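(* Let $p$ be a prime with $p\equiv 7\pmod{12}$, or $p\in\{37,61,73,109,157,181,229,277\}$. Then for every $u\equiv 2,4\pmod 6$ there exists a perfect 2-D $(u\times p,4,2)$-OOC, and for every $u\equiv 0\pmod 6$ there exists a 2-D $(u\times p,4,2)$-OOC with exactly $J^*(u\times p)=\left\lfloor\frac{u}{4}\left(\left\lfloor\frac{up-1}{3}\left\lfloor\frac{up-2}{2}\right\rfloor\right\rfloor-1\right)\right\rfloor$ codewords.
   Context: A 2-D $(u\times v,4,2)$-OOC is a family $\mathcal C$ of $u\times v$ $(0,1)$-matrices of Hamming weight $4$ such that for all $A=(a_{ij}),B=(b_{ij})\in\mathcal C$ and integers $r$ with $A\ne B$ or $r\not\equiv0\pmod v$, $\sum_{i,j}a_{ij}b_{i,j+r}\le 2$ (column indices mod $v$). It is perfect if it has exactly $u(uv-1)(uv-2)/24$ codewords. *)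

(* Defs.v *)
From mathcomp Require Import all_boot all_order all_algebra.
Set Implicit Arguments. Unset Strict Implicit. Unset Printing Implicit Defensive.

(* Column index j + r taken mod v (v > 0 follows from the existence of j). *)
Definition colshift (v : nat) (j : 'I_v) (r : nat) : 'I_v :=
  Ordinal (ltn_pmod (j + r) (leq_ltn_trans (leq0n j) (ltn_ord j))).

Definition mx_weight (u v : nat) (A : 'M[bool]_(u, v)) : nat :=
  \sum_(i < u) \sum_(j < v) (A i j : nat).

Definition corr (u v : nat) (A B : 'M[bool]_(u, v)) (r : nat) : nat :=
  \sum_(i < u) \sum_(j < v) ((A i j && B i (colshift j r)) : nat).

(* A 2-D (u x v, 4, 2)-OOC.  Shifts r range over nat, which covers all
   residues of integer shifts mod v. *)
Definition is_OOC_4_2 (u v : nat) (C : {set 'M[bool]_(u, v)}) : Prop :=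
  (forall A, A \in C -> mx_weight A = 4) /\
  (forall A B (r : nat), A \in C -> B \in C -> (A != B) || (r %% v != 0) ->
     corr A B r <= 2).

(* Perfect: exactly u(uv-1)(uv-2)/24 codewords (stated without division). *)
Definition is_perfect_OOC_4_2 (u v : nat) (C : {set 'M[bool]_(u, v)}) : Prop :=
  is_OOC_4_2 C /\ 24 * #|C| = u * (u * v - 1) * (u * v - 2).

Definition Jstar (u p : nat) : nat :=
  (u * (((u * p - 1) * ((u * p - 2) %/ 2)) %/ 3 - 1)) %/ 4.

(* Main.v *)
(** A design on F_p x U that is invariant under the translations of F_p yields
    the code: 4 is invertible mod p, so every translation orbit of blocks has
    exactly one member whose F_p-coordinates sum to 0, and these members are the
    codewords.  Two codewords meeting in three points after a shift would be
    translates of one another, by uniqueness of the block through three points.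

    The invariant design has three kinds of blocks.  Inside a fibre one places an
    SQS(u) when u = 2, 4 mod 6 (Hanani's theorem, proved by doubling, candelabra
    systems and fans), and when u = 0 mod 6 the packing that completes a
    G-design with groups of size 6 by three blocks in every group.  Triples with
    two points in one fibre are covered through a one-factorization of K_u.
    Triples in three fibres are covered by an H-design on F_p x {0, 1}, inflated
    by weights that sum to zero.

    The H-design starts from a translation-invariant system on F_p that covers
    every triple once, except the cubic triangles t + c{1, w, w^2} with w^3 = 1
    and c in a set C containing exactly one of c, -c.  For p = 7 mod 12 its
    blocks are the equianharmonic quadruples of one orientation; for the listed
    primes they are orbits of base blocks under an affine group of index 4 or 8.
    A missing triangle in one layer is closed by an apex in the other layer, and
    for a pair x, y of a layer the remaining points of the other layer are
    matched as consecutive terms of the progression x + k(x - y); a parity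
    condition on the apices makes this matching possible. *)

From Stdlib Require Import NArith.
Require Import Defs.
From mathcomp Require Import all_boot all_order all_algebra.
From mathcomp Require Import fingroup cyclic finfield boolp zify ring.
Set Implicit Arguments. Unset Strict Implicit. Unset Printing Implicit Defensive.
Import GRing.Theory.

(** * Designs *)

(* [R x y z w] reads: {x, y, z, w} is a block.  Every triple of [D] lies in
   exactly one block, and blocks contain no other triples. *)
Record design (T : Type) (D : T -> T -> T -> Prop) (R : T -> T -> T -> T -> Prop) : Prop := Design {
  design_swap12 : forall x y z w, R x y z w -> R y x z w;
  design_swap23 : forall x y z w, R x y z w -> R x z y w;
  design_swap34 : forall x y z w, R x y z w -> R x y w z;
  design_dom : forall x y z w, R x y z w -> D x y z;
  design_ex : forall x y z, D x y z -> exists w, R x y z w;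
  design_uniq : forall x y z w w', R x y z w -> R x y z w' -> w = w' }.

Definition has_design (T : Type) (D : T -> T -> T -> Prop) := exists R, design D R.

Definition distinct3 (T : eqType) (x y z : T) := [&& x != y, x != z & y != z].

Definition sqs (T : eqType) := has_design (fun x y z : T => distinct3 x y z).

Lemma perm_eq_swap12 (T : eqType) (x y z w : T) : perm_eq [:: x; y; z; w] [:: y; x; z; w].
Proof. by apply/permP => a /=; lia. Qed.

Lemma perm_eq_swap23 (T : eqType) (x y z w : T) : perm_eq [:: x; y; z; w] [:: x; z; y; w].
Proof. by apply/permP => a /=; lia. Qed.

Lemma perm_eq_swap34 (T : eqType) (x y z w : T) : perm_eq [:: x; y; z; w] [:: x; y; w; z].
Proof. by apply/permP => a /=; lia. Qed.

Lemma distinct3C12 (T : eqType) (x y z : T) : distinct3 x y z = distinct3 y x z.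
Proof. by rewrite /distinct3 eq_sym [X in _ && X]andbC. Qed.

Lemma distinct3C23 (T : eqType) (x y z : T) : distinct3 x y z = distinct3 x z y.
Proof. by rewrite /distinct3 andbCA [y == z]eq_sym. Qed.

Lemma distinct3_inj (T T' : eqType) (f : T -> T') (x y z : T) :
  injective f -> distinct3 (f x) (f y) (f z) = distinct3 x y z.
Proof. by move=> f_inj; rewrite /distinct3 !(inj_eq f_inj). Qed.

Lemma uniq4_distinct3 (T : eqType) (x y z w : T) : uniq [:: x; y; z; w] -> distinct3 x y z.
Proof. by rewrite /= !inE !negb_or /distinct3 => /and4P [/and3P [-> -> _] /andP [-> _] _ _]. Qed.

Section Designs.
Variable T : Type.
Implicit Types (D : T -> T -> T -> Prop) (R : T -> T -> T -> T -> Prop).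

Lemma design_of_unique_completion D R :
  (forall x y z w, R x y z w -> R y x z w) -> (forall x y z w, R x y z w -> R x z y w) ->
  (forall x y z w, R x y z w -> R x y w z) -> (forall x y z w, R x y z w -> D x y z) ->
  (forall x y z, D x y z -> exists! w, R x y z w) -> design D R.
Proof.
move=> s12 s23 s34 dom completion; split=> //.
  by move=> x y z /completion [w []]; exists w.
by move=> x y z w w' h; have [v [_ u]] := completion _ _ _ (dom _ _ _ _ h); move: (h) => /u <- /u <-.
Qed.

Lemma unique_completion_swap12 R x y z : (forall x y z w, R x y z w -> R y x z w) ->
  (exists! w, R x y z w) -> exists! w, R y x z w.
Proof. by move=> s12 [w [h u]]; exists w; split=> [|w' /s12 /u //]; apply: s12. Qed.

Lemma unique_completion_swap23 R x y z : (forall x y z w, R x y z w -> R x z y w) ->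
  (exists! w, R x y z w) -> exists! w, R x z y w.
Proof. by move=> s23 [w [h u]]; exists w; split=> [|w' /s23 /u //]; apply: s23. Qed.

Lemma eq_design D D' R : (forall x y z, D x y z <-> D' x y z) -> design D R -> design D' R.
Proof.
move=> eqD [s12 s23 s34 dom ex un]; split=> //; first by move=> *; apply/eqD; apply: dom; eauto.
by move=> a b c /eqD; apply: ex.
Qed.

Lemma eq_has_design D D' :
  (forall x y z, D x y z <-> D' x y z) -> has_design D -> has_design D'.
Proof. by move=> eqD [R dR]; exists R; apply: eq_design dR. Qed.

Lemma design_empty D : (forall x y z, ~ D x y z) -> design D (fun _ _ _ _ => False).
Proof. by move=> D0; split=> // x y z /D0. Qed.

Lemma has_design_empty D : (forall x y z, ~ D x y z) -> has_design D.
Proof. by move=> D0; exists (fun _ _ _ _ => False); apply: design_empty. Qed.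

Lemma design_bigcup (I : Type) (D : I -> T -> T -> T -> Prop) (R : I -> T -> T -> T -> T -> Prop) :
  (forall i, design (D i) (R i)) ->
  (forall i j x y z, D i x y z -> D j x y z -> i = j) ->
  design (fun x y z => exists i, D i x y z) (fun x y z w => exists i, R i x y z w).
Proof.
move=> dR disjoint; split.
- by move=> x y z w [i h]; exists i; apply: design_swap12 (dR i) _ _ _ _ h.
- by move=> x y z w [i h]; exists i; apply: design_swap23 (dR i) _ _ _ _ h.
- by move=> x y z w [i h]; exists i; apply: design_swap34 (dR i) _ _ _ _ h.
- by move=> x y z w [i h]; exists i; apply: design_dom (dR i) _ _ _ _ h.
- by move=> x y z [i /(design_ex (dR i)) [w h]]; exists w, i.
move=> x y z w w' [i h] [j h']; apply: (design_uniq (dR i) h).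
by rewrite (disjoint i j x y z (design_dom (dR i) h) (design_dom (dR j) h')).
Qed.

Lemma has_design_bigcup (I : Type) (D : I -> T -> T -> T -> Prop) :
  (forall i, has_design (D i)) -> (forall i j x y z, D i x y z -> D j x y z -> i = j) ->
  has_design (fun x y z => exists i, D i x y z).
Proof.
move=> dD disjoint; pose R i := cid (dD i).
by eexists; apply: design_bigcup disjoint => i; apply: svalP (R i).
Qed.

Lemma design_union D1 D2 R1 R2 : (forall x y z, D1 x y z -> D2 x y z -> False) ->
  design D1 R1 -> design D2 R2 ->
  design (fun x y z => D1 x y z \/ D2 x y z) (fun x y z w => R1 x y z w \/ R2 x y z w).
Proof.
move=> disjoint [s12 s23 s34 dom ex un] [s12' s23' s34' dom' ex' un']; split.
- by move=> x y z w [/s12|/s12']; [left|right].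
- by move=> x y z w [/s23|/s23']; [left|right].
- by move=> x y z w [/s34|/s34']; [left|right].
- by move=> x y z w [/dom|/dom']; [left|right].
- by move=> x y z [/ex|/ex'] [w]; exists w; [left|right].
move=> x y z w w' [h|h] [h'|h'].
- exact: un h h'.
- by case: (disjoint x y z (dom _ _ _ _ h) (dom' _ _ _ _ h')).
- by case: (disjoint x y z (dom _ _ _ _ h') (dom' _ _ _ _ h)).
exact: un' h h'.
Qed.

Lemma has_design_union D1 D2 : (forall x y z, D1 x y z -> D2 x y z -> False) ->
  has_design D1 -> has_design D2 -> has_design (fun x y z => D1 x y z \/ D2 x y z).
Proof. by move=> disjoint [R1 d1] [R2 d2]; eexists; apply: design_union disjoint d1 d2. Qed.

Lemma has_design_inj (A : Type) (f : A -> T) (DA : A -> A -> A -> Prop) D : injective f ->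
  (forall x y z, D x y z -> [/\ exists a, x = f a, exists b, y = f b & exists c, z = f c]) ->
  (forall a b c, D (f a) (f b) (f c) <-> DA a b c) -> has_design DA -> has_design D.
Proof.
move=> f_inj range eqD [R [s12 s23 s34 dom ex un]].
exists (fun x y z w => exists a b c d, [/\ x = f a, y = f b, z = f c, w = f d & R a b c d]); split.
- by move=> x y z w [a [b [c [d [-> -> -> -> /s12 h]]]]]; exists b, a, c, d.
- by move=> x y z w [a [b [c [d [-> -> -> -> /s23 h]]]]]; exists a, c, b, d.
- by move=> x y z w [a [b [c [d [-> -> -> -> /s34 h]]]]]; exists a, b, d, c.
- by move=> x y z w [a [b [c [d [-> -> -> _ /dom h]]]]]; apply/eqD.
- move=> x y z h; case: (range _ _ _ h) => -[a ea] [b eb] [c ec]; subst x y z.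
  by have /eqD/ex [d r] := h; exists (f d), a, b, c, d.
move=> x y z w w' [a [b [c [d [-> -> -> -> h]]]]] [a' [b' [c' [d' [/f_inj ea /f_inj eb /f_inj ec -> h']]]]].
by subst a' b' c'; rewrite (un _ _ _ _ _ h h').
Qed.

Lemma has_design_image (A : Type) (f : A -> T) (DA : A -> A -> A -> Prop) : injective f ->
  has_design DA ->
  has_design (fun x y z => exists a b c, [/\ x = f a, y = f b, z = f c & DA a b c]).
Proof.
move=> f_inj; apply: (has_design_inj f_inj) => [x y z [a [b [c [-> -> -> _]]]]|a b c].
  by split; [exists a|exists b|exists c].
by split=> [[a' [b' [c' [/f_inj -> /f_inj -> /f_inj ->]]]]|h]; last by exists a, b, c.
Qed.

Lemma design_preim (A : Type) (f : A -> T) D R : bijective f -> design D R ->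
  design (fun x y z => D (f x) (f y) (f z)) (fun x y z w => R (f x) (f y) (f z) (f w)).
Proof.
move=> [g fK gK] [s12 s23 s34 dom ex un]; split; try by move=> x y z w; eauto.
  by move=> x y z /ex [w h]; exists (g w); rewrite gK.
by move=> x y z w w' h h'; apply: (can_inj fK); apply: un h h'.
Qed.

End Designs.

Lemma has_design_bij (A T : Type) (f : A -> T) (DA : A -> A -> A -> Prop) (D : T -> T -> T -> Prop) :
  bijective f ->
  (forall a b c, DA a b c <-> D (f a) (f b) (f c)) -> has_design D -> has_design DA.
Proof.
move=> f_bij eqD [R dR]; eexists.
by apply: (eq_design _ (design_preim f_bij dR)) => a b c; rewrite eqD.
Qed.

Section DesignBlocks.
Variables (T : eqType) (D : T -> T -> T -> Prop) (R : T -> T -> T -> T -> Prop).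
Hypothesis dR : design D R.

Lemma design_perm a b c d x y z w :
  perm_eq [:: x; y; z; w] [:: a; b; c; d] -> R a b c d -> R x y z w.
Proof.
have swap12 := design_swap12 dR; have swap23 := design_swap23 dR; have swap34 := design_swap34 dR.
case/(perm_iotaP a) => Is; rewrite -mem_permutations !inE.
by do ?[case/orP]; move/eqP => -> [-> -> -> ->] /=; eauto 8.
Qed.

Lemma design_block_uniq x y z w :
  (forall x y z, D x y z -> distinct3 x y z) -> R x y z w -> uniq [:: x; y; z; w].
Proof.
move=> D3 h; have /and3P [xy xz yz] := D3 _ _ _ (design_dom dR h).
have /and3P [_ xw yw] := D3 _ _ _ (design_dom dR (design_swap34 dR h)).
have /and3P [_ _ zw] := D3 _ _ _ (design_dom dR (design_swap34 dR (design_swap23 dR h))).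
by rewrite /= !inE !negb_or xy xz yz xw yw zw.
Qed.

End DesignBlocks.

Lemma card_bij (A B : finType) : #|A| = #|B| -> exists f : A -> B, bijective f.
Proof.
move=> e; exists (fun a => enum_val (cast_ord e (enum_rank a))).
exists (fun b => enum_val (cast_ord (esym e) (enum_rank b))).
- by move=> a; rewrite enum_valK cast_ordK enum_rankK.
by move=> b; rewrite enum_valK cast_ordKV enum_rankK.
Qed.

Lemma sqs_card (A B : finType) : #|A| = #|B| -> sqs A -> sqs B.
Proof.
move/esym/card_bij => [f f_bij]; apply: (has_design_bij f_bij) => x y z.
by rewrite distinct3_inj //; apply: bij_inj.
Qed.

Lemma sqs_bool : sqs bool.
Proof. by apply: has_design_empty => -[] [] []. Qed.

(** * One-factorizations and fibred designs *)

Definition neq_rel (U : eqType) : rel U := fun x y => x != y.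

Record one_factorization (U : eqType) (e : rel U) (K : Type) (c : U -> U -> K) : Prop := OneFactorization {
  edge_sym : symmetric e;
  colour_sym : forall x y, c x y = c y x;
  colour_ex : forall x y z, e x y -> exists2 w, e z w & c z w = c x y;
  colour_inj : forall z w w', e z w -> e z w' -> c z w = c z w' -> w = w' }.

(* The colouring of the complete graph on Z_(2n+1) and a point at infinity by
   the sums x + y, where x + x is the colour of the edge from x to infinity. *)
Lemma one_factorization_option_Zp (n : nat) :
  exists c : option 'I_n.*2.+1 -> option 'I_n.*2.+1 -> 'I_n.*2.+1, one_factorization (@neq_rel _) c.
Proof.
pose c (a b : option 'I_n.*2.+1) : 'I_n.*2.+1 := match a, b with
  | Some x, Some y => (x + y)%R | Some x, None => (x + x)%R
  | None, Some y => (y + y)%R | None, None => 0%R end.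
have halfK (x : 'I_n.*2.+1) : (x *+ n.+1 + x *+ n.+1 = x)%R.
  rewrite -mulrnDr addSn addnS addnn mulrSr.
  suff -> : (x *+ n.*2.+1 = 0)%R by rewrite add0r.
  by apply: val_inj; rewrite Zp_mulrn /= modnMl.
have double_surj (x : 'I_n.*2.+1) : exists y, (y + y = x)%R by exists (x *+ n.+1)%R.
have double_inj (x y : 'I_n.*2.+1) : (x + x = y + y)%R -> x = y.
  by move=> e; rewrite -(halfK x) -(halfK y) -!mulrnDl e.
exists c; rewrite /neq_rel; split.
- by move=> x y; rewrite eq_sym.
- by move=> [x|] [y|] //=; rewrite addrC.
- move=> x y [z|] _; last by have [w hw] := double_surj (c x y); exists (Some w).
  case: (eqVneq (c x y) (z + z)%R) => [->|c_neq]; first by exists None.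
  exists (Some (c x y - z)%R); last by rewrite /= addrC subrK.
  by apply: contra_neq c_neq => -[{2}->]; rewrite addrC subrK.
move=> [z|] [w|] [w'|] //=.
- by move=> _ _ /addrI ->.
- by move=> zw _ /addrI e; rewrite e eqxx in zw.
- by move=> _ zw /addrI e; rewrite e eqxx in zw.
by move=> _ _ /double_inj ->.
Qed.

Lemma one_factorization_even (U : finType) :
  ~~ odd #|U| -> exists K (c : U -> U -> K), one_factorization (@neq_rel _) c.
Proof.
case: (posnP #|U|) => [/card0_eq U0|Upos] even_U.
  by exists unit, (fun _ _ => tt); split=> [x|//|x|x]; rewrite /neq_rel; have := U0 x; rewrite !inE.
pose n := #|U|.-1./2; have [c [_ sym_c ex_c inj_c]] := one_factorization_option_Zp n.
have cardU : #|U| = #|{: option 'I_n.*2.+1}| by rewrite card_option card_ord /n; lia.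
have [f [g fK gK]] := card_bij cardU.
exists 'I_n.*2.+1, (fun x y => c (f x) (f y)); rewrite /neq_rel; split=> [x y|x y|x y z xy|z w w'].
- by rewrite eq_sym.
- exact: sym_c.
- have [|w zw cw] := ex_c (f x) (f y) (f z); first by rewrite /neq_rel (can_eq fK).
  by exists (g w); rewrite ?gK // -(can_eq fK) gK.
by move=> zw zw' /inj_c; rewrite /neq_rel !(can_eq fK) => /(_ zw zw'); apply: can_inj fK _ _.
Qed.

Section EdgePairs.
Variables (G U : eqType) (e : rel U) (K : Type) (c : U -> U -> K).
Hypothesis fc : one_factorization e c.
Local Notation T := (G * U)%type.
Implicit Types x y z w : T.

Definition edge_pair x y z w : Prop :=
  [/\ [/\ x.1 = y.1, z.1 = w.1 & x.1 != z.1], e x.2 y.2, e z.2 w.2 & c x.2 y.2 = c z.2 w.2].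
Definition edge_pair_block x y z w := [\/ edge_pair x y z w, edge_pair x z y w | edge_pair x w y z].
Definition edge_and_point x y z : Prop := [/\ x.1 = y.1, x.1 != z.1 & e x.2 y.2].
Definition edge_and_point_dom x y z := [\/ edge_and_point x y z, edge_and_point x z y | edge_and_point y z x].

Lemma edge_pairC x y z w : edge_pair x y z w -> edge_pair z w x y.
Proof. by case=> [[xy zw xz] exy ezw cE]; split=> //; split=> //; rewrite eq_sym. Qed.

Lemma edge_pair_swap12 x y z w : edge_pair x y z w -> edge_pair y x z w.
Proof.
case=> [[xy zw xz] exy ezw cE]; split=> //; first by split=> //; rewrite -xy.
  by rewrite (edge_sym fc).
by rewrite (colour_sym fc).
Qed.

Lemma edge_pair_swap34 x y z w : edge_pair x y z w -> edge_pair x y w z.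
Proof. by move=> /edge_pairC /edge_pair_swap12 /edge_pairC. Qed.

Lemma edge_pair_block_swap12 x y z w : edge_pair_block x y z w -> edge_pair_block y x z w.
Proof.
by case=> h; [apply/Or31/edge_pair_swap12|apply/Or33/edge_pairC|apply/Or32/edge_pairC].
Qed.

Lemma edge_pair_block_swap23 x y z w : edge_pair_block x y z w -> edge_pair_block x z y w.
Proof. by case=> h; [apply: Or32|apply: Or31|apply/Or33/edge_pair_swap34]. Qed.

Lemma edge_pair_block_swap34 x y z w : edge_pair_block x y z w -> edge_pair_block x y w z.
Proof. by case=> h; [apply/Or31/edge_pair_swap34|apply: Or33|apply: Or32]. Qed.

Lemma edge_pair_block_uniq x y z w w' : edge_pair x y z w -> edge_pair_block x y z w' -> w = w'.
Proof.
case=> [[xy zw xz] exy ezw cE] [] [[p q r] exy' ezw' cE'].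
- have e_w : w.2 = w'.2 by apply: (colour_inj fc ezw ezw'); rewrite -cE.
  by rewrite (surjective_pairing w) (surjective_pairing w') e_w -zw q.
- by rewrite p eqxx in xz.
by rewrite -q -xy eqxx in xz.
Qed.

Lemma edge_pair_design : design edge_and_point_dom edge_pair_block.
Proof.
have ex x y z : edge_and_point x y z -> exists w, edge_pair x y z w.
  by case=> xy xz exy; have [w zw cw] := colour_ex fc z.2 exy; exists (z.1, w).
split.
- exact: edge_pair_block_swap12.
- exact: edge_pair_block_swap23.
- exact: edge_pair_block_swap34.
- move=> x y z w [] [[xy zw xz] exy ezw cE]; [apply: Or31|apply: Or32|apply: Or33]; split=> //.
  by rewrite eq_sym.
- move=> x y z [/ex [w h]|/ex [w h]|/ex [w h]]; exists w; first exact: Or31.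
    exact: Or32.
  exact/Or33/edge_pairC.
move=> x y z w w' [h|h|h] h'; first exact: edge_pair_block_uniq h h'.
  by apply: edge_pair_block_uniq h _; apply: edge_pair_block_swap23.
apply: (@edge_pair_block_uniq y z x); first exact: edge_pairC.
by apply: edge_pair_block_swap23; apply: edge_pair_block_swap12.
Qed.

End EdgePairs.

Lemma fibre_design (G U : eqType) (D : U -> U -> U -> Prop) R : design D R ->
  design (fun x y z : G * U => [/\ x.1 = y.1, x.1 = z.1 & D x.2 y.2 z.2])
    (fun x y z w => [/\ x.1 = y.1, x.1 = z.1, x.1 = w.1 & R x.2 y.2 z.2 w.2]).
Proof.
case=> s12 s23 s34 dom ex un; split.
- by move=> x y z w [xy xz xw /s12 h]; split; congruence.
- by move=> x y z w [xy xz xw /s23 h]; split; congruence.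
- by move=> x y z w [xy xz xw /s34 h]; split; congruence.
- by move=> x y z w [xy xz _ /dom h].
- by move=> x y z [xy xz /ex [w h]]; exists (x.1, w).
move=> x y z w w' [_ _ e h] [_ _ e' h'].
by rewrite (surjective_pairing w) (surjective_pairing w') -e -e' (un _ _ _ _ _ h h').
Qed.

Definition gdom (G U : eqType) (p q r : G * U) : bool :=
  distinct3 p q r && ~~ ((p.1 == q.1) && (p.1 == r.1)).

Lemma edge_and_point_not_transversal (G U : eqType) (e : rel U) (p q r : G * U) :
  edge_and_point_dom e p q r -> ~~ distinct3 p.1 q.1 r.1.
Proof. by case=> [] [-> _ _]; rewrite /distinct3 eqxx ?andbF. Qed.

Lemma gdomE (G U : eqType) (p q r : G * U) :
  gdom p q r <-> edge_and_point_dom (@neq_rel U) p q r \/ distinct3 p.1 q.1 r.1.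
Proof.
case: p q r => [i a] [j b] [k d].
rewrite /gdom /edge_and_point_dom /edge_and_point /neq_rel /distinct3 /= !xpair_eqE.
have [<-|ij] := eqVneq i j; have [<-|ik] := eqVneq i k; rewrite /= ?andbT ?andbF.
- by split=> [//|[[] [] //|//]].
- split=> [ab|]; first by left; apply: Or31.
  by case=> [[] [e]|] //; rewrite e eqxx in ik.
- rewrite (eq_sym j) (negPf ij) andbT; split=> [ad|]; first by left; apply: Or32.
  by case=> [[] [e]|] //; rewrite e eqxx in ij.
have [<-|jk] := eqVneq j k => /=; last by split=> // _; right.
split=> [bd|]; first by left; apply: Or33; split; rewrite // eq_sym.
by case=> [[] [e]|] //; rewrite e eqxx in ij.
Qed.

Section FibredDesign.
Variables (G U : eqType) (K : Type) (c : U -> U -> K).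
Hypothesis fc : one_factorization (@neq_rel _) c.
Variables (DU : U -> U -> U -> Prop) (RU : U -> U -> U -> U -> Prop).
Hypothesis dU : design DU RU.
Local Notation T := (G * U)%type.
Variable RH : T -> T -> T -> T -> Prop.
Hypothesis dH : design (fun x y z : T => distinct3 x.1 y.1 z.1) RH.
Implicit Types x y z w : T.

Definition fibred_dom x y z : Prop :=
  if (x.1 == y.1) && (x.1 == z.1) then DU x.2 y.2 z.2 else distinct3 x y z.

Definition fibred_block x y z w : Prop :=
  [/\ x.1 = y.1, x.1 = z.1, x.1 = w.1 & RU x.2 y.2 z.2 w.2] \/
  (edge_pair_block (@neq_rel U) c x y z w \/ RH x y z w).

Lemma fibred_domE x y z :
  [/\ x.1 = y.1, x.1 = z.1 & DU x.2 y.2 z.2] \/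
    (edge_and_point_dom (@neq_rel U) x y z \/ distinct3 x.1 y.1 z.1) <-> fibred_dom x y z.
Proof.
rewrite -gdomE /fibred_dom /gdom.
case: ifP => [/andP [/eqP <- /eqP <-]|same]; last first.
  by rewrite andbT; split=> [[[xy xz _]|//]|]; [rewrite -xy -xz eqxx in same|right].
by split=> [[[]|]|]; rewrite ?andbF //; left.
Qed.

Lemma fibred_design : design fibred_dom fibred_block.
Proof.
apply: eq_design fibred_domE _.
apply: design_union (fibre_design G dU) _ => [x y z [xy xz _]|].
  by rewrite -gdomE /gdom -xy -xz eqxx andbF.
apply: design_union (edge_pair_design G fc) dH => x y z.
by move/edge_and_point_not_transversal/negP.
Qed.

End FibredDesign.

Lemma bool_fibred_has_design (U : finType) (D : U -> U -> U -> Prop) : ~~ odd #|U| ->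
  has_design D -> has_design (@fibred_dom bool U D).
Proof.
move=> even_U [R dR]; have [K [c fc]] := one_factorization_even even_U.
have dH : design (fun x y z : bool * U => distinct3 x.1 y.1 z.1) (fun _ _ _ _ => False).
  by apply: design_empty => -[[] a] [[] b] [[] d].
by exists (fibred_block c R (fun _ _ _ _ => False)); apply: fibred_design.
Qed.

Lemma eq_fst (A B : eqType) (x y : A * B) : x.1 = y.1 -> (x == y) = (x.2 == y.2).
Proof. by case: x y => [a b] [a' b'] /= ->; rewrite xpair_eqE eqxx. Qed.

Lemma distinct3_fst (A B : eqType) (x y z : A * B) : x.1 = y.1 -> x.1 = z.1 ->
  distinct3 x y z = distinct3 x.2 y.2 z.2.
Proof. by move=> xy xz; rewrite /distinct3 !eq_fst // -xy. Qed.

Lemma sqs_double (U : finType) : ~~ odd #|U| -> sqs U -> sqs (bool * U)%type.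
Proof.
move=> even_U /(bool_fibred_has_design even_U); apply: eq_has_design => x y z.
by rewrite /fibred_dom; case: ifP => // /andP [/eqP xy /eqP xz]; rewrite distinct3_fst.
Qed.

(** * Candelabra systems *)

Section Candelabra.
Variables S G W : eqType.
Local Notation T := (S + G * W)%type.
Implicit Types (x y z : T) (P : pred G).

Definition cross x y : bool :=
  if x is inr p then if y is inr q then p.1 != q.1 else false else false.
Definition groups_in P x : bool := if x is inr p then P p.1 else true.
Definition transversal3 x y z : bool := [&& cross x y, cross x z & cross y z].
Definition cqs_dom x y z : bool := distinct3 x y z && [|| cross x y, cross x z | cross y z].
Definition cqs := has_design (fun x y z => cqs_dom x y z).
Definition hdes := has_design (fun p q r : G * W => distinct3 p.1 q.1 r.1).
Definition gdes := has_design (fun p q r : G * W => gdom p q r).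

Lemma crossC x y : cross x y = cross y x.
Proof. by case: x y => [s|p] [t|q] //=; rewrite eq_sym. Qed.

Lemma cross_one_group i x y : groups_in (pred1 i) x -> groups_in (pred1 i) y -> cross x y = false.
Proof. by case: x y => [//|p] [//|q] /= /eqP -> /eqP ->; rewrite eqxx. Qed.

Lemma transversal3P x y z : transversal3 x y z ->
  exists p q r, [/\ x = inr p, y = inr q, z = inr r & distinct3 p.1 q.1 r.1].
Proof.
case: x y z => [s|p] [t|q] [u|r] //=; rewrite /transversal3 ?andbF //= => d.
by exists p, q, r.
Qed.

Lemma distinct3_of_fst (p q r : G * W) : distinct3 p.1 q.1 r.1 -> distinct3 p q r.
Proof.
have neq_of_fst (a b : G * W) : a.1 != b.1 -> a != b by apply: contra_neq => ->.
by case/and3P => pq pr qr; rewrite /distinct3 !neq_of_fst.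
Qed.

Lemma transversal3_cqs_dom x y z : transversal3 x y z -> cqs_dom x y z.
Proof.
move=> tr; have /and3P [xy _ _] := tr; rewrite /cqs_dom xy andbT.
have [p [q [r [-> -> -> /distinct3_of_fst d]]]] := transversal3P tr.
by rewrite distinct3_inj //; apply: inr_inj.
Qed.

Lemma cqs_dom_groups x y z : cqs_dom x y z ->
  exists i j, i != j /\ forall P, groups_in P x -> groups_in P y -> groups_in P z -> P i && P j.
Proof.
have cross_groups u v : cross u v ->
    exists i j, i != j /\ forall P, groups_in P u -> groups_in P v -> P i && P j.
  by case: u v => [//|p] [//|q] /= pq; exists p.1, q.1; split=> // P -> ->.
by case/andP => _ /or3P [] /cross_groups [i [j [ij Pij]]]; exists i, j; split=> // P Px Py Pz;
  apply: Pij.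
Qed.

Lemma cqs_dom_cases x y z : cqs_dom x y z -> transversal3 x y z \/
  exists i j, i != j /\ [&& groups_in (pred2 i j) x, groups_in (pred2 i j) y & groups_in (pred2 i j) z].
Proof.
case/andP => _; case: x y z => [s|[i a]] [t|[j b]] [u|[k c]] //=; rewrite ?orbF => neq.
- by right; exists j, k; rewrite neq !eqxx orbT.
- by right; exists i, k; rewrite neq !eqxx orbT.
- by right; exists i, j; rewrite neq !eqxx orbT.
have [eij|ij] := eqVneq i j; first subst j.
  by right; exists i, k; rewrite eqxx orbb /= in neq; rewrite neq !eqxx ?orbT.
have [eik|ik] := eqVneq i k; first by subst k; right; exists i, j; rewrite ij !eqxx ?orbT.
have [ejk|jk] := eqVneq j k; first by subst k; right; exists i, j; rewrite ij !eqxx ?orbT.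
by left; rewrite /transversal3 /= ij ik jk.
Qed.

End Candelabra.

Lemma cqs_card (S G W S' G' W' : finType) : #|S| = #|S'| -> #|G| = #|G'| -> #|W| = #|W'| ->
  cqs S G W -> cqs S' G' W'.
Proof.
move=> /esym/card_bij [f bf] /esym/card_bij [g bg] /esym/card_bij [h bh].
have [f' fK f'K] := bf; have [g' gK g'K] := bg; have [h' hK h'K] := bh.
pose F (x : S' + G' * W') : S + G * W :=
  match x with inl s => inl (f s) | inr p => inr (g p.1, h p.2) end.
pose F' (x : S + G * W) : S' + G' * W' :=
  match x with inl s => inl (f' s) | inr p => inr (g' p.1, h' p.2) end.
have bF : bijective F.
  exists F'; first by move=> [s|[a b]] /=; rewrite ?fK ?gK ?hK.
  by move=> [s|[a b]] /=; rewrite ?f'K ?g'K ?h'K.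
apply: (has_design_bij bF) => x y z; rewrite /cqs_dom distinct3_inj; last exact: bij_inj.
suff crossF u v : cross (F u) (F v) = cross u v by rewrite !crossF.
by case: u v => [s|[a b]] [t|[c d]] //=; rewrite (can_eq gK).
Qed.

Lemma hdes_card (G W G' W' : finType) : #|G| = #|G'| -> #|W| = #|W'| -> hdes G W -> hdes G' W'.
Proof.
move=> /esym/card_bij [g bg] /esym/card_bij [h bh].
have [g' gK g'K] := bg; have [h' hK h'K] := bh.
have bF : bijective (fun p : G' * W' => (g p.1, h p.2)).
  by exists (fun p => (g' p.1, h' p.2)) => -[a b] /=; rewrite ?gK ?hK ?g'K ?h'K.
by apply: (has_design_bij bF) => p q r; rewrite (distinct3_inj _ _ _ (can_inj gK)).
Qed.

Lemma inr_bij (A : Type) : bijective (inr : A -> 'I_0 + A).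
Proof.
have no_ord0 (i : 'I_0) : False by case: i.
exists (fun x => match x with inl i => False_rect A (no_ord0 i) | inr a => a end) => // -[i|//].
by case: (no_ord0 i).
Qed.

Lemma cqs_dom_inr (S G W : eqType) (p q r : G * W) :
  cqs_dom (inr p : S + _) (inr q) (inr r) = gdom p q r.
Proof.
rewrite /cqs_dom /gdom distinct3_inj; last exact: inr_inj.
by rewrite /=; case: (eqVneq p.1 q.1) => [<-|]; rewrite //= orbb.
Qed.

Lemma gdes_cqs (G W : eqType) : gdes G W <-> cqs 'I_0 G W.
Proof.
split; last by apply: (has_design_bij (inr_bij _)) => p q r; rewrite cqs_dom_inr.
apply: (has_design_inj (f := inr) inr_inj) => [x y z _|p q r]; last by rewrite cqs_dom_inr.
by split; case: x y z => [[] //|p] [[] //|q] [[] //|r]; [exists p|exists q|exists r].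
Qed.

Lemma gdes_card (G W G' W' : finType) : #|G| = #|G'| -> #|W| = #|W'| -> gdes G W -> gdes G' W'.
Proof. by move=> eG eW /gdes_cqs h; apply/gdes_cqs; apply: cqs_card h. Qed.

Section Subgroups.
Variables (S G W : eqType) (P : pred G).

Lemma cqs_subgroups : cqs S {i | P i} W -> has_design (fun x y z : S + G * W =>
  [&& cqs_dom x y z, groups_in P x, groups_in P y & groups_in P z]).
Proof.
pose f (x : S + {i | P i} * W) : S + G * W :=
  match x with inl s => inl s | inr p => inr (val p.1, p.2) end.
have f_inj : injective f by move=> [s|[i a]] [t|[j b]] //= [] => [->|/val_inj -> ->].
have range x : groups_in P x -> exists a, x = f a.
  by case: x => [s|[i a]] /= Pi; [exists (inl s)|exists (inr (exist _ i Pi, a))].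
have Pf x : groups_in P (f x) by case: x => [//|[[i Pi] a]].
have crossf x y : cross (f x) (f y) = cross x y by case: x y => [s|[i a]] [t|[j b]].
apply: (has_design_inj f_inj) => [x y z /and4P [_ /range ? /range ? /range ?] //|x y z].
by rewrite !Pf !andbT /cqs_dom distinct3_inj // !crossf.
Qed.

Lemma hdes_subgroups : hdes {i | P i} W -> has_design (fun x y z : S + G * W =>
  [&& transversal3 x y z, groups_in P x, groups_in P y & groups_in P z]).
Proof.
pose f (p : {i | P i} * W) : S + G * W := inr (val p.1, p.2).
have f_inj : injective f by move=> [i a] [j b] [/val_inj -> ->].
have range p : P p.1 -> exists a, inr p = f a.
  by case: p => i a /= Pi; exists (exist _ i Pi, a).
apply: (has_design_inj f_inj) => [x y z /and4P []|p q r].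
  by case/transversal3P => p [q [r [-> -> -> _ /range ? /range ? /range ?]]].
by rewrite /= !(valP (_ : {i | P i})) !andbT.
Qed.

End Subgroups.

Section FillGroups.
Variables S G W : eqType.
Local Notation T := (S + G * W)%type.

Definition nonstem (A B : eqType) (x y z : A + B) : bool :=
  distinct3 x y z && ~~ [&& is_inl x, is_inl y & is_inl z].

Definition one_group (i : G) (x y z : T) : bool :=
  [&& nonstem x y z, groups_in (pred1 i) x, groups_in (pred1 i) y & groups_in (pred1 i) z].

Lemma one_group_has_design i :
  has_design (fun x y z : S + W => nonstem x y z) -> has_design (fun x y z => one_group i x y z).
Proof.
pose f (a : S + W) : T := match a with inl s => inl s | inr w => inr (i, w) end.
have f_inj : injective f by move=> [s|w] [t|v] //= [->].
have range x : groups_in (pred1 i) x -> exists a, x = f a.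
  by case: x => [s|[j w]] => [_|/eqP /= ->]; [exists (inl s)|exists (inr w)].
apply: (has_design_inj f_inj) => [x y z /and4P [_ /range ? /range ? /range ?] //|a b c].
rewrite /one_group /nonstem distinct3_inj //.
by case: a b c => [s|u] [t|v] [r|w]; rewrite /= ?eqxx ?andbT ?andbF.
Qed.

Lemma one_group_inj i j x y z : one_group i x y z -> one_group j x y z -> i = j.
Proof.
have group_eq u : ~~ is_inl u -> groups_in (pred1 i) u -> groups_in (pred1 j) u -> i = j.
  by case: u => //= p _ /eqP <- /eqP <-.
case/and4P => /andP [_ + xi yi zi] /and4P [_ xj yj zj]; rewrite !negb_and => /or3P [] ns.
- exact: group_eq xi xj.
- exact: group_eq yi yj.
exact: group_eq zi zj.
Qed.

Lemma distinct3_candelabra (x y z : T) : distinct3 x y z <->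
  cqs_dom x y z \/ ((exists i, one_group i x y z) \/
    exists a b c, [/\ x = inl a, y = inl b, z = inl c & distinct3 a b c]).
Proof.
have inl_distinct3 := distinct3_inj _ _ _ (@inl_inj S (G * W)).
split=> [d|[/andP [] //|[[i /andP [/andP []] //]|[a [b [c [-> -> ->]]]]]]]; last by rewrite inl_distinct3.
rewrite /cqs_dom /one_group /nonstem d /=.
case: (boolP [|| cross x y, cross x z | cross y z]) => [_|]; first by left.
move=> not_cross; right; move: not_cross; case: x y z d => [s|[i a]] [t|[j b]] [u|[k c]] /= d;
  rewrite ?orbF ?negb_or ?negbK.
- by right; exists s, t, u; rewrite -inl_distinct3.
- by left; exists k; rewrite eqxx.
- by left; exists j; rewrite eqxx.
- by move=> jk; left; exists j; rewrite eqxx eq_sym jk.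
- by left; exists i; rewrite eqxx.
- by move=> ik; left; exists i; rewrite eqxx eq_sym ik.
- by move=> ij; left; exists i; rewrite eqxx eq_sym ij.
by case/and3P => ij ik _; left; exists i; rewrite eqxx !(eq_sym _ i) ij ik.
Qed.

Lemma sqs_of_cqs :
  cqs S G W -> has_design (fun x y z : S + W => nonstem x y z) -> sqs S -> sqs T.
Proof.
move=> cqs_SGW fill sqs_S; apply: eq_has_design (fun x y z => iff_sym (distinct3_candelabra x y z)) _.
apply: has_design_union cqs_SGW _ => [x y z /andP [_ crosses] [[i]|[a [b [c [ex ey ez _]]]]]|].
- case/and4P => _ xi yi zi; move: crosses.
  by rewrite (cross_one_group xi yi) (cross_one_group xi zi) (cross_one_group yi zi).
- by rewrite ex ey ez in crosses.
apply: has_design_union (has_design_image (@inl_inj S (G * W)) sqs_S) => [x y z [i /andP [/andP [_ ns] _]]|].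
  by case=> a [b [c [ex ey ez _]]]; rewrite ex ey ez in ns.
by apply: has_design_bigcup one_group_inj => i; apply: one_group_has_design.
Qed.

End FillGroups.

Lemma sqs_of_cqs2 (G W : finType) : cqs bool G W -> sqs (bool + W)%type -> sqs (bool + G * W)%type.
Proof.
move=> cqs_GW sqs_W; apply: sqs_of_cqs cqs_GW _ sqs_bool; apply: eq_has_design sqs_W.
by move=> [[]|a] [[]|b] [[]|c]; rewrite /nonstem ?andbT.
Qed.

(** * The fan construction *)

Lemma weight_design (A : Type) (U : zmodType) (D : A -> A -> A -> Prop) R : design D R ->
  design (fun x y z : A * U => D x.1 y.1 z.1)
    (fun x y z w : A * U => R x.1 y.1 z.1 w.1 /\ (x.2 + y.2 + z.2 + w.2 = 0)%R).
Proof.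
move=> [s12 s23 s34 dom ex un]; split.
- by move=> x y z w [/s12 h e]; split; rewrite // [(y.2 + x.2)%R]addrC.
- by move=> x y z w [/s23 h e]; split; rewrite // [(x.2 + z.2 + y.2)%R]addrAC.
- by move=> x y z w [/s34 h e]; split; rewrite // addrAC.
- by move=> x y z w [/dom].
- by move=> x y z /ex [w h]; exists (w, - (x.2 + y.2 + z.2))%R; rewrite /= subrr.
move=> x y z w w' [h e] [h' e']; have eq_w : w.2 = w'.2 by move: e; rewrite -e' => /addrI.
by rewrite (surjective_pairing w) (surjective_pairing w') eq_w (un _ _ _ _ _ h h').
Qed.

Lemma has_design_when (T : Type) (P : Prop) (D : T -> T -> T -> Prop) :
  (P -> has_design D) -> has_design (fun x y z => P /\ D x y z).
Proof.
case: (pselect P) => [p /(_ p)|np _].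
  by apply: eq_has_design => x y z; split=> [|[]].
by apply: has_design_empty => x y z [].
Qed.

Definition class_dom (I K : eqType) (cl : I -> K) (i j k : I) : bool :=
  distinct3 i j k && ~~ ((cl i == cl j) && (cl i == cl k)).

(* A design on the points I + {None} covers the triples not contained in a class
   of cl.  Every point i of I is replaced by a group {i} x W.  The blocks through
   None become candelabra systems on three groups, the other blocks become
   blocks of weight zero, and the triples with groups in a class are covered
   separately. *)
Section Fan.
Variables (I : finType) (K : eqType) (cl : option I -> K) (S : eqType) (W : zmodType).
Variable R0 : option I -> option I -> option I -> option I -> Prop.
Hypothesis d0 : design (fun i j k => class_dom cl i j k) R0.
Local Notation T := (S + I * W)%type.
Implicit Types (x y z : T) (i j k : I) (A B : {set I}) (c : K).

Definition star i j k := R0 None (Some i) (Some j) (Some k).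
Definition star_set A : Prop := exists i j k, star i j k /\ A = [set i; j; k].
Definition infinity_class i : bool := cl (Some i) == cl None.

Lemma star_swap12 i j k : star i j k -> star j i k. Proof. exact: (design_swap23 d0). Qed.
Lemma star_swap23 i j k : star i j k -> star i k j. Proof. exact: (design_swap34 d0). Qed.
Lemma star_to_end i j k : star i j k -> R0 (Some i) (Some j) (Some k) None.
Proof. by move/(design_swap12 d0)/(design_swap23 d0)/(design_swap34 d0). Qed.

Lemma star_set_third A i j : star_set A -> i \in A -> j \in A -> i != j ->
  exists2 k, star i j k & A = [set i; j; k].
Proof.
case=> a [b [c [abc ->]]].
have [acb bac] := (star_swap23 abc, star_swap12 abc); have [cab bca] := (star_swap12 acb, star_swap23 bac).
have cba := star_swap12 bca.
have set_eq u v w : perm_eq [:: a; b; c] [:: u; v; w] -> [set a; b; c] = [set u; v; w].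
  by move/perm_mem => e; apply/setP => t; have := e t; rewrite !inE !orbA.
rewrite !inE -!orbA => /or3P [] /eqP -> /or3P [] /eqP ->; rewrite ?eqxx // => _.
- by exists c.
- by exists b => //; apply: set_eq; apply/permP => f /=; lia.
- by exists c => //; apply: set_eq; apply/permP => f /=; lia.
- by exists a => //; apply: set_eq; apply/permP => f /=; lia.
- by exists b => //; apply: set_eq; apply/permP => f /=; lia.
by exists a => //; apply: set_eq; apply/permP => f /=; lia.
Qed.

Lemma star_set_uniq A B i j : star_set A -> star_set B ->
  i \in A -> j \in A -> i \in B -> j \in B -> i != j -> A = B.
Proof.
move=> sA sB iA jA iB jB ij; have [k ijk eA] := star_set_third sA iA jA ij.
have [l ijl eB] := star_set_third sB iB jB ij.
by have [kl] := design_uniq d0 ijk ijl; rewrite eA eB kl.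
Qed.

Lemma star_neq i j k : star i j k -> distinct3 i j k.
Proof.
have neq u v w : star u v w -> u != v.
  by case/(design_dom d0)/andP => /and3P [_ _]; rewrite (inj_eq Some_inj).
move=> ijk; have ikj := star_swap23 ijk; rewrite /distinct3 (neq _ _ _ ijk) (neq _ _ _ ikj).
exact: neq (star_swap23 (star_swap12 ijk)).
Qed.

Lemma star_set_card A : star_set A -> #|A| = 3.
Proof.
case=> i [j [k [/star_neq/and3P [ij ik jk] ->]]].
by rewrite setUC cardsU1 cards2 !inE negb_or !(eq_sym k) ik jk ij.
Qed.

Lemma star_set_all A i j k : star_set A -> i \in A -> j \in A -> k \in A -> distinct3 i j k -> star i j k.
Proof.
move=> sA iA jA + /and3P [ij ik jk]; have [l hl ->] := star_set_third sA iA jA ij.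
by rewrite !inE !(eq_sym k) (negPf ik) (negPf jk) => /eqP <-.
Qed.

Definition star_dom A x y z : Prop :=
  star_set A /\ [&& cqs_dom x y z, groups_in (mem A) x, groups_in (mem A) y & groups_in (mem A) z].

Definition infinity_class_dom x y z : bool :=
  [&& cqs_dom x y z, groups_in infinity_class x, groups_in infinity_class y & groups_in infinity_class z].

Definition in_class c i : bool := cl (Some i) == c.

Definition other_class_dom c x y z : Prop := c != cl None /\
  [&& transversal3 x y z, groups_in (in_class c) x, groups_in (in_class c) y & groups_in (in_class c) z].

Definition finite_block_dom x y z : Prop := exists p q r,
  [/\ x = inr p, y = inr q, z = inr r & exists l, R0 (Some p.1) (Some q.1) (Some r.1) (Some l)].

Lemma star_dom_has_design : (forall A, #|A| = 3 -> cqs S {i | i \in A} W) ->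
  has_design (fun x y z => exists A, star_dom A x y z).
Proof.
move=> cqs3; apply: has_design_bigcup => [A|A B x y z [sA /and4P [d xA yA zA]] [sB /and4P [_ xB yB zB]]].
  apply: has_design_when => sA; exact/cqs_subgroups/cqs3/star_set_card.
have [i [j [ij inP]]] := cqs_dom_groups d.
have /andP [iA jA] := inP (mem A) xA yA zA; have /andP [iB jB] := inP (mem B) xB yB zB.
exact: star_set_uniq sA sB iA jA iB jB ij.
Qed.

Lemma finite_block_has_design : has_design finite_block_dom.
Proof.
have d_fin : design (fun i j k => exists l, R0 (Some i) (Some j) (Some k) (Some l))
    (fun i j k l => R0 (Some i) (Some j) (Some k) (Some l)).
  split=> [i j k l|i j k l|i j k l|i j k l h|i j k []|i j k l l' h h'].
  - exact: design_swap12 d0 _ _ _ _.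
  - exact: design_swap23 d0 _ _ _ _.
  - exact: design_swap34 d0 _ _ _ _.
  - by exists l.
  - by move=> l; exists l.
  by have [] := design_uniq d0 h h'.
exact: has_design_image inr_inj (ex_intro _ _ (weight_design W d_fin)).
Qed.

Lemma finite_block_class_dom p q r l : R0 (Some p) (Some q) (Some r) (Some l) ->
  distinct3 p q r /\ ~~ ((cl (Some p) == cl (Some q)) && (cl (Some p) == cl (Some r))).
Proof.
by move/(design_dom d0); rewrite /class_dom distinct3_inj; [case/andP|exact: Some_inj].
Qed.

Lemma star_infinity_class_disjoint A x y z : star_dom A x y z -> infinity_class_dom x y z -> False.
Proof.
case=> sA /and4P [d xA yA zA] /and4P [_ xc yc zc]; have [i [j [ij inP]]] := cqs_dom_groups d.
have /andP [iA jA] := inP (mem A) xA yA zA; have /andP [/eqP ic /eqP jc] := inP _ xc yc zc.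
have [k /(design_dom d0) + _] := star_set_third sA iA jA ij.
by rewrite /class_dom ic jc !eqxx andbF.
Qed.

Lemma star_finite_block_disjoint A x y z : star_dom A x y z -> finite_block_dom x y z -> False.
Proof.
case=> sA /and4P [_ xA yA zA] [p [q [r [ex ey ez [l h]]]]]; subst x y z.
have [d _] := finite_block_class_dom h; have /star_to_end h' := star_set_all sA xA yA zA d.
by have := design_uniq d0 h h'.
Qed.

Lemma star_other_class_disjoint A c x y z : star_dom A x y z -> other_class_dom c x y z -> False.
Proof.
case=> sA /and4P [_ xA yA zA] [_ /and4P [/transversal3P [p [q [r [ex ey ez d]]]]]]; subst x y z.
move=> /eqP pk /eqP qk /eqP rk; have /star_to_end/(design_dom d0) := star_set_all sA xA yA zA d.
by rewrite /class_dom pk qk rk !eqxx andbF.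
Qed.

Lemma finite_block_class_disjoint c x y z : finite_block_dom x y z ->
  groups_in (in_class c) x -> groups_in (in_class c) y -> groups_in (in_class c) z -> False.
Proof.
case=> p [q [r [-> -> -> [l /finite_block_class_dom [_ /negP nc]]]]] /eqP pc /eqP qc /eqP rc.
by case: nc; rewrite pc qc rc !eqxx.
Qed.

Lemma infinity_other_class_disjoint c x y z : infinity_class_dom x y z -> other_class_dom c x y z -> False.
Proof.
case/and4P => _ xc _ _ [kN /and4P [/transversal3P [p [q [r [ex _ _ _]]]] xk _ _]]; subst x.
by case/eqP: kN; rewrite -(eqP xk) (eqP xc).
Qed.

Lemma other_class_inj c c' x y z : other_class_dom c x y z -> other_class_dom c' x y z -> c = c'.
Proof.
case=> _ /and4P [/transversal3P [p [q [r [-> _ _ _]]]] /eqP <- _ _] [_ /and4P [_ /eqP <- _ _]].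
by [].
Qed.

Lemma cqs_dom_fan x y z : cqs_dom x y z <-> (exists A, star_dom A x y z) \/
  (infinity_class_dom x y z \/ (finite_block_dom x y z \/ exists c, other_class_dom c x y z)).
Proof.
split; last first.
  case=> [[A [_ /and4P [] //]]|[/and4P [] //|[[p [q [r [-> -> -> [l h]]]]]|[k [_ /and4P [tr _ _ _]]]]]].
    have [/and3P [pq pr qr] _] := finite_block_class_dom h.
    by apply: transversal3_cqs_dom; rewrite /transversal3 /= pq pr qr.
  exact: transversal3_cqs_dom.
move=> d; case: (cqs_dom_cases d) => [/transversal3P [p [q [r [ex ey ez dpqr]]]]|[i [j [ij in_ij]]]].
  case: (boolP ((cl (Some p.1) == cl (Some q.1)) && (cl (Some p.1) == cl (Some r.1)))) => [/andP [pq pr]|ncl].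
    right; case: (boolP (infinity_class p.1)) => [/eqP pN|pN]; [left|right; right].
      by rewrite /infinity_class_dom d ex ey ez /= /infinity_class -(eqP pq) -(eqP pr) pN eqxx.
    exists (cl (Some p.1)); split=> //; have /and3P [neq_pq neq_pr neq_qr] := dpqr.
    by rewrite ex ey ez /transversal3 /= neq_pq neq_pr neq_qr /in_class eqxx !(eq_sym _ (cl (Some p.1))) pq pr.
  have [|[l|] h] := design_ex d0 (x := Some p.1) (y := Some q.1) (z := Some r.1).
  - by rewrite /class_dom distinct3_inj ?dpqr //; apply: Some_inj.
  - by right; right; left; exists p, q, r; split=> //; exists l.
  left; exists [set p.1; q.1; r.1]; split.
    exists p.1, q.1, r.1; split=> //.
    by apply: (design_swap12 d0); apply: (design_swap23 d0); apply: (design_swap34 d0).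
  by rewrite d ex ey ez /= !inE !eqxx !orbT.
have widen (P : pred I) : P i -> P j -> [&& groups_in P x, groups_in P y & groups_in P z].
  have sub u : P i -> P j -> groups_in (pred2 i j) u -> groups_in P u.
    by case: u => [//|u] /= Pi Pj /orP [] /eqP ->.
  by move=> Pi Pj; have /and3P [xij yij zij] := in_ij; rewrite !sub.
case: (boolP (infinity_class i && infinity_class j)) => [/andP [ic jc]|ncl].
  by right; left; rewrite /infinity_class_dom d /=; apply: widen.
have [|[k|] h] := design_ex d0 (x := None) (y := Some i) (z := Some j).
- by rewrite /class_dom /distinct3 (inj_eq Some_inj) ij /= ![cl None == _]eq_sym.
- left; exists [set i; j; k]; split; first by exists i, j, k.
  by rewrite d /=; apply: widen; rewrite !inE eqxx ?orbT.
by have := design_dom d0 (design_swap34 d0 h); rewrite /class_dom /distinct3 eqxx andbF.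
Qed.

Theorem cqs_of_fan : (forall A, #|A| = 3 -> cqs S {i | i \in A} W) -> cqs S {i | infinity_class i} W ->
  (forall c, c != cl None -> hdes {i | in_class c i} W) -> cqs S I W.
Proof.
move=> cqs3 cqs_infinity hdes_other; apply: eq_has_design (fun x y z => iff_sym (cqs_dom_fan x y z)) _.
apply: has_design_union (star_dom_has_design cqs3) _ => [x y z [A sA] [ic|[fb|[c oc]]]|].
- exact: star_infinity_class_disjoint sA ic.
- exact: star_finite_block_disjoint sA fb.
- exact: star_other_class_disjoint sA oc.
apply: has_design_union (cqs_subgroups cqs_infinity) _ => [x y z ic [fb|[c oc]]|].
- by have /and4P [_ xc yc zc] := ic; apply: (finite_block_class_disjoint (c := cl None) fb).
- exact: infinity_other_class_disjoint ic oc.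
apply: has_design_union finite_block_has_design _ => [x y z fb [c [_ /and4P [_ xc yc zc]]]|].
  exact: finite_block_class_disjoint fb xc yc zc.
apply: has_design_bigcup other_class_inj => c; apply: has_design_when => /hdes_other; exact: hdes_subgroups.
Qed.

End Fan.

Section ClassesOfBijection.
Variables (I G H : finType) (f : option I -> G * H).
Hypothesis f_bij : bijective f.

Lemma card_class_of_bij (c : G) :
  #|{: {i | in_class (fun x => (f x).1) c i}}| = #|H| - (c == (f None).1).
Proof.
have f_inj := bij_inj f_bij.
have Some_f_inj : injective (fun i => f (Some i)) by move=> i j /f_inj [].
have image : (fun i => f (Some i)) @: [set i | (f (Some i)).1 == c] = setX [set c] setT :\ f None.
  apply/setP => p; have [g fK gK] := f_bij; apply/imsetP/idP => [[i]|].
    by rewrite !inE => ic ->; rewrite ic (inj_eq f_inj).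
  rewrite !inE andbT => /andP []; rewrite -(gK p); case: (g p) => [i|]; last by rewrite eqxx.
  by exists i; rewrite ?inE.
rewrite card_sig -(eq_card (_ : [set i | (f (Some i)).1 == c] =i _)); last by move=> i; rewrite !inE.
rewrite -(card_imset _ Some_f_inj) image.
have := cardsD1 (f None) (setX [set c] [set: H]); rewrite cardsX cards1 cardsT mul1n !inE andbT => ->.
by rewrite eq_sym addKn.
Qed.

End ClassesOfBijection.

Lemma cqs_of_gdes (S I G H : finType) (W : finZmodType) n : #|I|.+1 = #|G| * #|H| -> #|H| = n.+1 ->
  gdes G H -> cqs S 'I_3 W -> cqs S 'I_n W -> hdes H W -> cqs S I W.
Proof.
move=> cardI cardH gdes_GH cqs3 cqs_n hdes_H.
have [f f_bij] : exists f : option I -> G * H, bijective f.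
  by apply: card_bij; rewrite card_option card_prod.
have [R dR] : has_design (fun i j k => class_dom (fun x => (f x).1) i j k).
  apply: (has_design_bij f_bij) gdes_GH => i j k.
  by rewrite /class_dom /gdom distinct3_inj //; apply: bij_inj.
apply: (cqs_of_fan dR) => [A A3||c cN].
- by apply: cqs_card cqs3 => //; rewrite card_ord card_sig -A3.
- by apply: cqs_card cqs_n => //; rewrite (card_class_of_bij f_bij) eqxx cardH card_ord subn1.
by apply: hdes_card hdes_H => //; rewrite (card_class_of_bij f_bij) (negPf cN) subn0.
Qed.

Lemma cqs_of_sqs (S I : finType) (W : finZmodType) : sqs (option I) -> cqs S 'I_3 W -> cqs S I W.
Proof.
move=> sqs_I cqs3; apply: (@cqs_of_gdes S I (option I) unit W 0) cqs3 _ _.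
- by rewrite card_option card_unit muln1.
- exact: card_unit.
- have fst_bij : bijective (@fst (option I) unit) by exists (fun i => (i, tt)) => [[i []]|i].
  apply: (has_design_bij fst_bij) sqs_I => -[i []] [j []] [k []].
  by rewrite /gdom /distinct3 !xpair_eqE /= !andbT; case: (i == j); rewrite //= andbT.
- by apply: has_design_empty => x y z /cqs_dom_groups [[]].
by apply: has_design_empty => p q r; case: p.1 q.1 => [] [].
Qed.

(** * Hanani's quadrupling *)

Section BlockStatistics.
Variables (G : eqType) (W : zmodType).
Local Notation T := (bool + G * W)%type.
Implicit Types (g : G) (x : T) (s : seq T).

Definition in_group g x : bool := if x is inr p then p.1 == g else false.
Definition coord g x : W := if x is inr p then (if p.1 == g then p.2 else 0%R) else 0%R.
Definition stem_bit x : bool := if x is inl l then l else false.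
Definition group_count g s : nat := count (in_group g) s.
Definition stem_count s : nat := count is_inl s.
Definition group_sum g s : W := foldr +%R 0%R (map (coord g) s).
Definition stem_parity s : bool := foldr addb false (map stem_bit s).

Lemma perm_group_count g s s' : perm_eq s s' -> group_count g s = group_count g s'.
Proof. by move/permP; apply. Qed.

Lemma perm_stem_count s s' : perm_eq s s' -> stem_count s = stem_count s'.
Proof. by move/permP; apply. Qed.

Lemma perm_group_sum g s s' : perm_eq s s' -> group_sum g s = group_sum g s'.
Proof. by move=> p; rewrite /group_sum !foldrE; apply/perm_big/perm_map. Qed.

Lemma perm_stem_parity s s' : perm_eq s s' -> stem_parity s = stem_parity s'.
Proof. by move=> p; rewrite /stem_parity !foldrE; apply/perm_big/perm_map. Qed.

End BlockStatistics.

Section EvenCyclicGroup.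
Variable k : nat.
Local Notation W := 'I_k.*2.+2.
Implicit Types a b x : W.

Definition upper x : bool := k < x.
Definition halfway : W := inord k.+1.

Lemma val_halfway : val halfway = k.+1. Proof. by rewrite /halfway /= inordK //; lia. Qed.

Lemma odd_Zp_add a b : odd (val (a + b)%R) = odd a (+) odd b.
Proof.
rewrite /= -oddD -[in RHS](odd_mod (a + b) (d := k.*2.+2)) //.
by rewrite /= negbK odd_double.
Qed.

Lemma upper_add_halfway x : upper (x + halfway)%R = ~~ upper x.
Proof.
rewrite /upper /= val_halfway; have := ltn_ord x; move: (nat_of_ord x) => n n_lt.
have [n_le|k_lt] := leqP n k; first by rewrite modn_small; lia.
by rewrite (_ : n + k.+1 = (n - k.+1) + k.*2.+2) ?modnDr ?modn_small; lia.
Qed.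

Lemma halfway_double : (halfway + halfway = 0 :> W)%R.
Proof. by apply: val_inj; rewrite /= val_halfway addSn addnS addnn modnn. Qed.

Lemma oppr_halfway : (- halfway = halfway :> W)%R.
Proof. by apply/eqP; rewrite eq_sym -subr_eq0 opprK halfway_double. Qed.

Lemma even_is_double x : ~~ odd x -> exists a : W, (a + a)%R = x.
Proof.
move=> even_x; have := ltn_ord x => x_lt; exists (inord x./2); apply: val_inj.
by rewrite /= inordK ?modn_small; lia.
Qed.

Lemma double_eq a b : (a + a = b + b)%R -> b = a \/ (b = a + halfway)%R.
Proof.
move=> eq2; pose c : W := (b - a)%R; have -> : b = (a + c)%R by rewrite addrC subrK.
have : (c + c)%R == 0%R :> W by rewrite /c addrACA -opprD eq2 subrr.
have c_lt := ltn_ord c; rewrite -(inj_eq val_inj) /= => /dvdnP [[|[|q]] cE]; last lia.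
  by left; rewrite (_ : c = 0%R) ?addr0 //; apply: val_inj => /=; lia.
by right; congr (_ + _)%R; apply: val_inj; rewrite val_halfway /=; lia.
Qed.

End EvenCyclicGroup.

(* The four groups form two sides, the group (h, i) lying on the side h.  A
   block takes one point from each group of a side, and either two points of a
   group of the other side or one such point and a stem point. *)
Section Quadruple.
Variable k : nat.
Local Notation W := 'I_k.*2.+2.
Local Notation T := (bool + (bool * bool) * W)%type.
Implicit Types (x y z w : T) (s : seq T) (h i j l : bool) (a b c u v : W).
Local Open Scope ring_scope.

Definition twist h i : W := if i then (if h then -1 else 1) else 0.

Definition cut j i b a : bool := match j, i with
  | false, false => upper (a - b)
  | true, true => upper (a - b - 1)
  | _, _ => upper (b - a) end.

Definition quad_stem_bit h i u v : bool := if h then ~~ cut i false v u else cut false i u v.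

Definition quad_pair_block s h i : bool :=
  [&& group_count (h, false) s == 1%N, group_count (h, true) s == 1%N, group_count (~~ h, i) s == 2%N &
    group_sum (~~ h, i) s == group_sum (h, false) s + group_sum (h, true) s + twist h i].

Definition quad_stem_block s h i : bool :=
  [&& stem_count s == 1%N, group_count (h, false) s == 1%N, group_count (h, true) s == 1%N,
    group_count (~~ h, i) s == 1%N,
    group_sum (~~ h, i) s + group_sum (~~ h, i) s ==
      group_sum (h, false) s + group_sum (h, true) s + twist h i &
    stem_parity s == quad_stem_bit h i (group_sum (h, false) s) (group_sum (~~ h, i) s)].

Definition some_group (P : bool -> bool -> bool) : bool :=
  [|| P false false, P false true, P true false | P true true].

Definition quad_list s : bool :=
  uniq s && (some_group (quad_pair_block s) || some_group (quad_stem_block s)).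

Definition quad_block x y z w : Prop := quad_list [:: x; y; z; w].

Lemma perm_quad_list s s' : perm_eq s s' -> quad_list s -> quad_list s'.
Proof.
move=> p; rewrite /quad_list (perm_uniq p) /some_group /quad_pair_block /quad_stem_block.
by rewrite !(perm_group_count _ p) !(perm_group_sum _ p) (perm_stem_count p) (perm_stem_parity p).
Qed.

Lemma quad_block_swap12 x y z w : quad_block x y z w -> quad_block y x z w.
Proof. exact: perm_quad_list (perm_eq_swap12 _ _ _ _). Qed.

Lemma quad_block_swap23 x y z w : quad_block x y z w -> quad_block x z y w.
Proof. exact: perm_quad_list (perm_eq_swap23 _ _ _ _). Qed.

Lemma quad_block_swap34 x y z w : quad_block x y z w -> quad_block x y w z.
Proof. exact: perm_quad_list (perm_eq_swap34 _ _ _ _). Qed.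

Local Ltac unfold_quad := rewrite /quad_list /some_group /quad_pair_block /quad_stem_block
  /group_count /stem_count /group_sum /stem_parity /=
  ?inE ?(inj_eq inr_inj) ?xpair_eqE /= ?andbF ?orbF ?andbT ?addr0 ?add0r ?addbF ?andbF ?orbF.

Lemma quad_list_side_point h i b c a w :
  quad_list [:: inr ((h, false), b); inr ((h, true), c); inr ((~~ h, i), a); w] =
  match w with
  | inl l => (a + a == b + c + twist h i) && (l == quad_stem_bit h i b a)
  | inr (g, v) => [&& g == (~~ h, i), a != v & a + v == b + c + twist h i] end.
Proof.
by case: w => [l|[[h' i'] v]]; case: h => //; case: i => //; try case: h'; try case: i';
  unfold_quad.
Qed.

Lemma quad_list_group_point h i j a a' b w : a != a' ->
  quad_list [:: inr ((~~ h, i), a); inr ((~~ h, i), a'); inr ((h, j), b); w] =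
  if w is inr (g, v) then (g == (h, ~~ j)) && (a + a' == b + v + twist h i) else false.
Proof.
move=> n; case: w => [l|[[h' i'] v]]; case: h => //; case: i => //; case: j => //;
  by try case: h'; try case: i'; unfold_quad; rewrite ?n ?(addrC v b).
Qed.

Lemma quad_list_stem_side l h b c w :
  quad_list [:: inl l; inr ((h, false), b); inr ((h, true), c); w] =
  if w is inr ((h', i), v) then
    [&& h' == ~~ h, v + v == b + c + twist h i & l == quad_stem_bit h i b v] else false.
Proof.
by case: w => [l'|[[h' i'] v]]; case: h => //; try case: h'; try case: i'; unfold_quad.
Qed.

Lemma quad_list_stem_sides l j i b a w :
  quad_list [:: inl l; inr ((false, j), b); inr ((true, i), a); w] =
  if w is inr ((h', i'), v) then
    if h' then [&& i' == ~~ i, b + b == a + v + twist true j &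
                  l == quad_stem_bit true j (if i then v else a) b]
    else [&& i' == ~~ j, a + a == b + v + twist false i &
            l == quad_stem_bit false i (if j then v else b) a]
  else false.
Proof.
by case: w => [l'|[[h' i'] v]]; case: i => //; case: j => //; try case: h'; try case: i'; unfold_quad;
  rewrite ?(addrC v b) ?(addrC v a).
Qed.

Lemma odd_twist h i : odd (val (twist h i)) = i.
Proof. by case: h i => [] [] //=; rewrite /= ?modn_small //= ?subSS ?subn0 ?odd_double. Qed.

Lemma quad_stem_bit_halfway h i u v :
  quad_stem_bit h i u (v + halfway k) = ~~ quad_stem_bit h i u v.
Proof.
have shift_left c : v + halfway k - c = v - c + halfway k by ring.
have shift_right c : c - (v + halfway k) = c - v + halfway k by rewrite opprD oppr_halfway; ring.
have shift_left1 c d : v + halfway k - c - d = v - c - d + halfway k by ring.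
by case: h i => [] []; rewrite /quad_stem_bit /cut ?shift_left1 ?shift_left ?shift_right ?upper_add_halfway.
Qed.

Lemma quad_complete_side_point h i b c a :
  exists! w, quad_block (inr ((h, false), b)) (inr ((h, true), c)) (inr ((~~ h, i), a)) w.
Proof.
have [e|n] := eqVneq (a + a) (b + c + twist h i).
  exists (inl (quad_stem_bit h i b a)); split=> [|w]; rewrite /quad_block quad_list_side_point ?e ?eqxx //.
  case: w => [l /= /eqP -> //|[g v] /= /and3P [_ av /eqP ev]].
  by case/eqP: av; apply: (@addrI _ a); rewrite ev.
exists (inr ((~~ h, i), b + c + twist h i - a)); split=> [|w]; rewrite /quad_block quad_list_side_point.
  rewrite eqxx (addrC a) subrK eqxx andbT; apply: contraNneq n => e.
  by rewrite {1}e subrK.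
case: w => [l|[g v] /and3P [/eqP -> _ /eqP <-]]; first by rewrite (negPf n).
by rewrite (addrC a) addrK.
Qed.

Lemma quad_complete_group_point h i j a a' b : a != a' ->
  exists! w, quad_block (inr ((~~ h, i), a)) (inr ((~~ h, i), a')) (inr ((h, j), b)) w.
Proof.
move=> n; exists (inr ((h, ~~ j), a + a' - twist h i - b)).
split=> [|w]; rewrite /quad_block quad_list_group_point //; first by rewrite eqxx; apply/eqP; ring.
by case: w => [//|[g v]] /andP [/eqP -> /eqP ->]; congr (inr (_, _)); ring.
Qed.

(* Of the two halves a, a + halfway of b + c + twist, exactly one has stem bit l. *)
Lemma quad_complete_stem_side l h b c :
  exists! w, quad_block (inl l) (inr ((h, false), b)) (inr ((h, true), c)) w.
Proof.
pose i := odd (val (b + c)).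
have [a0 ea0] : exists a : W, a + a = b + c + twist h i.
  by apply: even_is_double; rewrite odd_Zp_add odd_twist addbb.
have [a [ea la]] : exists a : W, a + a = b + c + twist h i /\ quad_stem_bit h i b a = l.
  have [e|n] := eqVneq (quad_stem_bit h i b a0) l; first by exists a0.
  exists (a0 + halfway k); split; first by rewrite addrACA halfway_double addr0.
  by rewrite quad_stem_bit_halfway; move: n; case: (quad_stem_bit _ _ _ _) (l) => [] [].
exists (inr ((~~ h, i), a)); split=> [|w]; rewrite /quad_block quad_list_stem_side ?ea ?la ?eqxx //.
case: w => [//|[[h' i'] v]] /and3P [/eqP -> /eqP ev /eqP lv].
have ei : i' = i.
  move/(congr1 (fun x : W => odd (val x))): ev; rewrite !odd_Zp_add odd_twist addbb.
  by rewrite /i odd_Zp_add; case: (i') (odd b) (odd c) => [] [] [].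
rewrite ei in ev lv *; have [->//|e] := double_eq (etrans ea (esym ev)).
by move: lv; rewrite e quad_stem_bit_halfway la; case: (l).
Qed.

Lemma quad_complete_stem_sides l j i b a :
  exists! w, quad_block (inl l) (inr ((false, j), b)) (inr ((true, i), a)) w.
Proof.
have bit0 : quad_stem_bit false i (if j then a + a - b - twist false i else b) a = cut j i b a.
  by case: (j) (i) => [] []; rewrite /quad_stem_bit /cut /twist //; congr upper; ring.
have bit1 : quad_stem_bit true j (if i then b + b - a - twist true j else a) b = ~~ cut j i b a.
  by case: (j) (i) => [] []; rewrite /quad_stem_bit /cut /twist //; congr (~~ upper _); ring.
have [e|n] := eqVneq l (cut j i b a).
  exists (inr ((false, ~~ j), a + a - b - twist false i)).
  split=> [|w]; rewrite /quad_block quad_list_stem_sides.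
    by rewrite bit0 e !eqxx andbT; apply/eqP; ring.
  case: w => [//|[[[] i'] v]] /and3P [/eqP -> /eqP ev /eqP lv].
    have ev' : v = b + b - a - twist true j by rewrite ev; ring.
    by move: lv; rewrite ev' bit1 e; case: (cut _ _ _ _).
  by congr (inr (_, _)); rewrite ev; ring.
have e : l = ~~ cut j i b a by move: n; case: (l) (cut _ _ _ _) => [] [].
exists (inr ((true, ~~ i), b + b - a - twist true j)).
split=> [|w]; rewrite /quad_block quad_list_stem_sides.
  by rewrite bit1 e !eqxx andbT; apply/eqP; ring.
case: w => [//|[[[] i'] v]] /and3P [/eqP -> /eqP ev /eqP lv].
  by congr (inr (_, _)); rewrite ev; ring.
have ev' : v = a + a - b - twist false i by rewrite ev; ring.
by move: lv; rewrite ev' bit0 e; case: (cut _ _ _ _).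
Qed.

Definition on_side h x : bool := if x is inr p then p.1.1 == h else false.

Definition side_dom h x y z : bool :=
  [&& cqs_dom x y z, on_side h x, on_side h y & on_side h z].

Definition cross_side_dom x y z : bool := cqs_dom x y z && ~~ [exists h, side_dom h x y z].

Lemma quad_complete_stem l (p q : (bool * bool) * W) : p.1 != q.1 ->
  exists! w, quad_block (inl l) (inr p) (inr q) w.
Proof.
have swap := unique_completion_swap23 quad_block_swap23.
case: p q => [[[] i] a] [[[] j] b]; rewrite xpair_eqE /= => n.
- by case: i j n => [] [] // _; [apply: swap|]; apply: (quad_complete_stem_side l true).
- by apply: swap; apply: quad_complete_stem_sides.
- exact: quad_complete_stem_sides.
by case: i j n => [] [] // _; [apply: swap|]; apply: (quad_complete_stem_side l false).
Qed.

Lemma quad_complete_same_side (p q r : (bool * bool) * W) :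
  p.1.1 = q.1.1 -> r.1.1 != p.1.1 -> p != q -> exists! w, quad_block (inr p) (inr q) (inr r) w.
Proof.
case: p q r => [[h i] a] [[h' j] b] [[h'' l] c] /= <-; rewrite !xpair_eqE eqxx /= => nh.
have {nh} -> : h'' = ~~ h by case: (h) (h'') nh => [] [].
have [<-|ij] := eqVneq i j => /=.
  by move=> ab; have := quad_complete_group_point (~~ h) i l c ab; rewrite negbK.
case: i j ij => [] [] // _ _; last exact: quad_complete_side_point.
by apply: unique_completion_swap12 quad_block_swap12 _; apply: quad_complete_side_point.
Qed.

Lemma quad_complete x y z : cross_side_dom x y z -> exists! w, quad_block x y z w.
Proof.
have swap12 x' y' z' := @unique_completion_swap12 _ _ x' y' z' quad_block_swap12.
have swap23 x' y' z' := @unique_completion_swap23 _ _ x' y' z' quad_block_swap23.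
case/andP => d; have /andP [/and3P [xy xz yz] crosses] := d.
rewrite /side_dom d /= => /existsPn one_side; move: xy xz yz crosses one_side {d}.
case: x y z => [l|p] [l'|q] [l''|r] //=; rewrite ?orbF ?(inj_eq inr_inj) => pq pr qr crosses one_side.
- exact: quad_complete_stem.
- exact/swap12/quad_complete_stem.
- exact/swap23/swap12/quad_complete_stem.
have [epq|npq] := eqVneq p.1.1 q.1.1.
  apply: quad_complete_same_side => //.
  by have := one_side p.1.1; rewrite -epq eqxx.
have [epr|npr] := eqVneq p.1.1 r.1.1.
  by apply/swap23/quad_complete_same_side; rewrite // eq_sym.
apply/swap12/swap23/swap12/quad_complete_same_side; rewrite 1?eq_sym //.
  by case: (p.1.1) (q.1.1) (r.1.1) npq npr => [] [] [].
by rewrite eq_sym.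
Qed.

Lemma quad_block_dom x y z w : quad_block x y z w -> cross_side_dom x y z.
Proof.
rewrite /quad_block => h; have /andP [/uniq4_distinct3 d _] := h.
have {h} : some_group (fun h i => [&& group_count (h, false) [:: x; y; z; w] == 1%N,
    group_count (h, true) [:: x; y; z; w] == 1%N & 0 < group_count (~~ h, i) [:: x; y; z; w]]%N).
  have weaken (P Q : bool -> bool -> bool) : (forall h i, P h i -> Q h i) ->
    some_group P -> some_group Q by move=> PQ /or4P [] /PQ q; rewrite /some_group q ?orbT.
  case/andP: h => _ /orP []; apply: weaken => h i.
    by case/and4P => -> -> /eqP ->.
  by case/and5P => _ -> -> /eqP ->.
rewrite /cross_side_dom /cqs_dom d /= => counts.
have /andP [-> off_side] : [|| cross x y, cross x z | cross y z] &&
    [&& ~~ [&& on_side false x, on_side false y & on_side false z] &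
        ~~ [&& on_side true x, on_side true y & on_side true z]].
  by move: counts; case: x y z {d} => [l|[[[] []] a]] [l'|[[[] []] a']] [l''|[[[] []] a'']] //=;
    case: w => [l3|[[[] []] a3]].
by apply/existsPn => -[]; case/andP: off_side => off0 off1; rewrite /side_dom andbC ?(negPf off0) ?(negPf off1).
Qed.

Lemma cross_side_design : design (fun x y z => cross_side_dom x y z) quad_block.
Proof.
exact: design_of_unique_completion quad_block_swap12 quad_block_swap23 quad_block_swap34
  quad_block_dom quad_complete.
Qed.

Lemma side_has_design h : has_design (fun x y z => side_dom h x y z).
Proof.
have [K [c fc]] : exists K (c : W -> W -> K), one_factorization (@neq_rel _) c.
  by apply: one_factorization_even; rewrite card_ord /= negbK odd_double.
pose f (p : bool * W) : T := inr ((h, p.1), p.2).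
have f_inj : injective f by move=> [i a] [j b] [-> ->].
have range x : on_side h x -> exists p, x = f p.
  by case: x => [//|[[h' i] a]] /eqP /= ->; exists (i, a).
apply: (has_design_inj f_inj _ _ (ex_intro _ _ (edge_pair_design bool fc))) => [x y z|p q r].
  by case/and4P => _ /range ? /range ? /range ?.
have -> : side_dom h (f p) (f q) (f r) = gdom p q r.
  rewrite /side_dom /cqs_dom (distinct3_inj _ _ _ f_inj) /= !eqxx !andbT /gdom; congr (_ && _).
  by rewrite !xpair_eqE eqxx /=; case: (p.1) (q.1) (r.1) => [] [] [].
rewrite gdomE; split=> [[//|]|]; last by left.
by rewrite /distinct3; case: (p.1) (q.1) (r.1) => [] [] [].
Qed.

Lemma cqs_quad : cqs bool (bool * bool)%type W.
Proof.
have sides : has_design (fun x y z => exists h, side_dom h x y z).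
  apply: has_design_bigcup side_has_design _ => h h' x y z /and4P [_ xh _ _] /and4P [_ xh' _ _].
  by case: x xh xh' => //= p /eqP <- /eqP <-.
apply: eq_has_design (has_design_union _ (ex_intro _ _ cross_side_design) sides) => x y z.
  rewrite /cross_side_dom; split=> [[/andP [] //|[h /andP [] //]]|d].
  by case: (boolP [exists h, side_dom h x y z]) => [/existsP|ns]; [right|left; rewrite d].
by case/andP => _ /existsPn ns [h]; apply/negP.
Qed.

End Quadruple.

Lemma sqs_quad (k : nat) : sqs 'I_k.*2.+4 -> sqs 'I_(4 * k.*2.+2 + 2).
Proof.
move=> sqs_k; have := sqs_of_cqs2 (cqs_quad k) (sqs_card _ sqs_k).
rewrite card_sum card_bool !card_ord => /(_ erefl); apply: sqs_card.
by rewrite card_sum card_prod card_prod card_bool !card_ord; lia.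
Qed.

(** * Hanani's tripling *)

(* The sum j of the coordinates of a transversal of the three groups either
   determines a stem point, or a group in which the point of the transversal is
   exchanged so that the sum becomes [mate j]. *)
Record mate_system (W : zmodType) (stem_of : W -> option bool) (group_of : W -> option bool)
    (mate : W -> W) (short : pred W) : Prop := MateSystem {
  stem_of_bij : forall l, exists! j, stem_of j = Some l;
  mateK : forall j, stem_of j = None -> mate (mate j) = j;
  stem_of_mate : forall j, stem_of j = None -> stem_of (mate j) = None;
  group_of_mate : forall j, stem_of j = None -> group_of (mate j) = group_of j;
  mate_short : forall j, stem_of j = None -> short (mate j - j)%R;
  short_mate : forall g a, short a ->
    exists! j, [/\ stem_of j = None, group_of j = g & (mate j - j)%R = a];
  short0 : ~~ short 0%R }.

Section Triple.
Variables (W : comNzRingType) (stem_of group_of : W -> option bool) (mate : W -> W) (short : pred W).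
Hypothesis ms : mate_system stem_of group_of mate short.
Local Notation G := (option bool).
Local Notation T := (bool + G * W)%type.
Implicit Types (x y z w : T) (s : seq T) (g : G) (a b c j v : W) (l : bool).
Local Open Scope ring_scope.

Definition total s : W := group_sum None s + group_sum (Some false) s + group_sum (Some true) s.

Definition mates g j j' : bool := [&& stem_of j == None, group_of j == g & mate j == j'].

Definition triple_stem_block s : bool :=
  [&& stem_count s == 1%N, group_count None s == 1%N, group_count (Some false) s == 1%N,
    group_count (Some true) s == 1%N & stem_of (total s) == Some (stem_parity s)].

Definition triple_pair_block g s : bool :=
  [&& group_count None s == (g == None).+1, group_count (Some false) s == (g == Some false).+1,
    group_count (Some true) s == (g == Some true).+1 &
    has (fun x => in_group g x &&
      mates g (coord g x + (total s - group_sum g s))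
              (group_sum g s - coord g x + (total s - group_sum g s))) s].

Definition triple_list s : bool := uniq s && [|| triple_stem_block s, triple_pair_block None s,
  triple_pair_block (Some false) s | triple_pair_block (Some true) s].

Definition triple_block x y z w : Prop := triple_list [:: x; y; z; w].

Lemma perm_triple_list s s' : perm_eq s s' -> triple_list s -> triple_list s'.
Proof.
move=> p; rewrite /triple_list (perm_uniq p) /triple_stem_block /triple_pair_block /total.
rewrite !(perm_group_count _ p) !(perm_group_sum _ p) (perm_stem_count p) (perm_stem_parity p).
by rewrite !(eq_has_r (perm_mem p)).
Qed.

Lemma triple_block_swap12 x y z w : triple_block x y z w -> triple_block y x z w.
Proof. exact: perm_triple_list (perm_eq_swap12 _ _ _ _). Qed.

Lemma triple_block_swap23 x y z w : triple_block x y z w -> triple_block x z y w.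
Proof. exact: perm_triple_list (perm_eq_swap23 _ _ _ _). Qed.

Lemma triple_block_swap34 x y z w : triple_block x y z w -> triple_block x y w z.
Proof. exact: perm_triple_list (perm_eq_swap34 _ _ _ _). Qed.

Local Ltac unfold_triple := rewrite /triple_list /triple_stem_block /triple_pair_block /total
  /group_count /stem_count /group_sum /stem_parity /=
  ?inE ?(inj_eq inr_inj) ?xpair_eqE /= ?andbF ?orbF ?andbT ?addr0 ?add0r ?addbF ?andbF ?orbF.

Lemma mates_sym g j j' : mates g j j' -> mates g j' j.
Proof.
case/and3P => /eqP sj /eqP gj /eqP <-.
by rewrite /mates (stem_of_mate ms) // (group_of_mate ms) // (mateK ms) // gj !eqxx.
Qed.

Lemma mates_short g j j' : mates g j j' -> short (j' - j).
Proof. by case/and3P => /eqP sj _ /eqP <-; apply: mate_short ms _ sj. Qed.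

Lemma mates_neq g j j' : mates g j j' -> j != j'.
Proof.
by move/mates_short; apply: contraTneq => ->; rewrite subrr; apply: short0 ms.
Qed.

Lemma mates_or g j1 j1' j2 j2' j j' : j1 = j -> j1' = j' -> j2 = j' -> j2' = j ->
  mates g j1 j1' || mates g j2 j2' = mates g j j'.
Proof. by move=> -> -> -> ->; apply/orP/idP => [[//|/mates_sym //]|]; left. Qed.

Lemma neq_and_mates_or g u v j1 j1' j2 j2' j j' : j1 = j -> j1' = j' -> j2 = j' -> j2' = j ->
  j - j' = u - v -> (u != v) && (mates g j1 j1' || mates g j2 j2') = mates g j j'.
Proof.
move=> j1E j1'E j2E j2'E diffE; rewrite (mates_or g j1E j1'E j2E j2'E); apply/andP/idP => [[]//|m].
by split=> //; rewrite -subr_eq0 -diffE subr_eq0; apply: mates_neq m.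
Qed.

Definition select_group a b c g : W := match g with None => a | Some false => b | Some true => c end.

Lemma triple_list_transversal a b c w :
  triple_list [:: inr (None, a); inr (Some false, b); inr (Some true, c); w] =
  match w with
  | inl l => stem_of (a + b + c) == Some l
  | inr (g, v) => mates g (a + b + c) (a + b + c - select_group a b c g + v) end.
Proof.
case: w => [l|[g v]]; first by unfold_triple.
by case: g => [[]|]; unfold_triple; apply: neq_and_mates_or; rewrite /select_group; ring.
Qed.

Lemma triple_list_group_pair g g' a a' b w : g != g' -> a != a' ->
  triple_list [:: inr (g, a); inr (g, a'); inr (g', b); w] =
  if w is inr (g'', v) then [&& g'' != g, g'' != g' & mates g (a + b + v) (a' + b + v)] else false.
Proof.
move=> n na; case: w => [l|[g'' v]].
  by case: g g' n => [[]|] [[]|] // _; unfold_triple.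
by case: g g' g'' n => [[]|] [[]|] [[]|] // _; unfold_triple => //; rewrite ?na /=; apply: mates_or; ring.
Qed.

Lemma triple_list_stem l g g' a b w : g != g' ->
  triple_list [:: inl l; inr (g, a); inr (g', b); w] =
  if w is inr (g'', v) then [&& g'' != g, g'' != g' & stem_of (a + b + v) == Some l] else false.
Proof.
move=> n; case: w => [l'|[g'' v]].
  by case: g g' n => [[]|] [[]|] // _; unfold_triple.
by case: g g' g'' n => [[]|] [[]|] [[]|] // _; unfold_triple => //; congr (stem_of _ == _); ring.
Qed.

Lemma triple_list_short g a a' z w : triple_list [:: inr (g, a); inr (g, a'); z; w] -> short (a' - a).
Proof.
have short_of j j' h : j' - j = a' - a -> mates h j j' -> short (a' - a).
  by move=> <-; apply: mates_short.
have short_of_sym j j' h : j - j' = a' - a -> mates h j j' -> short (a' - a).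
  by move=> e /mates_sym; apply: short_of.
case: z => [l|[g' b]]; case: w => [l'|[g'' v]]; case: g => [[]|]; try case: g' => [[]|];
  try case: g'' => [[]|]; unfold_triple => //; case/andP => _ /orP [] m;
  first [apply: short_of m; ring | apply: short_of_sym m; ring].
Qed.

Definition third_group g g' : G := match g, g' with
  | None, Some l => Some (~~ l) | Some l, None => Some (~~ l) | _, _ => None end.

Lemma third_groupP g g' g'' : g != g' -> [&& g'' != g & g'' != g'] = (g'' == third_group g g').
Proof. by case: g g' g'' => [[]|] [[]|] [[]|]. Qed.

Lemma triple_complete_transversal a b c :
  exists! w, triple_block (inr (None, a)) (inr (Some false, b)) (inr (Some true, c)) w.
Proof.
case e: (stem_of (a + b + c)) => [l|].
  exists (inl l); split=> [|[l'|[g v]]]; rewrite /triple_block triple_list_transversal ?e ?eqxx //.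
    by move/eqP => [->].
  by case/and3P; rewrite e.
set j := a + b + c in e *; pose g := group_of j.
exists (inr (g, select_group a b c g + mate j - j)); split=> [|[l|[g' v]]];
  rewrite /triple_block triple_list_transversal -/j ?e //.
  by rewrite /mates e !eqxx /=; apply/eqP; ring.
by case/and3P => _ /eqP <- /eqP ->; congr (inr (_, _)); rewrite /g; ring.
Qed.

Lemma triple_complete_group_pair g g' a a' b : g != g' -> short (a' - a) ->
  exists! w, triple_block (inr (g, a)) (inr (g, a')) (inr (g', b)) w.
Proof.
move=> n d; have na : a != a' by apply: contraTneq d => ->; rewrite subrr; apply: short0 ms.
have [j [[sj gj mj] uj]] := short_mate ms g d.
exists (inr (third_group g g', j - a - b)); split=> [|w]; rewrite /triple_block triple_list_group_pair //.
  rewrite andbA (third_groupP _ n) eqxx /= /mates.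
  have -> : a + b + (j - a - b) = j by ring.
  by rewrite sj gj !eqxx; apply/eqP; rewrite -[mate j](subrK j) mj; ring.
case: w => [//|[g'' v]]; rewrite andbA (third_groupP _ n) => /andP [/eqP -> /and3P [/eqP s /eqP i /eqP p]].
by rewrite (uj (a + b + v)); [congr (inr (_, _)); ring|split=> //; rewrite p; ring].
Qed.

Lemma triple_complete_stem l g g' a b : g != g' ->
  exists! w, triple_block (inl l) (inr (g, a)) (inr (g', b)) w.
Proof.
move=> n; have [j [sj uj]] := stem_of_bij ms l.
exists (inr (third_group g g', j - a - b)); split=> [|w]; rewrite /triple_block (triple_list_stem _ _ _ _ n).
  rewrite andbA (third_groupP _ n) eqxx /=.
  by have -> : a + b + (j - a - b) = j by [ring]; rewrite sj.
case: w => [//|[g'' v]]; rewrite andbA (third_groupP _ n) => /andP [/eqP -> /eqP /uj ->].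
by congr (inr (_, _)); ring.
Qed.

Definition short_apart x y : bool := match x, y with
  | inr p, inr q => (p.1 == q.1) ==> short (q.2 - p.2) | _, _ => true end.

Definition short_dom x y z : bool :=
  [&& cqs_dom x y z, short_apart x y, short_apart x z & short_apart y z].

Lemma triple_complete_three_groups a b c g g' g'' : distinct3 g g' g'' ->
  exists! w, triple_block (inr (g, a)) (inr (g', b)) (inr (g'', c)) w.
Proof.
have swap12 x y z := @unique_completion_swap12 _ _ x y z triple_block_swap12.
have swap23 x y z := @unique_completion_swap23 _ _ x y z triple_block_swap23.
have base := triple_complete_transversal.
case: g g' g'' => [[]|] [[]|] [[]|] // _.
- exact/swap12/swap23/swap12/base.
- exact/swap12/swap23/base.
- exact/swap23/swap12/base.
- exact/swap12/base.
- exact/swap23/base.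
Qed.

Lemma triple_complete x y z : short_dom x y z -> exists! w, triple_block x y z w.
Proof.
have swap12 x' y' z' := @unique_completion_swap12 _ _ x' y' z' triple_block_swap12.
have swap23 x' y' z' := @unique_completion_swap23 _ _ x' y' z' triple_block_swap23.
case/and4P => /andP [/and3P [xy xz yz] crosses] sxy sxz syz; move: xy xz yz crosses sxy sxz syz.
case: x y z => [l|[g a]] [l'|[g' b]] [l''|[g'' c]] //=;
  rewrite ?orbF /= => xy xz yz crosses sxy sxz syz.
- exact: triple_complete_stem.
- exact/swap12/triple_complete_stem.
- exact/swap23/swap12/triple_complete_stem.
have [e|gg'] := eqVneq g g'.
  subst g'; move: sxy crosses; rewrite eqxx /= orbb => sxy gg''.
  exact: triple_complete_group_pair.
have [e|gg''] := eqVneq g g''.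
  by subst g''; rewrite eqxx in sxz; apply/swap23/triple_complete_group_pair.
have [e|g'g''] := eqVneq g' g''.
  subst g''; rewrite eqxx in syz; apply/swap12/swap23/triple_complete_group_pair => //.
  by rewrite eq_sym.
by apply: triple_complete_three_groups; rewrite /distinct3 gg' gg''.
Qed.

Lemma triple_block_short_apart x y z w : triple_block x y z w -> short_apart x y.
Proof.
case: x y => [//|[g a]] [//|[g' b]] h; apply/implyP => /= /eqP e; subst g'.
exact: triple_list_short h.
Qed.

Lemma triple_block_dom x y z w : triple_block x y z w -> short_dom x y z.
Proof.
move=> h; have xyz_swap23 := triple_block_swap23 h; have xyz_swap13 := triple_block_swap23 (triple_block_swap12 h).
rewrite /short_dom (triple_block_short_apart h) (triple_block_short_apart xyz_swap23).
rewrite (triple_block_short_apart xyz_swap13) !andbT.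
have /andP [/uniq4_distinct3 d _] := h; rewrite /cqs_dom d /=.
have : [&& 0 < group_count None [:: x; y; z; w], 0 < group_count (Some false) [:: x; y; z; w] &
    0 < group_count (Some true) [:: x; y; z; w]]%N.
  by case/andP: h => _ /or4P [/and5P [_ /eqP -> /eqP -> /eqP -> _]|/and4P [/eqP -> /eqP -> /eqP -> _]|
    /and4P [/eqP -> /eqP -> /eqP -> _]|/and4P [/eqP -> /eqP -> /eqP -> _]].
by case: x y z {h xyz_swap23 xyz_swap13 d} => [l|[[[]|] a]] [l'|[[[]|] a']] [l''|[[[]|] a'']] //=;
  case: w => [l3|[[[]|] a3]].
Qed.

Lemma short_design : design (fun x y z => short_dom x y z) triple_block.
Proof.
exact: design_of_unique_completion triple_block_swap12 triple_block_swap23 triple_block_swap34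
  triple_block_dom triple_complete.
Qed.

Definition long_edge : rel W := fun a b => (a != b) && ~~ short (b - a).

Definition long_dom x y z : Prop := exists p q r : G * W,
  [/\ x = inr p, y = inr q, z = inr r & edge_and_point_dom long_edge p q r].

Lemma cqs_dom_short_long x y z : cqs_dom x y z <-> short_dom x y z \/ long_dom x y z.
Proof.
split=> [d|[/and4P [] //|[p [q [r [-> -> -> pqr]]]]]]; last first.
  rewrite cqs_dom_inr; apply/gdomE; left.
  by case: pqr => [] [same other /andP [neq _]]; [apply: Or31|apply: Or32|apply: Or33].
case: (boolP (short_dom x y z)) => [|not_short]; [by left|right]; move: not_short; rewrite /short_dom d /=.
case: x y z d => [l|p] [l'|q] [l''|r] //= d.
- by have /andP [_ /= /negPf ->] := d.
- by have /andP [_ /=] := d; rewrite orbF => /negPf ->.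
- by have /andP [_ /=] := d; rewrite !orbF => /negPf ->.
move=> not_short; exists p, q, r; split=> //; move: d; rewrite cqs_dom_inr => /gdomE [pqr|]; last first.
  by case/and3P => /negPf pq /negPf pr /negPf qr; rewrite pq pr qr in not_short.
have long (u v : G * W) : neq_rel u.2 v.2 -> ~~ short (v.2 - u.2) -> long_edge u.2 v.2.
  by rewrite /neq_rel /long_edge => ->.
case: pqr not_short => [] [same other neq]; rewrite same eqxx; rewrite same in other.
- rewrite (negPf other) /= !andbT => /(long _ _ neq) is_long.
  by apply: Or31; split; rewrite // same.
- rewrite (negPf other) (eq_sym q.1) (negPf other) /= andbT => /(long _ _ neq) is_long.
  by apply: Or32; split; rewrite // same.
rewrite !(eq_sym p.1) (negPf other) /= => /(long _ _ neq) is_long.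
by apply: Or33; split; rewrite // same.
Qed.

Lemma cqs_triple (K : Type) (colour : W -> W -> K) : one_factorization long_edge colour -> cqs bool G W.
Proof.
move=> fc; apply: eq_has_design (fun x y z => iff_sym (cqs_dom_short_long x y z)) _.
have long := has_design_image (@inr_inj bool _) (ex_intro _ _ (edge_pair_design G fc)).
apply: has_design_union (ex_intro _ _ short_design) long => x y z /and4P [_ sxy sxz syz].
case=> p [q [r [ex ey ez]]]; subst x y z.
by case=> [] [e _ /andP [_ /negP []]]; move: sxy sxz syz; rewrite /= e eqxx.
Qed.

End Triple.

Lemma val_Zp_sub m (a b : 'I_m.+1) : val (a - b)%R = if b <= a then a - b else a + m.+1 - b.
Proof.
have := ltn_ord a; have := ltn_ord b; rewrite /= => b_lt a_lt.
case: leqP => l; last by rewrite modnDmr modn_small; lia.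
by rewrite modnDmr (_ : a + (m.+1 - b) = a - b + m.+1) ?modnDr ?modn_small; lia.
Qed.

Section LongEdgeColouring.
Variable k : nat.
Local Notation W := 'I_k.*2.+2.
Variable short : pred W.
Hypotheses (odd_k : odd k) (short_odd : forall a, short a -> odd a)
  (shortN : forall a, short (- a)%R = short a).
Implicit Types (a b x y z : W) (u : 'I_k.+1).

Definition half a : 'I_k.+1 := inord a./2.
Definition of_half (o : bool) u : W := inord (o + u.*2).
Definition parity_diff a b : W := if odd a then (b - a)%R else (a - b)%R.

Lemma val_half a : val (half a) = a./2.
Proof. by rewrite /half /= inordK //; have := ltn_ord a; lia. Qed.

Lemma val_of_half o u : val (of_half o u) = o + u.*2.
Proof. by rewrite /of_half /= inordK //; have := ltn_ord u; case: o; lia. Qed.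

Lemma odd_of_half o u : odd (of_half o u) = o.
Proof. by have /= -> := val_of_half o u; case: o; lia. Qed.

Lemma of_halfK o : cancel (of_half o) half.
Proof. by move=> u; apply: val_inj; rewrite val_half /= (val_of_half o u); case: o; lia. Qed.

Lemma half_inj a b : odd a = odd b -> half a = half b -> a = b.
Proof. by move=> o /(congr1 val); rewrite !val_half => h; apply: val_inj => /=; lia. Qed.

Lemma odd_Zp_sub a b : odd (val (a - b)%R) = odd a (+) odd b.
Proof. by have := odd_Zp_add (a - b)%R b; rewrite subrK => ->; rewrite addbK. Qed.

Lemma parity_diffC a b : odd a != odd b -> parity_diff a b = parity_diff b a.
Proof. by rewrite /parity_diff; case: (odd a); case: (odd b). Qed.

Lemma odd_parity_diff a b : odd a != odd b -> odd (parity_diff a b).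
Proof. by rewrite /parity_diff; case: ifP => oa; rewrite odd_Zp_sub oa; case: (odd b). Qed.

Lemma short_parity_diff a b : short (parity_diff a b) = short (b - a)%R.
Proof. by rewrite /parity_diff; case: ifP => // _; rewrite -shortN opprB. Qed.

Definition long_colour (K : Type) (c : 'I_k.+1 -> 'I_k.+1 -> K) a b : K + W :=
  if odd a == odd b then inl (c (half a) (half b)) else inr (parity_diff a b).

Lemma long_colour_sym K (c : 'I_k.+1 -> 'I_k.+1 -> K) a b :
  one_factorization (@neq_rel _) c -> long_colour c a b = long_colour c b a.
Proof.
move=> fc; rewrite /long_colour eq_sym (colour_sym fc); case: eqP => // /eqP; rewrite eq_sym => oab.
by rewrite parity_diffC.
Qed.

Lemma long_colour_ex K (c : 'I_k.+1 -> 'I_k.+1 -> K) x y z :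
  one_factorization (@neq_rel _) c -> long_edge short x y ->
  exists2 w, long_edge short z w & long_colour c z w = long_colour c x y.
Proof.
move=> fc /andP [xy not_short]; rewrite /long_colour; have [oxy|oxy] := eqVneq (odd x) (odd y).
  have half_xy : neq_rel (half x) (half y) by apply: contra_neq xy; apply: half_inj.
  have [u zu cu] := colour_ex fc (half z) half_xy.
  exists (of_half (odd z) u); last by rewrite odd_of_half eqxx of_halfK cu.
  apply/andP; split; first by apply: contra_neq zu => e; rewrite {1}e of_halfK.
  by apply/negP => /short_odd; rewrite odd_Zp_sub odd_of_half addbb.
pose d := parity_diff x y; have odd_d : odd d by apply: odd_parity_diff.
have long_d : ~~ short d by rewrite short_parity_diff.
pose w : W := if odd z then (z + d)%R else (z - d)%R.
have odd_w : odd w = ~~ odd z.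
  by rewrite /w; case: ifP => oz; rewrite ?odd_Zp_sub ?odd_Zp_add oz odd_d.
have dE : parity_diff z w = d.
  by rewrite /parity_diff /w; case: (odd z); rewrite ?opprB addrC ?addKr ?subrK.
exists w; last by rewrite odd_w dE; case: (odd z).
rewrite /long_edge -short_parity_diff dE long_d andbT.
by apply: contra_eq_neq odd_w => <-; case: (odd z).
Qed.

Lemma long_colour_inj K (c : 'I_k.+1 -> 'I_k.+1 -> K) z x y :
  one_factorization (@neq_rel _) c -> long_edge short z x -> long_edge short z y ->
  long_colour c z x = long_colour c z y -> x = y.
Proof.
move=> fc /andP [zx _] /andP [zy _]; rewrite /long_colour.
case: eqP => ox; case: eqP => oy //; last first.
  by rewrite /parity_diff => -[]; case: ifP => _; [move/addIr|move/addrI/oppr_inj].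
have neq_half a : odd z = odd a -> z != a -> neq_rel (half z) (half a).
  by move=> o; apply: contra_neq; apply: half_inj.
move=> [] /(colour_inj fc (neq_half _ ox zx) (neq_half _ oy zy)).
by apply: half_inj; rewrite -ox -oy.
Qed.

Lemma long_edge_one_factorization :
  exists K (colour : W -> W -> K), one_factorization (long_edge short) colour.
Proof.
have [|K [c fc]] := @one_factorization_even 'I_k.+1; first by rewrite card_ord /= odd_k.
exists (K + W)%type, (long_colour c); split.
- by move=> a b; rewrite /long_edge eq_sym -[in RHS]shortN opprB.
- by move=> a b; apply: long_colour_sym.
- by move=> x y z; apply: long_colour_ex.
by move=> z x y; apply: long_colour_inj.
Qed.

End LongEdgeColouring.

Section TripleInstance.
Variable t : nat.
Let n := 4 * t + 3.
Local Notation W := 'I_(12 * t + 9).*2.+2.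
Implicit Types (a j : W) (g : option bool) (l : bool).

Lemma tripling_modulus : (12 * t + 9).*2.+2 = 6 * n + 2. Proof. by rewrite /n; lia. Qed.

(* The sums 6n and 6n + 1 belong to the stem; the sums below 6n are cut into
   three intervals of length 2n, and mate reflects each of them. *)
Definition interval_start g : nat := match g with None => 0 | Some false => 2 * n | Some true => 4 * n end.
Definition sum_stem j : option bool := if j < 6 * n then None else Some (val j == 6 * n + 1).
Definition sum_group j : option bool := if j < 2 * n then None else Some (4 * n <= j).
Definition mate_nat (j : nat) : nat :=
  if j < 2 * n then 2 * n - 1 - j else if j < 4 * n then 6 * n - 1 - j else 10 * n - 1 - j.
Definition sum_mate j : W := inord (mate_nat j).
Definition short_diff a : bool := odd a && ((a < 2 * n) || (4 * n + 2 < a)).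

Lemma sum_stem_None j : (sum_stem j == None) = (j < 6 * n).
Proof. by rewrite /sum_stem; case: ifP. Qed.

Lemma mate_nat_lt (j : nat) : j < 6 * n -> mate_nat j < 6 * n.
Proof. by rewrite /mate_nat; do ?case: ifP; lia. Qed.

Lemma val_sum_mate j : j < 6 * n -> sum_mate j = mate_nat j :> nat.
Proof. by move/mate_nat_lt => l; rewrite /sum_mate inordK //; have := tripling_modulus; lia. Qed.

Lemma mate_nat_interval g (r : nat) : r < 2 * n ->
  mate_nat (interval_start g + r) = interval_start g + (2 * n - 1 - r).
Proof. by rewrite /mate_nat; case: g => [[]|] /= r_lt; do ?case: ifP; lia. Qed.

Lemma interval_lt g (r : nat) : r < 2 * n -> interval_start g + r < 6 * n.
Proof. by case: g => [[]|] /=; lia. Qed.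

Lemma interval_ex j : j < 6 * n -> exists2 r, r < 2 * n & j = interval_start (sum_group j) + r :> nat.
Proof.
move=> j_lt; exists (j - interval_start (sum_group j)); rewrite /sum_group;
  by case: (ltnP j (2 * n)) => j2 /=; last (case: (leqP (4 * n) j) => j4 /=); lia.
Qed.

Lemma sum_group_interval g j (r : nat) : r < 2 * n -> j = interval_start g + r :> nat -> sum_group j = g.
Proof.
move=> r_lt jE; rewrite /sum_group; move: jE; case: g => [[]|] /= jE; case: ifP => j2 //;
  by [congr Some; lia|lia].
Qed.

Lemma val_mate_sub g j (r : nat) : r < 2 * n -> j = interval_start g + r :> nat ->
  val (sum_mate j - j)%R = if r < n then 2 * n - 1 - r.*2 else 8 * n + 1 - r.*2.
Proof.
move=> r_lt jE; rewrite val_Zp_sub val_sum_mate jE ?interval_lt // mate_nat_interval // tripling_modulus.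
by move: (interval_start g) => b; do 2!case: ifP; lia.
Qed.

Lemma short_diffN a : short_diff (- a)%R = short_diff a.
Proof.
have a_lt := ltn_ord a; have w_eq := tripling_modulus.
have : val (- a)%R = (if a == 0 :> nat then 0 else 6 * n + 2 - a).
  by have := val_Zp_sub 0%R a; rewrite sub0r => -> /=; case: ifP; case: ifP; lia.
by rewrite /short_diff /= => ->; case: ifP; lia.
Qed.

Lemma sum_stem_bij l : exists! j, sum_stem j = Some l.
Proof.
have w_eq := tripling_modulus.
have val_j : (inord (6 * n + l) : W) = 6 * n + l :> nat by rewrite inordK //; case: l; lia.
exists (inord (6 * n + l)); split=> [|j].
  by rewrite /sum_stem /= val_j; case: ifP => [|_]; [case: (l); lia|congr Some; case: (l); lia].
rewrite /sum_stem; case: ifP => // j_ge [jl]; apply: val_inj; rewrite /= val_j.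
by have := ltn_ord j; move: jl => /=; case: (l); lia.
Qed.

Lemma sum_mate_short g a : short_diff a ->
  exists! j, [/\ sum_stem j = None, sum_group j = g & (sum_mate j - j)%R = a].
Proof.
move=> short_a; have w_eq := tripling_modulus; have a_lt := ltn_ord a.
pose r := if a < 2 * n then (2 * n - 1 - a)./2 else (8 * n + 1 - a)./2.
have r_lt : r < 2 * n by rewrite /r; move: short_a; rewrite /short_diff; case: ifP; lia.
have val_j : (inord (interval_start g + r) : W) = interval_start g + r :> nat.
  by rewrite inordK //; have := interval_lt g r_lt; lia.
exists (inord (interval_start g + r)); split.
  split; last 1 first.
  - apply: val_inj; rewrite (val_mate_sub r_lt val_j) /r.
    by move: short_a; rewrite /short_diff /=; do 2!case: ifP; lia.
  - by apply/eqP; rewrite sum_stem_None val_j interval_lt.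
  exact: sum_group_interval r_lt val_j.
move=> j [/eqP]; rewrite sum_stem_None => /interval_ex [r' r'_lt jE] gE.
move/(congr1 val); rewrite gE in jE; rewrite (val_mate_sub r'_lt jE) => aE.
apply: val_inj; rewrite /= val_j jE; congr (_ + _); rewrite /r.
by move: short_a aE; rewrite /short_diff /=; do 2!case: ifP; lia.
Qed.

Lemma tripling_mate_system : mate_system sum_stem sum_group sum_mate short_diff.
Proof.
have bound j : sum_stem j = None -> j < 6 * n by move/eqP; rewrite sum_stem_None.
split=> //.
- exact: sum_stem_bij.
- move=> j /bound j_lt; apply: val_inj; rewrite /= !val_sum_mate ?mate_nat_lt //.
  have [r r_lt ->] := interval_ex j_lt; rewrite !mate_nat_interval; lia.
- by move=> j /bound j_lt; apply/eqP; rewrite sum_stem_None val_sum_mate ?mate_nat_lt.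
- move=> j /bound j_lt; have [r r_lt jE] := interval_ex j_lt.
  apply: (@sum_group_interval _ _ (2 * n - 1 - r)); first lia.
  by rewrite val_sum_mate // {1}jE mate_nat_interval.
- move=> j /bound j_lt; have [r r_lt jE] := interval_ex j_lt.
  have := val_mate_sub r_lt jE; rewrite /short_diff /= => ->; case: ifP; rewrite /n; lia.
exact: sum_mate_short.
Qed.

Lemma cqs_tripling : cqs bool (option bool) W.
Proof.
have [|a /andP [] //|K [colour fc]] := @long_edge_one_factorization (12 * t + 9) short_diff _ _ short_diffN.
  by lia.
exact: (cqs_triple (W := W) tripling_mate_system fc).
Qed.

Lemma sqs_triple : sqs 'I_(24 * t + 22) -> sqs 'I_(72 * t + 62).
Proof.
move=> sqs_t; have := sqs_of_cqs2 cqs_tripling (sqs_card _ sqs_t).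
rewrite card_sum card_bool !card_ord => /(_ ltac:(lia)); apply: sqs_card.
by rewrite card_sum card_prod card_option card_bool !card_ord; lia.
Qed.

End TripleInstance.

(** * Designs found by computer *)

Definition quadruples (A : Type) (s : seq A) : seq (seq A) := reshape (nseq (size s %/ 4) 4) s.

Definition orbits (fs : seq (nat -> nat)) (base : seq nat) : seq (seq nat) :=
  undup [seq sort leq (map f b) | f <- fs, b <- quadruples base].

Definition sub_triples (b : seq nat) : seq (seq nat) := [seq rem x b | x <- b].

Definition triples (N : nat) : seq (seq nat) :=
  [seq x :: yz | x <- iota 0 N,
    yz <- [seq [:: y; z] | y <- iota x.+1 (N - x.+1), z <- iota y.+1 (N - y.+1)]].

Definition check_design (N : nat) (hole : pred (seq nat)) (bs : seq (seq nat)) : bool :=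
  all (fun b => [&& sorted ltn b, size b == 4 & all (ltn^~ N) b]) bs &&
  (sort (<=%O : rel (seqlexi nat)) (flatten (map sub_triples bs)) == [seq t <- triples N | ~~ hole t]).

Lemma mem_triples N t : (t \in triples N) = [&& size t == 3, sorted ltn t & all (ltn^~ N) t].
Proof.
apply/allpairsPdep/idP => [[x [yz [+ /allpairsPdep [y [z [+ + -> ->]]]]]]|].
  by rewrite !mem_iota /=; lia.
case: t => [|x [|y [|z []]]] //= xyz; exists x, [:: y; z]; split=> //; first by rewrite mem_iota; lia.
by apply/allpairsPdep; exists y, z; rewrite !mem_iota; split=> //; lia.
Qed.

Lemma uniq_triples N : uniq (triples N).
Proof.
apply: allpairs_uniq_dep (iota_uniq _ _) _ _ => [x _|[x yz] [x' yz'] _ _ /= [-> ->] //].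
by apply: allpairs_uniq_dep => [|y _|[y z] [y' z'] _ _ /= [-> ->] //]; apply: iota_uniq.
Qed.

Lemma uniq_flatten_map_inj (A B : eqType) (f : A -> seq B) s a a' b : uniq (flatten (map f s)) ->
  a \in s -> a' \in s -> b \in f a -> b \in f a' -> a = a'.
Proof.
elim: s => //= c s IHs; rewrite cat_uniq => /and3P [_ /hasPn disjoint us]; rewrite !inE.
have absurd d : d \in s -> b \in f d -> b \in f c -> False.
  by move=> ds bd; apply/negP/disjoint/flatten_mapP; exists d.
move=> /orP [/eqP ->|as_] /orP [/eqP ->|as'] // ba ba'; last exact: IHs.
  by case: (absurd a').
by case: (absurd a).
Qed.

Lemma sort_triple_rem b (x y z w : nat) : sorted ltn b -> perm_eq b [:: x; y; z; w] ->
  sort leq [:: x; y; z] = rem w b.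
Proof.
move=> sorted_b b_xyzw; have w_b : w \in b by rewrite (perm_mem b_xyzw) !inE eqxx !orbT.
apply: (sorted_eq leq_trans anti_leq); first exact: sort_sorted leq_total _.
  apply: subseq_sorted leq_trans _ _ (rem_subseq w b) _.
  by move: sorted_b; rewrite ltn_sorted_uniq_leq => /andP [].
rewrite perm_sort -(perm_cons w) -(permPr (perm_to_rem w_b)) (permPr b_xyzw).
by apply/permP => f /=; lia.
Qed.

Section CheckDesign.
Variables (N : nat) (hole : pred (seq nat)) (bs : seq (seq nat)).
Hypotheses (hole_perm : forall s s', perm_eq s s' -> hole s = hole s') (checked : check_design N hole bs).
Implicit Types x y z w : 'I_N.

Definition listed_block x y z w : Prop := exists2 b, b \in bs & perm_eq b [:: val x; val y; val z; val w].

Lemma listed_block_sorted b : b \in bs -> [&& sorted ltn b, size b == 4 & all (ltn^~ N) b].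
Proof. by case/andP: checked => /allP wf _ /wf. Qed.

Lemma perm_listed_triples : perm_eq (flatten (map sub_triples bs)) [seq t <- triples N | ~~ hole t].
Proof. by case/andP: checked => _ /eqP <-; rewrite perm_sym perm_sort. Qed.

Lemma mem_listed_triples t : (t \in flatten (map sub_triples bs)) = ~~ hole t && (t \in triples N).
Proof. by rewrite (perm_mem perm_listed_triples) mem_filter. Qed.

Lemma listed_block_triple x y z w b : b \in bs -> perm_eq b [:: val x; val y; val z; val w] ->
  sort leq [:: val x; val y; val z] \in sub_triples b.
Proof.
move=> b_bs b_xyzw; have /and3P [sorted_b _ _] := listed_block_sorted b_bs.
rewrite (sort_triple_rem sorted_b b_xyzw); apply: map_f.
by rewrite (perm_mem b_xyzw) !inE eqxx !orbT.
Qed.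

Lemma sorted_triple_in x y z : (sort leq [:: val x; val y; val z] \in triples N) = distinct3 x y z.
Proof.
rewrite mem_triples size_sort eqxx ltn_sorted_uniq_leq sort_uniq sort_sorted ?andbT; last exact: leq_total.
rewrite (perm_all _ (permEl (perm_sort _ _))) /= !ltn_ord !andbT !inE negb_or.
by rewrite /distinct3 -!(inj_eq val_inj) andbA.
Qed.

Lemma listed_block_uniq x y z w w' : listed_block x y z w -> listed_block x y z w' -> w = w'.
Proof.
have uniq_triples_bs : uniq (flatten (map sub_triples bs)).
  by rewrite (perm_uniq perm_listed_triples) filter_uniq // uniq_triples.
move=> [b b_bs b_w] [b' b'_bs b'_w']; have eb : b = b'.
  exact: uniq_flatten_map_inj uniq_triples_bs b_bs b'_bs
    (listed_block_triple b_bs b_w) (listed_block_triple b'_bs b'_w').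
subst b'; move: b'_w'; rewrite (permPl b_w).
rewrite (perm_cat2l [:: val x; val y; val z] [:: val w]) => /perm_mem /(_ (val w)).
by rewrite !inE eqxx => /esym /eqP /val_inj.
Qed.

Lemma listed_design : design
  (fun x y z => distinct3 x y z && ~~ hole [:: val x; val y; val z]) listed_block.
Proof.
have hole_sort x y z : hole (sort leq [:: val x; val y; val z]) = hole [:: val x; val y; val z].
  exact/hole_perm/permEl/perm_sort.
split.
- by move=> x y z w [b b_bs b_w]; exists b => //; apply: perm_trans b_w (perm_eq_swap12 _ _ _ _).
- by move=> x y z w [b b_bs b_w]; exists b => //; apply: perm_trans b_w (perm_eq_swap23 _ _ _ _).
- by move=> x y z w [b b_bs b_w]; exists b => //; apply: perm_trans b_w (perm_eq_swap34 _ _ _ _).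
- move=> x y z w [b b_bs b_w]; rewrite andbC -hole_sort -sorted_triple_in -mem_listed_triples.
  by apply/flatten_mapP; exists b => //; apply: listed_block_triple b_w.
- move=> x y z; rewrite andbC -hole_sort -sorted_triple_in -mem_listed_triples => /flatten_mapP [b b_bs].
  case/mapP => w w_b xyzE; have /and3P [_ _ /allP b_lt] := listed_block_sorted b_bs.
  exists (Ordinal (b_lt w w_b)); exists b => //=; rewrite (permPl (perm_to_rem w_b)) -xyzE.
  apply: (@perm_trans _ [:: w; val x; val y; val z]); first by rewrite perm_cons perm_sort.
  by apply/permP => f /=; lia.
exact: listed_block_uniq.
Qed.

End CheckDesign.

(* CQS(g^n : s) has n groups of size g and a stem of size s. *)
Definition sqs10_base : seq nat :=
  [:: 0; 1; 2; 6; 0; 1; 3; 4; 0; 2; 4; 7].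
Definition sqs14_base : seq nat :=
  [:: 0; 1; 4; 5; 0; 4; 9; 13; 0; 2; 7; 9; 0; 2; 11; 13; 0; 3; 7; 10; 0; 1; 2; 3; 0; 2; 4; 10; 0;
  2; 5; 6; 0; 1; 7; 8; 0; 3; 6; 11; 0; 1; 6; 9; 1; 3; 5; 9; 0; 3; 5; 13].
Definition cqs_6_3_0_base : seq nat :=
  [:: 0; 3; 8; 11; 0; 4; 9; 13; 0; 2; 7; 9; 0; 1; 2; 10; 0; 1; 3; 5; 0; 1; 4; 8; 0; 1; 6; 11; 0;
  1; 13; 15; 0; 1; 7; 14; 0; 1; 12; 16; 0; 2; 8; 12].
Definition cqs_6_3_4_base : seq nat :=
  [:: 0; 1; 2; 12; 0; 1; 3; 16; 0; 1; 4; 9; 0; 1; 5; 20; 0; 1; 6; 13; 0; 1; 7; 14; 0; 1; 8; 21; 0;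
  1; 10; 15; 0; 1; 11; 19; 0; 1; 17; 18; 0; 2; 3; 5; 0; 2; 4; 20; 0; 2; 6; 14; 0; 2; 7; 18; 0; 2;
  8; 13; 0; 2; 9; 11; 0; 2; 16; 21; 0; 3; 8; 17; 0; 4; 5; 21; 0; 4; 8; 19; 0; 4; 14; 18; 0; 5; 7;
  19; 0; 5; 8; 9; 0; 7; 9; 16; 0; 7; 17; 20; 1; 2; 4; 11; 1; 2; 5; 16; 1; 2; 7; 8; 1; 2; 10; 17;
  1; 5; 10; 14].
Definition cqs_12_3_2_base : seq nat :=
  [:: 0; 1; 2; 15; 0; 1; 3; 11; 0; 1; 4; 9; 0; 1; 5; 16; 0; 1; 6; 7; 0; 1; 8; 23; 0; 1; 10; 18; 0;
  1; 12; 13; 0; 1; 14; 34; 0; 1; 17; 21; 0; 1; 19; 27; 0; 1; 20; 22; 0; 1; 26; 36; 0; 1; 28; 33;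
  0; 1; 29; 32; 0; 1; 30; 31; 0; 1; 35; 37; 0; 2; 3; 10; 0; 2; 4; 19; 0; 2; 5; 28; 0; 2; 6; 8; 0;
  2; 7; 17; 0; 2; 9; 11; 0; 2; 12; 14; 0; 2; 13; 35; 0; 2; 16; 21; 0; 2; 18; 20; 0; 2; 22; 23; 0;
  2; 25; 36; 0; 2; 27; 29; 0; 2; 30; 32; 0; 2; 31; 33; 0; 2; 34; 37; 0; 3; 4; 31; 0; 3; 5; 25; 0;
  3; 7; 23; 0; 3; 8; 17; 0; 3; 13; 22; 0; 3; 14; 16; 0; 3; 19; 29; 0; 3; 20; 28; 0; 3; 26; 35; 0;
  3; 32; 34; 0; 4; 5; 20; 0; 4; 6; 10; 0; 4; 7; 26; 0; 4; 8; 11; 0; 4; 12; 16; 0; 4; 13; 18; 0; 4;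
  14; 21; 0; 4; 15; 35; 0; 4; 17; 25; 0; 4; 22; 27; 0; 4; 23; 36; 0; 4; 29; 33; 0; 4; 30; 34; 0;
  4; 32; 37; 0; 5; 6; 11; 0; 5; 7; 10; 0; 5; 8; 27; 0; 5; 9; 23; 0; 5; 12; 17; 0; 5; 13; 21; 0; 5;
  14; 33; 0; 5; 15; 34; 0; 5; 18; 32; 0; 5; 19; 26; 0; 5; 22; 36; 0; 5; 30; 35; 0; 5; 31; 37; 0;
  6; 13; 19; 0; 6; 14; 20; 0; 6; 16; 22; 0; 6; 17; 23; 0; 6; 25; 31; 0; 6; 26; 32; 0; 6; 28; 34;
  0; 6; 29; 35; 0; 7; 8; 33; 0; 7; 9; 16; 0; 7; 11; 21; 0; 7; 12; 31; 0; 7; 13; 24; 0; 7; 14; 28;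
  0; 7; 15; 32; 0; 7; 18; 25; 0; 7; 19; 30; 0; 7; 20; 36; 0; 7; 22; 35; 0; 7; 27; 34; 0; 7; 29;
  37; 0; 8; 9; 26; 0; 8; 10; 21; 0; 8; 12; 32; 0; 8; 13; 34; 0; 8; 14; 24; 0; 8; 15; 31; 0; 8; 16;
  29; 0; 8; 18; 35; 0; 8; 19; 36; 0; 8; 20; 30; 0; 8; 22; 25; 0; 8; 28; 37; 0; 9; 10; 28; 0; 9;
  13; 31; 0; 9; 14; 17; 0; 9; 19; 22; 0; 9; 20; 29; 0; 9; 25; 34; 0; 9; 32; 35; 0; 10; 11; 31; 0;
  10; 12; 34; 0; 10; 13; 27; 0; 10; 14; 35; 0; 10; 15; 29; 0; 10; 16; 24; 0; 10; 17; 36; 0; 10;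
  19; 33; 0; 10; 20; 23; 0; 10; 22; 30; 0; 10; 25; 32; 0; 10; 26; 37; 0; 11; 12; 35; 0; 11; 13;
  32; 0; 11; 14; 19; 0; 11; 15; 28; 0; 11; 16; 36; 0; 11; 17; 24; 0; 11; 18; 29; 0; 11; 20; 27; 0;
  11; 22; 33; 0; 11; 23; 30; 0; 11; 25; 37; 0; 11; 26; 34; 0; 13; 14; 36; 0; 13; 15; 26; 0; 13;
  16; 17; 0; 13; 20; 33; 0; 13; 23; 37; 0; 13; 25; 30; 0; 13; 28; 29; 0; 14; 15; 25; 0; 14; 18;
  23; 0; 14; 22; 37; 0; 14; 26; 30; 0; 14; 27; 32; 0; 14; 29; 31; 0; 15; 16; 23; 0; 15; 17; 22; 0;
  15; 19; 20; 0; 16; 18; 34; 0; 16; 19; 32; 0; 16; 20; 37; 0; 16; 25; 27; 0; 16; 26; 31; 0; 16;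
  28; 30; 0; 16; 33; 35; 0; 17; 18; 26; 0; 17; 19; 37; 0; 17; 20; 31; 0; 17; 27; 35; 0; 17; 28;
  32; 0; 17; 29; 30; 0; 17; 33; 34; 0; 18; 19; 28; 0; 18; 22; 31; 0; 19; 21; 35; 0; 19; 23; 34; 0;
  20; 21; 34; 0; 20; 25; 35; 0; 21; 22; 32; 0; 21; 23; 31; 0; 21; 25; 29; 0; 21; 26; 28; 0; 22;
  26; 29; 0; 23; 25; 28; 0; 23; 26; 27; 0; 23; 32; 33; 0; 25; 26; 33; 0; 27; 28; 31; 0; 28; 35;
  36; 0; 29; 34; 36; 0; 31; 32; 36; 0; 31; 34; 35; 1; 2; 3; 16; 1; 2; 4; 11; 1; 2; 5; 27; 1; 2; 6;
  17; 1; 2; 7; 8; 1; 2; 10; 20; 1; 2; 13; 14; 1; 2; 18; 22; 1; 2; 19; 29; 1; 2; 21; 23; 1; 2; 28;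
  35; 1; 2; 30; 34; 1; 2; 31; 32; 1; 2; 33; 37; 1; 3; 4; 8; 1; 3; 5; 20; 1; 3; 6; 26; 1; 3; 7; 9;
  1; 3; 10; 30; 1; 3; 13; 15; 1; 3; 17; 22; 1; 3; 18; 35; 1; 3; 19; 21; 1; 3; 23; 36; 1; 3; 29;
  34; 1; 3; 31; 33; 1; 3; 32; 37; 1; 4; 6; 23; 1; 4; 14; 15; 1; 4; 17; 30; 1; 4; 18; 27; 1; 4; 20;
  29; 1; 4; 21; 26; 1; 4; 32; 33; 1; 5; 6; 8; 1; 5; 7; 11; 1; 5; 9; 34; 1; 5; 10; 32; 1; 5; 13;
  17; 1; 5; 14; 28; 1; 5; 15; 22; 1; 5; 18; 26; 1; 5; 19; 23; 1; 5; 21; 36; 1; 5; 30; 37; 1; 5;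
  31; 35; 1; 6; 9; 10; 1; 6; 11; 27; 1; 6; 13; 30; 1; 6; 14; 22; 1; 6; 15; 19; 1; 6; 16; 35; 1; 6;
  18; 31; 1; 6; 20; 36; 1; 6; 21; 32; 1; 6; 29; 37; 1; 6; 33; 34; 1; 7; 14; 20; 1; 7; 15; 21; 1;
  7; 17; 23; 1; 7; 26; 32; 1; 7; 27; 33; 1; 7; 29; 35; 1; 8; 9; 30; 1; 8; 10; 11; 1; 8; 13; 32; 1;
  8; 14; 25; 1; 8; 15; 29; 1; 8; 16; 33; 1; 8; 17; 19; 1; 8; 18; 36; 1; 8; 20; 31; 1; 8; 26; 28;
  1; 8; 27; 37; 1; 8; 34; 35; 1; 9; 11; 22; 1; 9; 13; 33; 1; 9; 14; 35; 1; 9; 15; 25; 1; 9; 16;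
  32; 1; 9; 17; 36; 1; 9; 18; 19; 1; 9; 20; 23; 1; 9; 21; 31; 1; 9; 26; 37; 1; 9; 27; 28; 1; 10;
  14; 23; 1; 10; 15; 33; 1; 10; 17; 35; 1; 10; 26; 29; 1; 11; 13; 35; 1; 11; 14; 18; 1; 11; 15;
  36; 1; 11; 16; 30; 1; 11; 17; 25; 1; 11; 19; 20; 1; 11; 21; 34; 1; 11; 23; 31; 1; 11; 26; 33; 1;
  11; 28; 29; 1; 14; 16; 27; 1; 14; 17; 33; 1; 14; 19; 32; 1; 14; 21; 37; 1; 14; 26; 31; 1; 14;
  29; 30; 1; 15; 16; 26; 1; 15; 18; 28; 1; 15; 20; 37; 1; 15; 23; 30; 1; 15; 27; 31; 1; 15; 32;
  35; 1; 16; 18; 23; 1; 16; 20; 21; 1; 17; 18; 37; 1; 17; 20; 28; 1; 17; 26; 34; 1; 17; 27; 32; 1;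
  17; 29; 31; 1; 18; 20; 33; 1; 18; 21; 29; 1; 18; 32; 34; 1; 19; 26; 35; 1; 20; 27; 30; 1; 21;
  22; 35; 1; 21; 28; 30; 1; 22; 23; 33; 1; 22; 26; 30; 1; 22; 27; 29; 1; 23; 27; 34; 1; 23; 28;
  32; 1; 27; 35; 36; 1; 29; 33; 36; 1; 30; 32; 36; 1; 30; 33; 35; 2; 3; 4; 17; 2; 3; 5; 7; 2; 3;
  6; 29; 2; 3; 8; 9; 2; 3; 11; 21; 2; 3; 14; 15; 2; 3; 18; 34; 2; 3; 19; 23; 2; 3; 20; 30; 2; 3;
  22; 36; 2; 3; 31; 37; 2; 3; 32; 33; 2; 4; 5; 31; 2; 4; 6; 7; 2; 4; 8; 10; 2; 4; 9; 35; 2; 4; 14;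
  16; 2; 4; 18; 23; 2; 4; 21; 36; 2; 4; 22; 29; 2; 4; 30; 37; 2; 4; 32; 34; 2; 5; 6; 15; 2; 5; 9;
  19; 2; 5; 10; 18; 2; 5; 16; 30; 2; 6; 9; 22; 2; 6; 10; 27; 2; 6; 14; 30; 2; 6; 16; 23; 2; 6; 18;
  32; 2; 6; 19; 36; 2; 6; 20; 33; 2; 6; 21; 31; 2; 6; 28; 37; 2; 7; 9; 30; 2; 7; 10; 21; 2; 7; 11;
  16; 2; 7; 14; 31; 2; 7; 15; 23; 2; 7; 18; 36; 2; 7; 19; 32; 2; 7; 22; 33; 2; 7; 27; 37; 2; 7;
  29; 34; 2; 8; 15; 21; 2; 8; 16; 22; 2; 8; 27; 33; 2; 8; 28; 34; 2; 9; 10; 31; 2; 9; 14; 33; 2;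
  9; 15; 26; 2; 9; 16; 36; 2; 9; 17; 34; 2; 9; 18; 29; 2; 9; 20; 27; 2; 9; 21; 32; 2; 10; 11; 28;
  2; 10; 14; 34; 2; 10; 15; 36; 2; 10; 16; 26; 2; 10; 17; 33; 2; 10; 19; 35; 2; 10; 22; 32; 2; 11;
  18; 27; 2; 11; 19; 22; 2; 11; 30; 33; 2; 15; 16; 35; 2; 15; 17; 28; 2; 15; 19; 37; 2; 15; 22;
  30; 2; 15; 27; 32; 2; 15; 29; 33; 2; 15; 31; 34; 2; 16; 17; 27; 2; 16; 18; 37; 2; 16; 20; 34; 2;
  16; 28; 32; 2; 17; 21; 22; 2; 18; 19; 33; 2; 18; 21; 28; 2; 18; 31; 35; 2; 19; 20; 28; 2; 19;
  21; 34; 2; 19; 27; 30; 2; 20; 22; 31; 2; 21; 30; 35; 2; 22; 27; 35; 2; 23; 27; 31; 2; 23; 28;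
  30; 2; 27; 34; 36; 2; 28; 29; 31; 2; 28; 33; 36; 2; 30; 31; 36; 2; 33; 34; 35; 3; 4; 5; 6; 3; 4;
  9; 10; 3; 4; 15; 16; 3; 4; 18; 32; 3; 4; 19; 35; 3; 4; 20; 36; 3; 4; 22; 30; 3; 4; 29; 37; 3; 4;
  33; 34; 3; 5; 8; 22; 3; 5; 9; 11; 3; 5; 15; 17; 3; 5; 18; 31; 3; 5; 19; 36; 3; 5; 21; 23; 3; 5;
  28; 37; 3; 5; 30; 32; 3; 5; 33; 35; 3; 6; 7; 34; 3; 6; 8; 19; 3; 6; 10; 17; 3; 6; 11; 20; 3; 6;
  22; 23; 3; 6; 28; 35; 3; 7; 10; 20; 3; 7; 11; 28; 3; 7; 15; 31; 3; 7; 16; 21; 3; 7; 17; 36; 3;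
  7; 18; 29; 3; 7; 19; 33; 3; 7; 22; 32; 3; 8; 10; 31; 3; 8; 11; 30; 3; 8; 15; 32; 3; 8; 16; 36;
  3; 8; 18; 28; 3; 8; 20; 33; 3; 8; 21; 35; 3; 8; 23; 34; 3; 9; 16; 22; 3; 9; 17; 23; 3; 9; 28;
  34; 3; 9; 29; 35; 3; 10; 11; 32; 3; 10; 15; 34; 3; 10; 16; 27; 3; 10; 21; 28; 3; 10; 22; 33; 3;
  10; 23; 37; 3; 11; 15; 35; 3; 11; 16; 19; 3; 11; 17; 27; 3; 11; 22; 37; 3; 11; 23; 33; 3; 16;
  17; 37; 3; 16; 18; 20; 3; 16; 23; 31; 3; 16; 28; 33; 3; 16; 29; 32; 3; 17; 18; 19; 3; 17; 28;
  31; 3; 17; 29; 33; 3; 17; 30; 35; 3; 19; 20; 34; 3; 19; 28; 30; 3; 20; 21; 29; 3; 20; 22; 35; 3;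
  21; 22; 31; 3; 28; 32; 36; 3; 29; 31; 36; 3; 30; 31; 34; 3; 31; 32; 35; 3; 34; 35; 37; 4; 5; 8;
  21; 4; 5; 9; 30; 4; 5; 10; 11; 4; 5; 16; 17; 4; 5; 18; 36; 4; 5; 19; 33; 4; 5; 22; 32; 4; 5; 34;
  35; 4; 6; 9; 20; 4; 6; 16; 30; 4; 6; 17; 36; 4; 6; 18; 34; 4; 6; 19; 32; 4; 6; 21; 29; 4; 7; 8;
  18; 4; 7; 9; 17; 4; 7; 11; 33; 4; 7; 21; 30; 4; 7; 23; 32; 4; 8; 16; 32; 4; 8; 17; 31; 4; 8; 19;
  30; 4; 8; 20; 34; 4; 8; 23; 33; 4; 9; 11; 32; 4; 9; 16; 33; 4; 9; 18; 22; 4; 9; 19; 29; 4; 9;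
  21; 34; 4; 9; 23; 37; 4; 10; 17; 23; 4; 10; 29; 35; 4; 11; 16; 35; 4; 11; 17; 28; 4; 11; 20; 22;
  4; 11; 21; 37; 4; 11; 23; 34; 4; 11; 29; 31; 4; 17; 18; 33; 4; 17; 19; 21; 4; 17; 22; 35; 4; 17;
  29; 34; 4; 18; 19; 20; 4; 18; 21; 31; 4; 20; 21; 35; 4; 20; 23; 31; 4; 29; 30; 36; 4; 30; 32;
  35; 4; 33; 35; 37; 5; 6; 9; 32; 5; 6; 10; 31; 5; 6; 17; 30; 5; 6; 18; 35; 5; 6; 19; 22; 5; 6;
  20; 34; 5; 6; 23; 33; 5; 7; 8; 34; 5; 7; 17; 31; 5; 7; 18; 21; 5; 7; 19; 35; 5; 7; 20; 33; 5; 7;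
  22; 30; 5; 8; 9; 18; 5; 8; 10; 33; 5; 8; 30; 31; 5; 9; 17; 33; 5; 9; 20; 31; 5; 9; 21; 35; 5; 9;
  22; 37; 5; 10; 17; 34; 5; 10; 20; 30; 5; 10; 21; 37; 5; 10; 22; 35; 5; 18; 19; 34; 5; 18; 20;
  22; 5; 19; 20; 21; 5; 22; 23; 31; 5; 31; 32; 34; 5; 33; 34; 37; 6; 7; 9; 35; 6; 7; 11; 32; 6; 7;
  18; 19; 6; 7; 23; 37; 6; 8; 9; 34; 6; 8; 18; 20; 6; 8; 22; 37; 6; 8; 23; 31; 6; 8; 33; 35; 6;
  10; 11; 36; 6; 10; 18; 22; 6; 10; 20; 37; 6; 10; 21; 23; 6; 10; 32; 35; 6; 11; 18; 23; 6; 11;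
  19; 37; 6; 11; 21; 22; 6; 11; 31; 34; 6; 19; 20; 35; 6; 21; 34; 35; 6; 22; 31; 33; 6; 22; 35;
  36; 6; 23; 34; 36; 6; 31; 35; 37; 6; 32; 34; 37; 7; 8; 19; 20; 7; 8; 21; 37; 7; 9; 10; 32; 7; 9;
  11; 36; 7; 9; 19; 21; 7; 9; 20; 37; 7; 11; 19; 23; 7; 11; 20; 34; 7; 20; 21; 23; 7; 21; 35; 36;
  7; 23; 33; 36; 7; 32; 33; 37; 8; 9; 10; 36; 8; 9; 20; 21; 8; 10; 20; 22; 8; 21; 34; 36; 8; 22;
  33; 36; 9; 10; 21; 22; 9; 11; 21; 23; 10; 11; 22; 23].
Definition cqs_6_5_4_base : seq nat :=
  [:: 0; 2; 7; 9; 0; 2; 12; 20; 0; 5; 12; 18; 0; 2; 24; 27; 0; 2; 8; 15; 0; 2; 5; 17; 0; 5; 11;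
  24; 0; 3; 21; 25; 0; 6; 12; 21; 0; 3; 7; 10; 0; 2; 18; 21; 0; 4; 11; 20; 0; 5; 16; 23; 0; 2; 11;
  22; 0; 5; 13; 21; 0; 2; 10; 16; 0; 1; 6; 10; 0; 1; 8; 21; 0; 1; 5; 19; 0; 1; 9; 25; 0; 1; 12;
  15; 0; 1; 11; 28; 0; 1; 7; 17; 0; 1; 18; 26; 0; 1; 2; 4; 0; 1; 14; 27; 0; 3; 20; 24; 0; 1; 16;
  20; 0; 4; 8; 23; 0; 2; 14; 32; 0; 3; 22; 32; 0; 1; 24; 32; 0; 4; 21; 32; 0; 1; 22; 30; 0; 3; 16;
  30; 0; 7; 18; 30; 0; 2; 26; 30; 0; 1; 23; 31; 0; 2; 19; 31; 0; 3; 9; 31; 0; 4; 16; 31; 0; 1; 13;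
  33; 0; 3; 11; 33; 0; 7; 21; 33; 0; 2; 6; 33].
Definition cqs_6_5_0_base : seq nat :=
  [:: 0; 1; 16; 23; 0; 1; 15; 17; 0; 6; 15; 23; 0; 1; 8; 22; 0; 1; 7; 9; 0; 1; 10; 24; 0; 1; 13;
  21; 0; 4; 10; 16; 0; 2; 6; 14; 0; 2; 18; 26; 0; 2; 4; 19; 0; 1; 12; 18; 0; 1; 2; 20; 0; 4; 11;
  24; 0; 2; 11; 22; 0; 3; 15; 24; 0; 3; 12; 16; 0; 1; 3; 11; 0; 3; 7; 18; 0; 3; 13; 26; 0; 3; 10;
  14; 0; 2; 9; 12; 0; 3; 17; 22; 0; 2; 8; 13; 0; 1; 6; 27; 0; 2; 7; 25; 0; 5; 11; 18; 0; 4; 14;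
  25; 0; 3; 8; 20; 0; 1; 4; 26; 0; 1; 5; 14; 0; 1; 25; 28; 0; 2; 5; 21].
Definition hdes_3_6_base : seq nat :=
  [:: 0; 3; 4; 7; 0; 1; 2; 9; 0; 5; 7; 15; 0; 4; 11; 13; 0; 2; 7; 11; 0; 1; 3; 16; 0; 2; 4; 15; 0;
  1; 11; 15; 0; 3; 8; 11; 0; 1; 8; 17; 0; 1; 4; 14; 0; 1; 5; 10; 0; 4; 9; 17; 0; 13; 15; 17; 0; 2;
  10; 17].
Definition cqs_6_3_4_shifts : seq (seq nat) :=
  [:: [:: 0; 0; 0]; [:: 0; 3; 3]; [:: 1; 1; 4]; [:: 1; 4; 1]; [:: 2; 2; 2]; [:: 2; 5; 5]; [:: 3;
  0; 3]; [:: 3; 3; 0]; [:: 4; 1; 1]; [:: 4; 4; 4]; [:: 5; 2; 5]; [:: 5; 5; 2]].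
Definition cqs_12_3_2_shifts : seq (seq nat) :=
  [:: [:: 0; 0; 0]; [:: 4; 4; 4]; [:: 8; 8; 8]].

Definition cyclic_shifts (n step count : nat) : seq (nat -> nat) :=
  [seq (fun x => if x < n then (x + k * step) %% n else x) | k <- iota 0 count].

(* The point (i, a) of the i-th of m groups of size w is numbered a * m + i, and
   the stem points are numbered from m * w; the i-th group is shifted by t_i. *)
Definition group_shifts (m w : nat) (ts : seq (seq nat)) : seq (nat -> nat) :=
  [seq (fun x => if x < m * w then (x %/ m + nth 0 t (x %% m)) %% w * m + x %% m else x) | t <- ts].

Lemma radix_inj m (i i' : 'I_m) (a a' : nat) : a * m + i = a' * m + i' -> i = i' /\ a = a'.
Proof.
move=> e; have m_gt0 : 0 < m by apply: leq_ltn_trans (ltn_ord i).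
have val_i : val i = val i' by have := congr1 (modn^~ m) e; rewrite !modnMDl !modn_small.
split; first exact: val_inj.
by have := congr1 (divn^~ m) e; rewrite !divnMDl // !divn_small // !addn0.
Qed.

Lemma radix_lt m w (i : 'I_m) (a : 'I_w) : a * m + i < m * w.
Proof.
apply: (@leq_trans (a.+1 * m)); first by rewrite mulSn addnC ltn_add2r.
by rewrite mulnC leq_mul2l ltn_ord orbT.
Qed.

Lemma sqs_of_check N bs : check_design N pred0 bs -> sqs 'I_N.
Proof.
move=> ck; exists (listed_block bs); apply: eq_design (listed_design _ ck) => // x y z.
by rewrite andbT.
Qed.

Definition separated (m : nat) (group : seq nat) (x y : nat) : bool :=
  let i := nth m group x in let j := nth m group y in [&& i != m, j != m & i != j].

Definition cqs_hole (m n : nat) : pred (seq nat) :=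
  let group := mkseq (modn^~ m) n in fun t => ~~ has (fun x => has (separated m group x) t) t.

Lemma perm_cqs_hole m n t t' : perm_eq t t' -> cqs_hole m n t = cqs_hole m n t'.
Proof.
move=> p; rewrite /cqs_hole; congr negb; rewrite (perm_has _ p); apply: eq_has => x; exact: perm_has.
Qed.

Section CandelabraNumbering.
Variables s m w : nat.
Implicit Types u v : ('I_s + 'I_m * 'I_w)%type.

Definition cqs_number u : nat := match u with inl j => m * w + j | inr p => p.2 * m + p.1 end.

Lemma cqs_number_lt u : cqs_number u < m * w + s.
Proof. by case: u => [j|[i a]] /=; rewrite ?ltn_add2l //; apply/ltn_addr/radix_lt. Qed.

Definition cqs_index u : 'I_(m * w + s) := Ordinal (cqs_number_lt u).

Lemma cqs_index_inj : injective cqs_index.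
Proof.
move=> [j|[i a]] [j'|[i' a']] /(congr1 val) /=.
- by move/addnI => e; congr inl; apply: val_inj.
- by move=> e; have := radix_lt i' a'; rewrite -e; lia.
- by move=> e; have := radix_lt i a; rewrite e; lia.
by case/radix_inj => -> /val_inj ->.
Qed.

Lemma cqs_index_bij : bijective cqs_index.
Proof. by apply: inj_card_bij cqs_index_inj _; rewrite card_sum card_prod !card_ord addnC. Qed.

Lemma separated_cross u v :
  separated m (mkseq (modn^~ m) (m * w)) (cqs_number u) (cqs_number v) = cross u v.
Proof.
have group_number x : nth m (mkseq (modn^~ m) (m * w)) (cqs_number x) = if x is inr p then val p.1 else m.
  case: x => [j|[i a]] /=; first by rewrite nth_default // size_mkseq leq_addr.
  by rewrite nth_mkseq ?radix_lt // modnMDl modn_small.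
rewrite /separated !group_number; case: u v => [j|[i a]] [j'|[i' a']] /=; rewrite ?eqxx ?andbF //.
by rewrite !neq_ltn !ltn_ord -neq_ltn.
Qed.

Lemma cqs_of_check bs : check_design (m * w + s) (cqs_hole m (m * w)) bs -> cqs 'I_s 'I_m 'I_w.
Proof.
move=> ck; have d := listed_design (@perm_cqs_hole m (m * w)) ck.
apply: (has_design_bij cqs_index_bij _ (ex_intro _ _ d)) => x y z.
rewrite /cqs_dom (distinct3_inj _ _ _ cqs_index_inj) /cqs_hole negbK /= !separated_cross.
have crossxx u : cross u u = false by case: u => [j|[i a]] //=; rewrite eqxx.
rewrite !crossxx (crossC y x) (crossC z x) (crossC z y) /=.
by case: (cross x y); case: (cross x z); case: (cross y z).
Qed.

End CandelabraNumbering.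

Definition hdes_hole (m : nat) : pred (seq nat) := fun t => ~~ uniq (map (modn^~ m) t).

Lemma hdes_of_check m w bs : check_design (m * w) (hdes_hole m) bs -> hdes 'I_m 'I_w.
Proof.
move=> ck; pose index (p : 'I_m * 'I_w) : 'I_(m * w) := Ordinal (radix_lt p.1 p.2).
have index_inj : injective index by move=> [i a] [j b] /(congr1 val) /= /radix_inj [-> /val_inj ->].
have index_bij : bijective index by apply: inj_card_bij index_inj _; rewrite card_prod !card_ord.
have hole_perm t t' : perm_eq t t' -> hdes_hole m t = hdes_hole m t'.
  by move=> p; rewrite /hdes_hole (perm_uniq (perm_map _ p)).
apply: (has_design_bij index_bij _ (ex_intro _ _ (listed_design hole_perm ck))) => p q r.
rewrite (distinct3_inj _ _ _ index_inj) /hdes_hole negbK /= !modnMDl !modn_small // !inE !andbT negb_or.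
rewrite -andbA !(inj_eq val_inj) -/(distinct3 p.1 q.1 r.1).
by split=> [d|/andP [] //]; rewrite d distinct3_of_fst.
Qed.

Lemma sqs4 : sqs 'I_4.
Proof. by apply: (@sqs_of_check _ [:: [:: 0; 1; 2; 3]]); vm_compute. Qed.

Lemma sqs14 : sqs 'I_14.
Proof. by apply: (@sqs_of_check _ (orbits (cyclic_shifts 14 2 7) sqs14_base)); vm_compute. Qed.

Lemma cqs_6_3_0 : cqs 'I_0 'I_3 'I_6.
Proof. by apply: (@cqs_of_check _ _ _ (orbits (cyclic_shifts 18 1 18) cqs_6_3_0_base)); vm_compute. Qed.

Lemma cqs_6_5_0 : cqs 'I_0 'I_5 'I_6.
Proof. by apply: (@cqs_of_check _ _ _ (orbits (cyclic_shifts 30 1 30) cqs_6_5_0_base)); vm_compute. Qed.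

Lemma cqs_6_5_4 : cqs 'I_4 'I_5 'I_6.
Proof. by apply: (@cqs_of_check _ _ _ (orbits (cyclic_shifts 30 1 30) cqs_6_5_4_base)); vm_compute. Qed.

Lemma cqs_6_3_4 : cqs 'I_4 'I_3 'I_6.
Proof.
by apply: (@cqs_of_check _ _ _ (orbits (group_shifts 3 6 cqs_6_3_4_shifts) cqs_6_3_4_base)); vm_compute.
Qed.

Lemma cqs_12_3_2 : cqs 'I_2 'I_3 'I_12.
Proof.
by apply: (@cqs_of_check _ _ _ (orbits (group_shifts 3 12 cqs_12_3_2_shifts) cqs_12_3_2_base)); vm_compute.
Qed.

Lemma hdes_3_6 : hdes 'I_6 'I_3.
Proof. by apply: (@hdes_of_check _ _ (orbits (cyclic_shifts 18 2 9) hdes_3_6_base)); vm_compute. Qed.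

(* The permutation moves the block {0, 1, 2, 6} of SQS(10) to the first four points. *)
Lemma sqs10_without_block : has_design (fun x y z : 'I_4 + 'I_6 => nonstem x y z).
Proof.
pose move_block x := nth 0 [:: 0; 1; 2; 4; 5; 6; 3; 7; 8; 9] x.
have ck : check_design 10 (all (ltn^~ 4))
    (rem [:: 0; 1; 2; 3] (orbits [seq move_block \o f | f <- cyclic_shifts 10 1 10] sqs10_base)).
  by vm_compute.
have unsplit_bij : bijective (@unsplit 4 6) by exists (@split 4 6); [exact: unsplitK|exact: splitK].
have d := listed_design (fun t t' p => perm_all _ p) ck.
apply: (has_design_bij unsplit_bij _ (ex_intro _ _ d)) => x y z.
rewrite /nonstem (distinct3_inj _ _ _ (bij_inj unsplit_bij)) /=.
have is_inlE u : (val (@unsplit 4 6 u) < 4) = is_inl u by case: u => j /=; rewrite ?ltn_ord // ltnNge leq_addr.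
rewrite !is_inlE andbT; exact: iff_refl.
Qed.

(** * Existence of Steiner quadruple systems *)

Lemma hdes_inflate (G : eqType) (W : eqType) (U : zmodType) : hdes G W -> hdes G (W * U)%type.
Proof.
case=> R dR; pose f (x : G * (W * U)) : (G * W) * U := ((x.1, x.2.1), x.2.2).
have f_bij : bijective f by exists (fun y => (y.1.1, (y.1.2, y.2))) => [[g [a b]]|[[g a] b]].
exact: (has_design_bij f_bij _ (ex_intro _ _ (weight_design U dR))).
Qed.

Lemma hdes_6_6 : hdes 'I_6 'I_6.
Proof.
by apply: hdes_card (hdes_inflate 'I_2 hdes_3_6); rewrite // card_prod !card_ord.
Qed.

Lemma gdes_double (G W : finType) : ~~ odd (#|G| * #|W|) -> gdes G W -> gdes (bool * G)%type W.
Proof.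
rewrite -card_prod => even_GW /(bool_fibred_has_design even_GW).
pose f (x : (bool * G) * W) : bool * (G * W) := (x.1.1, (x.1.2, x.2)).
have f_bij : bijective f by exists (fun y => ((y.1, y.2.1), y.2.2)) => [[[l i] a]|[l [i a]]].
apply: (has_design_bij f_bij) => -[[l i] a] [[l' j] b] [[l'' k] d].
rewrite /fibred_dom /gdom /distinct3 /f /= !xpair_eqE.
by case: l l' l'' => [] [] []; rewrite /= ?andbF ?andbT.
Qed.

Lemma gdes_one_group (G W : finType) : #|G| = 1 -> gdes G W.
Proof.
move=> /fintype1 [g gE]; apply: has_design_empty => x y z.
by rewrite /gdom (gE x.1) (gE y.1) (gE z.1) eqxx andbF.
Qed.

Lemma sqs_fill4 m : cqs 'I_4 'I_m 'I_6 -> sqs 'I_(6 * m + 4).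
Proof.
move=> cqs_m; apply: sqs_card (sqs_of_cqs cqs_m sqs10_without_block sqs4).
by rewrite card_sum card_prod !card_ord; lia.
Qed.

Lemma cqs_sqs_fan (S : finType) m (W : finZmodType) : sqs 'I_m.+1 -> cqs S 'I_3 W -> cqs S 'I_m W.
Proof. by move=> sqs_m; apply: cqs_of_sqs; apply: sqs_card sqs_m; rewrite card_option !card_ord. Qed.

Lemma cqs_gdes_fan (S : finType) m n : m.+1 = 6 * n ->
  gdes 'I_n 'I_6 -> cqs S 'I_3 'I_6 -> cqs S 'I_5 'I_6 -> cqs S 'I_m 'I_6.
Proof.
move=> m_eq gdes_n cqs3 cqs5; apply: (cqs_of_gdes _ _ gdes_n cqs3 cqs5 hdes_6_6).
  by rewrite !card_ord mulnC.
exact: card_ord.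
Qed.

Lemma sqs_fan12 m : sqs 'I_m.+1 -> sqs 'I_(12 * m + 2).
Proof.
move=> sqs_m; have cqs_m : cqs bool 'I_m 'I_12.
  by apply: cqs_card (cqs_sqs_fan sqs_m cqs_12_3_2); rewrite // card_ord card_bool.
have : sqs (bool + 'I_12)%type by apply: sqs_card sqs14; rewrite card_sum card_bool !card_ord.
by move/(sqs_of_cqs2 cqs_m); apply: sqs_card; rewrite card_sum card_prod card_bool !card_ord; lia.
Qed.

Section RecursiveStep.
Variable N : nat.
Hypotheses (sqs_lt : forall v, v < N -> v %% 6 \in [:: 2; 4] -> sqs 'I_v)
  (gdes_lt : forall m, 0 < m -> 6 * m < N -> gdes 'I_m 'I_6).

Lemma sqs_step : N %% 6 \in [:: 2; 4] -> sqs 'I_N.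
Proof.
have cast v : v = N -> sqs 'I_v -> sqs 'I_N by move=> ->.
have smaller v : v < N -> (v %% 6 == 2) || (v %% 6 == 4) -> sqs 'I_v.
  by move=> v_lt; have := @sqs_lt v v_lt; rewrite !inE.
rewrite !inE => N6; have [N2|N2] := eqVneq N 2.
  by rewrite N2; apply: sqs_card sqs_bool; rewrite card_bool card_ord.
case N12: ((N %% 12 == 4) || (N %% 12 == 8)).
  have : sqs (bool * 'I_N./2)%type by apply: sqs_double; [rewrite card_ord; lia|apply: smaller; lia].
  by apply: sqs_card; rewrite card_prod card_bool !card_ord; lia.
case N24: ((N %% 24 == 2) || (N %% 24 == 10)).
  by apply: cast (sqs_quad (k := (N - 10) %/ 8) _); [lia|apply: smaller; lia].
have N72 : [|| N %% 72 == 14, N %% 72 == 38, N %% 72 == 62, N %% 72 == 22, N %% 72 == 46 | N %% 72 == 70].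
  by lia.
case N62: (N %% 72 == 62); first by apply: cast (sqs_triple (t := N %/ 72) _); [lia|apply: smaller; lia].
case N14: ((N %% 72 == 14) || (N %% 72 == 38)).
  by apply: cast (sqs_fan12 (m := (N - 2) %/ 12) _); [lia|apply: smaller; lia].
apply: cast (sqs_fill4 (m := (N - 4) %/ 6) _); first lia.
case N70: (N %% 72 == 70); last by apply: cqs_sqs_fan cqs_6_3_4; apply: smaller; lia.
apply: (@cqs_gdes_fan _ _ (2 * (N %/ 72) + 2)) cqs_6_3_4 cqs_6_5_4; first lia.
by apply: gdes_lt; lia.
Qed.

Lemma gdes_step m : 0 < m -> 6 * m = N -> gdes 'I_m 'I_6.
Proof.
move=> m_gt0 m_eq; have [m_eq1|m_neq1] := eqVneq m 1; first by apply: gdes_one_group; rewrite card_ord.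
case odd_m: (odd m); last first.
  apply: (@gdes_card (bool * 'I_m./2)%type 'I_6); rewrite ?card_prod ?card_bool ?card_ord //; first lia.
  by apply: gdes_double; [rewrite !card_ord; lia|apply: gdes_lt; lia].
apply/gdes_cqs; case m5: (m %% 6 == 5).
  by apply: (@cqs_gdes_fan _ _ (m.+1 %/ 6)) cqs_6_3_0 cqs_6_5_0; [lia|apply: gdes_lt; lia].
by apply: cqs_sqs_fan cqs_6_3_0; apply: sqs_lt; rewrite ?inE; lia.
Qed.

End RecursiveStep.

Lemma sqs_gdes_exist N : (N %% 6 \in [:: 2; 4] -> sqs 'I_N) /\
  (forall m, 0 < m -> 6 * m = N -> gdes 'I_m 'I_6).
Proof.
elim/ltn_ind: N => N IHN.
have sqs_lt v : v < N -> v %% 6 \in [:: 2; 4] -> sqs 'I_v by move=> /IHN [].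
have gdes_lt m : 0 < m -> 6 * m < N -> gdes 'I_m 'I_6.
  by move=> m_gt0 /IHN [_]; apply.
by split=> [|m]; [apply: sqs_step|apply: gdes_step].
Qed.

Lemma sqs_exists v : v %% 6 \in [:: 2; 4] -> sqs 'I_v.
Proof. exact: (sqs_gdes_exist v).1. Qed.

Lemma gdes_exists m : 0 < m -> gdes 'I_m 'I_6.
Proof. by move=> m_gt0; apply: (sqs_gdes_exist (6 * m)).2. Qed.

(** * Codes from invariant designs *)

Lemma uniq_perm_cat (T : eqType) (s t : seq T) :
  uniq s -> {subset s <= t} -> exists r, perm_eq t (s ++ r).
Proof.
move=> us /(leq_uniq_count us) /count_subseqP [s' s't ss'].
by have [r t_s'r] := perm_to_subseq s't; exists r; rewrite (permPl t_s'r) perm_cat2r perm_sym.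
Qed.

Lemma sum_pred (I : finType) (P : pred I) : \sum_(i : I) (P i : nat) = #|P|.
Proof. by rewrite -sum1_card [RHS]big_mkcond /=; apply: eq_bigr => i _; rewrite unfold_in; case: (P i). Qed.

Lemma tuple4P (T : Type) (q : 4.-tuple T) : exists x y z w, q = [tuple x; y; z; w].
Proof.
case/tupleP: q => x q; case/tupleP: q => y q; case/tupleP: q => z q; case/tupleP: q => w q.
by exists x, y, z, w; rewrite (tuple0 q); apply: val_inj.
Qed.

(* As p is odd, 4 is invertible mod p, and every translation orbit of blocks has
   exactly one member of mean zero; these members are the codewords. *)
Section InvariantDesignCode.
Variables (p u : nat).
Hypotheses (prime_p : prime p) (odd_p : odd p).
Local Notation F := 'F_p.
Local Notation T := (F * 'I_u)%type.
Implicit Types (x y z w : T) (s : seq T) (q : 4.-tuple T) (t : F) (B : {set T}).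

Definition shift t x : T := ((x.1 + t)%R, x.2).

Variables (D : T -> T -> T -> bool) (R : T -> T -> T -> T -> Prop).
Hypotheses (dR : design (fun x y z => D x y z) R)
  (R_shift : forall t x y z w, R x y z w -> R (shift t x) (shift t y) (shift t z) (shift t w))
  (D_distinct : forall x y z, D x y z -> distinct3 x y z).

Lemma shiftK t : cancel (shift t) (shift (- t)%R).
Proof. by case=> a i; rewrite /shift /= addrK. Qed.

Lemma shift_inj t : injective (shift t).
Proof. exact: can_inj (shiftK t). Qed.

Definition block_seq s : bool := if s is [:: x; y; z; w] then `[< R x y z w >] else false.

Lemma block_seqE x y z w : block_seq [:: x; y; z; w] <-> R x y z w.
Proof. by split=> /asboolP. Qed.

Lemma perm_block_seq s s' : perm_eq s s' -> block_seq s = block_seq s'.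
Proof.
wlog suff imp : s s' / perm_eq s s' -> block_seq s -> block_seq s'.
  by move=> ss'; apply/idP/idP; apply: imp; rewrite // perm_sym.
case: s => [|x [|y [|z [|w []]]]] // ss'; have := perm_size ss'.
by case: s' ss' => [|x' [|y' [|z' [|w' []]]]] // ss' _ /block_seqE h; apply/block_seqE/(design_perm dR _ h);
  rewrite perm_sym.
Qed.

Lemma block_seq_uniq s : block_seq s -> uniq s.
Proof.
case: s => [|x [|y [|z [|w []]]]] // /block_seqE; exact: design_block_uniq dR _ _ _ _ D_distinct.
Qed.

Lemma block_seq_shift t s : block_seq s -> block_seq (map (shift t) s).
Proof. by case: s => [|x [|y [|z [|w []]]]] // /block_seqE h; apply/block_seqE/R_shift. Qed.

Definition mean s : F := ((\sum_(x <- s) x.1) / 4%:R)%R.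

Lemma four_neq0 : (4%:R != 0 :> F)%R.
Proof. by rewrite -unitfE unitFpE // -[4]/(2 ^ 2) coprimeXr ?coprimen2. Qed.

Lemma mean_shift t s : size s = 4 -> mean (map (shift t) s) = (mean s + t)%R.
Proof.
move=> s4; rewrite /mean big_map big_split /= mulrDl; congr (_ + _)%R.
by rewrite big_const_seq count_predT s4 iter_addr_0 -[(t *+ 4)%R]mulr_natr mulfK // four_neq0.
Qed.

Lemma perm_mean s s' : perm_eq s s' -> mean s = mean s'.
Proof. by move=> ss'; rewrite /mean (perm_big _ ss'). Qed.

Definition centred_blocks : {set 4.-tuple T} := [set q : 4.-tuple T | block_seq q & mean q == 0%R].
Definition point_set q : {set T} := [set x in q].
Definition codewords : {set {set T}} := point_set @: centred_blocks.

Lemma mem_centred_blocks q : (q \in centred_blocks) = block_seq q && (mean q == 0%R).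
Proof. by rewrite inE. Qed.

Lemma mem_point_set q x : (x \in point_set q) = (x \in q).
Proof. by rewrite inE. Qed.

Lemma codeword_third B x y z : B \in codewords -> x \in B -> y \in B -> z \in B -> distinct3 x y z ->
  exists w, [/\ R x y z w, mean [:: x; y; z; w] = 0%R & B = [set v in [:: x; y; z; w]]].
Proof.
case/imsetP => q; rewrite inE => /andP [block_q /eqP mean_q] ->; rewrite !inE => xq yq zq /and3P [xy xz yz].
have uniq_xyz : uniq [:: x; y; z] by rewrite /= !inE negb_or xy xz yz.
have [|r q_xyzr] := uniq_perm_cat uniq_xyz (t := q); first by move=> v; rewrite !inE => /or3P [] /eqP ->.
have := perm_size q_xyzr; rewrite size_tuple; case: r q_xyzr => [|w []] //= q_xyzw _; exists w; split.
- by apply/block_seqE; rewrite -(perm_block_seq q_xyzw).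
- by rewrite -(perm_mean q_xyzw).
by apply/setP => v; rewrite !inE (perm_mem q_xyzw) !inE.
Qed.

Lemma card_codeword B : B \in codewords -> #|B| = 4.
Proof.
case/imsetP => q; rewrite inE => /andP [/block_seq_uniq uniq_q _] ->.
by rewrite cardsE (card_uniqP uniq_q) size_tuple.
Qed.

Lemma card_centred_blocks : #|centred_blocks| = 24 * #|codewords|.
Proof.
rewrite -sum1_card (partition_big_imset point_set) /= (eq_bigr (fun=> 24)) => [|B B_code].
  by rewrite sum_nat_const mulnC.
transitivity (#|B| ^_ 4); last by rewrite card_codeword.
rewrite sum1_card -card_uniq_tuples; apply: eq_card => q.
rewrite [RHS]inE unfold_in mem_centred_blocks; apply/andP/andP => [[/andP [block_q _] /eqP <-]|[/allP q_B uniq_q]].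
  by split; [apply/allP => x; rewrite -mem_point_set|apply: block_seq_uniq block_q].
have [q' q'_centred eB] := imsetP B_code.
move: q'_centred; rewrite mem_centred_blocks => /andP [block_q' mean_q'].
have q_q' : perm_eq q q'.
  have sub : {subset q <= q'} by move=> x /q_B; rewrite eB => /(etrans (esym (mem_point_set _ _))).
  have [|_ eq_mem] := uniq_min_size uniq_q sub; first by rewrite !size_tuple.
  exact: uniq_perm uniq_q (block_seq_uniq block_q') eq_mem.
split; first by rewrite (perm_block_seq q_q') (perm_mean q_q') block_q'.
by apply/eqP/setP => x; rewrite eB !inE (perm_mem q_q').
Qed.

Definition shift_tuple t q : 4.-tuple T := map_tuple (shift t) q.

Definition shift_equivariant (f : 4.-tuple T -> F) : Prop :=
  forall t q, f (shift_tuple t q) = (f q + t)%R.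

Lemma leq_card_slices (f g : 4.-tuple T -> F) : shift_equivariant f -> shift_equivariant g ->
  #|[set q : 4.-tuple T | block_seq q & f q == 0%R]| <= #|[set q : 4.-tuple T | block_seq q & g q == 0%R]|.
Proof.
move=> f_shift g_shift; rewrite -(card_in_imset (f := fun q => shift_tuple (- g q)%R q)) => [|q q'].
  apply/subset_leq_card/subsetP => _ /imsetP [q + ->]; rewrite !inE => /andP [block_q _].
  by rewrite g_shift subrr eqxx andbT; apply: block_seq_shift.
rewrite !inE => /andP [_ /eqP fq] /andP [_ /eqP fq'] eq_shift.
have /oppr_inj eq_g : (- g q = - g q')%R by rewrite -[LHS]add0r -[RHS]add0r -{1}fq -fq' -!f_shift eq_shift.
apply: val_inj; apply: (inj_map (@shift_inj (- g q)%R)).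
by rewrite {2}eq_g; exact: (congr1 val eq_shift).
Qed.

Definition based_blocks : {set 4.-tuple T} := [set q : 4.-tuple T | block_seq q & (thead q).1 == 0%R].

Lemma card_based_blocks : #|centred_blocks| = #|based_blocks|.
Proof.
have mean_equivariant : shift_equivariant mean by move=> t q; rewrite mean_shift // size_tuple.
have head_equivariant : shift_equivariant (fun q => (thead q).1) by move=> t; case/tupleP.
by apply/eqP; rewrite eqn_leq !leq_card_slices.
Qed.

Variable M : nat.
Hypothesis card_D : forall i, #|[set q : T * T | D (0%R, i) q.1 q.2]| = M.

Lemma card_based_blocksM : #|based_blocks| = u * M.
Proof.
pose D0 := [set d : 'I_u * (T * T) | D (0%R, d.1) d.2.1 d.2.2].
have -> : u * M = #|D0|.
  rewrite -[#|D0|]sum1_card big_mkcond /= (eq_bigr (fun d => (D (0%R, d.1) d.2.1 d.2.2) : nat)); last first.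
    by move=> d _; rewrite inE; case: ifP.
  rewrite -(pair_bigA _ (fun i d => (D (0%R, i) d.1 d.2) : nat)) /= (eq_bigr (fun=> M)) => [|i _].
    by rewrite sum_nat_const card_ord.
  by rewrite (sum_pred (fun d : T * T => D (0%R, i) d.1 d.2)) -(card_D i) cardsE.
pose triple q := ((thead q).2, (nth (thead q) q 1, nth (thead q) q 2)).
have triple_inj : {in based_blocks &, injective triple}.
  move=> q q'; have [x [y [z [w ->]]]] := tuple4P q; have [x' [y' [z' [w' ->]]]] := tuple4P q'.
  rewrite !inE => /andP [/block_seqE h /eqP /= x0] /andP [/block_seqE h' /eqP /= x'0] [ex ey ez].
  have ex' : x = x' by rewrite (surjective_pairing x) (surjective_pairing x') x0 x'0 ex.
  by move: h; rewrite ex' ey ez => /(design_uniq dR h') ->; apply: val_inj.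
rewrite -(card_in_imset triple_inj); apply: eq_card => -[i [y z]]; rewrite !inE /=.
apply/imsetP/idP => [[q]|/(design_ex dR) [w h]].
  have [x [y' [z' [w ->]]]] := tuple4P q; rewrite inE => /andP [/block_seqE h /eqP /= x0] [-> -> ->].
  by rewrite -x0 -surjective_pairing; apply: (design_dom dR h).
exists [tuple (0%R, i); y; z; w]; rewrite // inE /= eqxx andbT.
exact/block_seqE.
Qed.

Definition point (d : 'I_u * 'I_p) : T := ((val d.2)%:R%R, d.1).

Lemma point_bij : bijective point.
Proof.
apply: inj_card_bij; last by rewrite !card_prod card_Fp // !card_ord mulnC.
move=> [i j] [i' j'] [e ->]; congr (_, _); apply: val_inj.
by have := congr1 val e; rewrite /= !val_Fp_nat // !modn_small.
Qed.

Lemma point_colshift i (j : 'I_p) r : point (i, colshift j r) = shift (r%:R)%R (point (i, j)).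
Proof. by rewrite /point /shift /= Fp_nat_mod // natrD. Qed.

Definition mx_of_set B : 'M[bool]_(u, p) := \matrix_(i < u, j < p) (point (i, j) \in B).

Lemma mx_of_set_inj : injective mx_of_set.
Proof.
move=> B B' e; have [g _ gK] := point_bij; apply/setP => x; rewrite -(gK x).
by case: (g x) => i j; move/matrixP/(_ i j): e; rewrite !mxE.
Qed.

Lemma mx_weight_of_set B : mx_weight (mx_of_set B) = #|B|.
Proof.
rewrite /mx_weight pair_bigA (eq_bigr (fun d => (point d \in B) : nat)) => [|[i j] _]; last by rewrite mxE.
rewrite (sum_pred (fun d => point d \in B)) -(on_card_preimset (onW_bij _ point_bij)).
by apply: eq_card => d; rewrite !inE.
Qed.

Lemma corr_of_set B B' r : corr (mx_of_set B) (mx_of_set B') r =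
  #|[pred d | (point d \in B) && (shift (r%:R)%R (point d) \in B')]|.
Proof.
by rewrite /corr pair_bigA -sum_pred; apply: eq_bigr => -[i j] _; rewrite !mxE /= -point_colshift.
Qed.

Lemma codewords_meet B B' t x y z : B \in codewords -> B' \in codewords -> distinct3 x y z ->
  x \in B -> y \in B -> z \in B -> shift t x \in B' -> shift t y \in B' -> shift t z \in B' ->
  t = 0%R /\ B = B'.
Proof.
move=> codeB codeB' d xB yB zB xB' yB' zB'; have [w [h mean_w ->]] := codeword_third codeB xB yB zB d.
have d' : distinct3 (shift t x) (shift t y) (shift t z) by rewrite (distinct3_inj _ _ _ (@shift_inj t)).
have [w' [h' mean_w' ->]] := codeword_third codeB' xB' yB' zB' d'.
have w'E : w' = shift t w := design_uniq dR h' (R_shift t h).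
have t_eq0 : t = 0%R by move: mean_w'; rewrite w'E (mean_shift t (s := [:: x; y; z; w])) // mean_w add0r.
have shift0 v : shift t v = v by case: v => a i; rewrite /shift t_eq0 addr0.
by rewrite w'E !shift0.
Qed.

Lemma codewords_OOC : is_OOC_4_2 (mx_of_set @: codewords).
Proof.
split=> [A /imsetP [B codeB ->]|A A' r /imsetP [B codeB ->] /imsetP [B' codeB' ->]].
  by rewrite mx_weight_of_set card_codeword.
rewrite (inj_eq mx_of_set_inj) corr_of_set leqNgt => distinct; apply/negP => /card_gt2P [x [y [z]]].
rewrite !inE => -[[/andP [xB xB'] /andP [yB yB'] /andP [zB zB']] [xy yz zx]].
have d : distinct3 (point x) (point y) (point z).
  by rewrite (distinct3_inj _ _ _ (bij_inj point_bij)) /distinct3 xy yz eq_sym zx.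
have [r0 eB] := codewords_meet codeB codeB' d xB yB zB xB' yB' zB'.
case/orP: distinct => [/eqP //|]; have := congr1 val r0.
by rewrite /= val_Fp_nat // => ->.
Qed.

Lemma ooc_of_invariant_design :
  exists C : {set 'M[bool]_(u, p)}, is_OOC_4_2 C /\ 24 * #|C| = u * M.
Proof.
exists (mx_of_set @: codewords); split; first exact: codewords_OOC.
by rewrite (card_imset _ mx_of_set_inj) -card_centred_blocks card_based_blocks card_based_blocksM.
Qed.

End InvariantDesignCode.

(** * Rotational quadruple systems *)

Local Open Scope ring_scope.

Lemma primitive_cube_rootI (F : fieldType) (om : F) :
  om ^+ 2 = - om - 1 -> om != 1 -> 3.-primitive_root om.
Proof.
move=> om2 om1; have om3 : om ^+ 3 = 1 by rewrite exprS om2; ring: om2.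
have [m prim_m m_dvd] := prim_order_exists (isT : (0 < 3)%N) om3.
have m1 : m != 1%N by apply: contra_neq om1 => m1; have := prim_expr_order prim_m; rewrite m1 expr1.
by have <- : m = 3%N by apply/(prime_nt_dvdP _ m1).
Qed.

Section CubeRoot.
Variables (F : fieldType) (om : F).
Hypothesis om_prim : 3.-primitive_root om.

Lemma cube_root_exp3 : om ^+ 3 = 1.
Proof. exact: prim_expr_order. Qed.

Lemma cube_root_neq1 : om != 1.
Proof. by have := prim_order_dvd om_prim 1; rewrite expr1 => <-. Qed.

Lemma cube_root_sqr : om ^+ 2 = - om - 1.
Proof.
have : (om - 1) * (om ^+ 2 + om + 1) = 0.
  by transitivity (om ^+ 3 - 1); [ring|rewrite cube_root_exp3 subrr].
move/eqP; rewrite mulf_eq0 subr_eq0 (negPf cube_root_neq1) /= => /eqP sum0.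
by rewrite -[LHS]subr0 -sum0; ring.
Qed.

Lemma cube_root_neq0 : om != 0.
Proof. by have := oner_neq0 F; rewrite -cube_root_exp3 expf_eq0. Qed.

Lemma cube_root_subr_neq0 : 1 - om != 0.
Proof. by rewrite subr_eq0 eq_sym cube_root_neq1. Qed.

Lemma cube_root_addr_neq0 : 1 + om != 0.
Proof.
have : - om ^+ 2 != 0 by rewrite oppr_eq0 expf_neq0 ?cube_root_neq0.
by rewrite cube_root_sqr; apply: contra_neq => e; rewrite -[RHS]e; ring.
Qed.

Lemma cube_root_conj : 3.-primitive_root (- 1 - om).
Proof.
have om2 := cube_root_sqr; apply: primitive_cube_rootI; first by ring: om2.
have := cube_root_neq1; apply: contra_neq => e.
by rewrite -cube_root_exp3 exprS om2 addrC -e; ring: e.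
Qed.

End CubeRoot.

Lemma finField_expf_pred (F : finFieldType) (a : F) : a != 0 -> a ^+ #|F|.-1 = 1.
Proof.
move=> a0; apply: (mulfI a0); rewrite -exprS prednK ?mulr1 ?expf_card //.
exact: ltnW (finNzRing_gt1 F).
Qed.

Lemma finField_cube_root (F : finFieldType) : (3 %| #|F|.-1)%N -> exists om : F, 3.-primitive_root om.
Proof.
set n := #|F|.-1 => n3; have n_gt0 : (0 < n)%N by rewrite -ltnS prednK ?finNzRing_gt1 // ltnW ?finNzRing_gt1.
have /hasP [z _ prim_z] : has n.-primitive_root (enum (predC1 (0 : F))).
  apply: has_prim_root n_gt0 _ (enum_uniq _) _; last by rewrite -cardE cardC1.
  by apply/allP => a; rewrite mem_enum unity_rootE => /finField_expf_pred ->.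
exists (z ^+ (n %/ 3)); have := exp_prim_root prim_z (n %/ 3)%N.
have -> : gcdn (n %/ 3) n = (n %/ 3)%N by apply/gcdn_idPl; rewrite -{2}(divnK n3) dvdn_mulr.
by rewrite divnA // mulKn.
Qed.

Lemma odd_finField_neqN1 (F : finFieldType) : odd #|F| -> (1 : F) != - 1.
Proof.
move=> odd_F; rewrite -subr_eq0 opprK; apply: contraL odd_F => /eqP two0.
have order1 : #[1%R : F]%g = 2%N.
  apply: (elimT (prime_nt_dvdP _ _)) => //; first by rewrite order_eq1; apply: oner_neq0.
  by rewrite order_dvdn FinRing.zmodXgE; apply/eqP.
by rewrite -dvdn2 -order1 -cardsT; apply: order_dvdG; rewrite inE.
Qed.

(* The cubic triangles are {t + c, t + om c, t + om^2 c} with c in C; the radius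
   c is read off two consecutive vertices. *)
Section CubicTriangles.
Variables (F : fieldType) (om : F) (C : pred F).
Implicit Types x y z : F.

Definition radius x y : F := (x - y) / (1 - om).
Definition oriented_triangle x y z : bool := (x + om * y - (1 + om) * z == 0) && C (radius x y).
Definition cubic_triangle x y z : bool := oriented_triangle x y z || oriented_triangle y x z.

Lemma radius_sym x y : radius y x = - radius x y.
Proof. by rewrite /radius -mulNr opprB. Qed.

Lemma radius_neq0 x y : om != 1 -> x != y -> radius x y != 0.
Proof. by move=> om1 xy; rewrite /radius mulf_neq0 ?invr_eq0 // subr_eq0 // eq_sym. Qed.

Lemma radiusK x y : om != 1 -> (1 - om) * radius x y = x - y.
Proof. by move=> om1; rewrite /radius mulrC divfK // subr_eq0 eq_sym. Qed.

Lemma cubic_triangle_swap12 x y z : cubic_triangle x y z = cubic_triangle y x z.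
Proof. exact: orbC. Qed.

Hypotheses (om_prim : 3.-primitive_root om) (C_om : forall c, C (om * c) = C c).
Let om2 := cube_root_sqr om_prim.

Lemma oriented_triangle_radius x y z : oriented_triangle x y z -> radius y z = om * radius x y.
Proof.
case/andP => /eqP xyz _; rewrite /radius mulrA; congr (_ / _); apply/eqP; rewrite -subr_eq0; apply/eqP.
transitivity (- om * (x + om * y - (1 + om) * z)); last by rewrite xyz mulr0.
by ring: om2.
Qed.

Lemma oriented_triangle_rot x y z : oriented_triangle x y z -> oriented_triangle y z x.
Proof.
move=> xyz; have radius_yz := oriented_triangle_radius xyz; have /andP [/eqP xyz0 Cxy] := xyz.
rewrite /oriented_triangle radius_yz C_om Cxy andbT; apply/eqP.
transitivity (- (1 + om) * (x + om * y - (1 + om) * z)); last by rewrite xyz0 mulr0.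
by ring: om2.
Qed.

Lemma cubic_triangle_swap23 x y z : cubic_triangle x y z = cubic_triangle x z y.
Proof.
suff swap x' y' z' : cubic_triangle x' y' z' -> cubic_triangle x' z' y' by apply/idP/idP; apply: swap.
case/orP => tri; apply/orP; first by right; do 2 apply: oriented_triangle_rot.
by left; apply: oriented_triangle_rot.
Qed.

End CubicTriangles.

(* Adding a point at infinity to every cubic triangle completes Q to a
   rotational Steiner quadruple system. *)
Record rosqs (F : fieldType) (om : F) (C : pred F) (Q : F -> F -> F -> F -> Prop) : Prop := Rosqs {
  rosqs_om : 3.-primitive_root om;
  rosqs_C0 : C 0 = false;
  rosqs_CN : forall c, c != 0 -> C (- c) = ~~ C c;
  rosqs_Com : forall c, C (om * c) = C c;
  rosqs_design : design (fun x y z => distinct3 x y z && ~~ cubic_triangle om C x y z) Q;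
  rosqs_shift : forall t x y z w, Q x y z w -> Q (x + t) (y + t) (z + t) (w + t) }.

Section QuadraticResidue.
Variable F : finFieldType.
Hypothesis F7 : (#|F| %% 12 = 7)%N.
Implicit Types a b : F.

Definition residue a : bool := a ^+ #|F|./2 == 1.

Lemma exp_half_card a : a != 0 -> a ^+ #|F|./2 = 1 \/ a ^+ #|F|./2 = -1.
Proof.
move=> a0; have : (a ^+ #|F|./2) ^+ 2 = 1.
  by rewrite -exprM muln2 (_ : #|F|./2.*2 = #|F|.-1) ?finField_expf_pred //; lia.
by move/eqP; rewrite sqrf_eq1 => /orP [/eqP|/eqP]; [left|right].
Qed.

Lemma residueN a : a != 0 -> residue (- a) = ~~ residue a.
Proof.
move=> a0; have neqN1 : (1 : F) != -1 by apply: odd_finField_neqN1; lia.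
rewrite /residue exprNn -signr_odd (_ : odd #|F|./2 = true) ?expr1; last lia.
by rewrite mulN1r; case: (exp_half_card a0) => ->; rewrite ?opprK ?eqxx // eq_sym (negPf neqN1).
Qed.

Lemma residue_mul_sqr a b : b != 0 -> residue (a * b ^+ 2) = residue a.
Proof.
move=> b0; rewrite /residue exprMn -exprM mulnC muln2.
by rewrite (_ : #|F|./2.*2 = #|F|.-1) ?finField_expf_pred ?mulr1 //; lia.
Qed.

Lemma residue_exp3 a : a != 0 -> residue (a ^+ 3) = residue a.
Proof. by move=> a0; rewrite exprS residue_mul_sqr. Qed.

Lemma residue_mul_cube_root (om : F) a : 3.-primitive_root om -> residue (om * a) = residue a.
Proof.
move=> om_prim; rewrite /residue exprMn (_ : #|F|./2 = (3 * (#|F|./2 %/ 3))%N); last lia.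
by rewrite [om ^+ _]exprM (cube_root_exp3 om_prim) expr1n mul1r.
Qed.

End QuadraticResidue.

(* The blocks are quadruples whose cross ratio is a primitive sixth root of unity.
   A triple lies in two of them, one for each primitive cube root of unity, and
   the quadratic character of its Vandermonde product selects one. *)
Section Equianharmonic.
Variables (F : finFieldType) (om : F).
Hypotheses (F7 : (#|F| %% 12 = 7)%N) (om_prim : 3.-primitive_root om).
Implicit Types a c t u v x y z w : F.

Definition nonresidue_radius c : bool := (c != 0) && ~~ residue (c * (1 - om)).

Definition cross_form a x y z w : F :=
  x * y + z * w + a * (x * z + y * w) - (1 + a) * (x * w + y * z).
Definition last_coef a x y z : F := z + a * y - (1 + a) * x.
Definition vandermonde3 x y z : F := (x - y) * (y - z) * (z - x).
Definition triple_root x y z : F := if residue (vandermonde3 x y z) then om else - 1 - om.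
Definition equianharmonic x y z w : Prop :=
  distinct3 x y z /\ cross_form (triple_root x y z) x y z w = 0.

Lemma nonresidue_radiusN c : c != 0 -> nonresidue_radius (- c) = ~~ nonresidue_radius c.
Proof.
move=> c0; rewrite /nonresidue_radius oppr_eq0 c0 /= mulNr residueN //.
by rewrite mulf_neq0 ?(cube_root_subr_neq0 om_prim).
Qed.

Lemma nonresidue_radius_om c : nonresidue_radius (om * c) = nonresidue_radius c.
Proof.
by rewrite /nonresidue_radius mulf_eq0 (negPf (cube_root_neq0 om_prim)) -mulrA residue_mul_cube_root.
Qed.

Lemma nonresidue_radius_diff u v : u != v -> nonresidue_radius (radius om u v) = ~~ residue (u - v).
Proof.
have om1 := cube_root_neq1 om_prim => uv.
by rewrite /nonresidue_radius radius_neq0 //= mulrC radiusK.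
Qed.

Lemma triple_root_prim x y z : 3.-primitive_root (triple_root x y z).
Proof. by rewrite /triple_root; case: ifP => _ //; apply: cube_root_conj. Qed.

Lemma vandermonde3_neq0 x y z : distinct3 x y z -> vandermonde3 x y z != 0.
Proof. by case/and3P => xy xz yz; rewrite /vandermonde3 !mulf_neq0 // subr_eq0 // eq_sym. Qed.

Lemma triple_root_opp x y z x' y' z' : vandermonde3 x' y' z' = - vandermonde3 x y z ->
  distinct3 x y z -> triple_root x' y' z' = - 1 - triple_root x y z.
Proof.
move=> e d; rewrite /triple_root e residueN ?vandermonde3_neq0 //.
by case: (residue _) => //=; ring.
Qed.

Lemma cross_form_coef a x y z w :
  cross_form a x y z w = w * last_coef a x y z + (x * y + a * (x * z) - (1 + a) * (y * z)).
Proof. by rewrite /cross_form /last_coef; ring. Qed.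

Lemma last_coef_subx a x y z w : 3.-primitive_root a -> cross_form a x y z w = 0 ->
  last_coef a x y z * (w - x) = (1 + a) * (x - y) * (x - z).
Proof.
move=> /cube_root_sqr a_sqr form0; apply/eqP; rewrite -subr_eq0 -form0 /cross_form /last_coef; apply/eqP.
by ring: a_sqr.
Qed.

Lemma last_coef_suby a x y z w : 3.-primitive_root a -> cross_form a x y z w = 0 ->
  last_coef a x y z * (y - w) = a * (y - x) * (y - z).
Proof.
move=> /cube_root_sqr a_sqr form0; apply/eqP; rewrite -subr_eq0 -oppr_eq0 -form0 /cross_form /last_coef.
by apply/eqP; ring: a_sqr.
Qed.

Lemma last_coef_neq0 x y z w : equianharmonic x y z w -> last_coef (triple_root x y z) x y z != 0.
Proof.
case=> /and3P [xy xz _] form0; have a_prim := triple_root_prim x y z.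
have := last_coef_subx a_prim form0; apply: contra_eq_neq => ->; rewrite mul0r eq_sym.
by rewrite !mulf_neq0 ?(cube_root_addr_neq0 a_prim) // subr_eq0.
Qed.

Lemma equianharmonic_swap12 x y z w : equianharmonic x y z w -> equianharmonic y x z w.
Proof.
case=> d form0; split; first by rewrite distinct3C12.
by rewrite (@triple_root_opp x y z) //; [rewrite -form0 /cross_form; ring|rewrite /vandermonde3; ring].
Qed.

Lemma equianharmonic_swap23 x y z w : equianharmonic x y z w -> equianharmonic x z y w.
Proof.
case=> d form0; have a_sqr := cube_root_sqr (triple_root_prim x y z); split; first by rewrite distinct3C23.
rewrite (@triple_root_opp x y z) //; last by rewrite /vandermonde3; ring.
transitivity ((- 1 - triple_root x y z) * cross_form (triple_root x y z) x y z w); last by rewrite form0 mulr0.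
by rewrite /cross_form; ring: a_sqr.
Qed.

Lemma equianharmonic_swap34 x y z w : equianharmonic x y z w -> equianharmonic x y w z.
Proof.
move=> q; have last0 := last_coef_neq0 q; case: (q) => d form0; have /and3P [xy xz yz] := d.
have a_prim := triple_root_prim x y z; have a_sqr := cube_root_sqr a_prim.
have lx := last_coef_subx a_prim form0; have ly := last_coef_suby a_prim form0.
set l := last_coef _ x y z in lx ly last0.
have wx : w - x != 0.
  move: lx; apply: contra_eq_neq => ->; rewrite mulr0 eq_sym.
  by rewrite !mulf_neq0 ?(cube_root_addr_neq0 a_prim) // subr_eq0.
have wy : y - w != 0.
  move: ly; apply: contra_eq_neq => ->; rewrite mulr0 eq_sym.
  by rewrite !mulf_neq0 ?(cube_root_neq0 a_prim) // subr_eq0 // eq_sym.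
split; first by rewrite /distinct3 xy (eq_sym x) -!(subr_eq0 w) -(subr_eq0 y) wx wy.
suff -> : triple_root x y w = - 1 - triple_root x y z by rewrite -form0 /cross_form; ring.
have eV : vandermonde3 x y w * l ^+ 2 = - (vandermonde3 x y z * (x - y) ^+ 2).
  transitivity ((x - y) * (l * (y - w)) * (l * (w - x))); first by rewrite /vandermonde3; ring.
  by rewrite lx ly /vandermonde3; ring: a_sqr.
have xy0 : x - y != 0 by rewrite subr_eq0.
rewrite {1}/triple_root -(residue_mul_sqr F7 (vandermonde3 x y w) last0) eV -mulNr residue_mul_sqr //.
rewrite residueN ?vandermonde3_neq0 // /triple_root.
by case: (residue _) => //=; ring.
Qed.

Lemma vandermonde3_triangle x y z : x + om * y - (1 + om) * z = 0 -> vandermonde3 x y z = (x - y) ^+ 3.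
Proof.
have om2 := cube_root_sqr om_prim; move=> e.
have -> : x = (1 + om) * z - om * y by apply/eqP; rewrite -subr_eq0 -e; apply/eqP; ring.
by rewrite /vandermonde3; ring: om2.
Qed.

Lemma cubic_triangle_last_coef x y z : distinct3 x y z ->
  cubic_triangle om nonresidue_radius x y z = (last_coef (triple_root x y z) x y z == 0).
Proof.
have om2 := cube_root_sqr om_prim; have om_neq0 := cube_root_neq0 om_prim.
move=> d; have /and3P [xy _ _] := d; have yx : y != x by rewrite eq_sym.
have [xy0 yx0] : x - y != 0 /\ y - x != 0 by rewrite !subr_eq0.
have coef_conj : last_coef (- 1 - om) x y z = om * (x + om * y - (1 + om) * z).
  by rewrite /last_coef; ring: om2.
have coef_om : last_coef om x y z = om * (y + om * x - (1 + om) * z) by rewrite /last_coef; ring: om2.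
have V_swap : vandermonde3 y x z = - vandermonde3 x y z by rewrite /vandermonde3; ring.
rewrite /cubic_triangle /oriented_triangle !nonresidue_radius_diff // /triple_root.
apply/orP/eqP => [[/andP [/eqP t c]|/andP [/eqP t c]]|].
- by rewrite vandermonde3_triangle // residue_exp3 // (negPf c) coef_conj t mulr0.
- rewrite -[vandermonde3 x y z]opprK -V_swap vandermonde3_triangle // residueN ?expf_neq0 //.
  by rewrite residue_exp3 // c coef_om t mulr0.
case: ifP => res; rewrite ?coef_conj ?coef_om => /eqP; rewrite mulf_eq0 (negPf om_neq0) /= => /eqP t.
  right; rewrite t eqxx -(residue_exp3 F7 yx0) -(vandermonde3_triangle t) V_swap.
  by rewrite residueN ?vandermonde3_neq0 // res.
by left; rewrite t eqxx -(residue_exp3 F7 xy0) -(vandermonde3_triangle t) res.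
Qed.

Lemma equianharmonic_design : design
  (fun x y z => distinct3 x y z && ~~ cubic_triangle om nonresidue_radius x y z) equianharmonic.
Proof.
split.
- exact: equianharmonic_swap12.
- exact: equianharmonic_swap23.
- exact: equianharmonic_swap34.
- by move=> x y z w q; case: (q) => d _; rewrite d cubic_triangle_last_coef // (negPf (last_coef_neq0 q)).
- move=> x y z /andP [d]; rewrite cubic_triangle_last_coef // => last0; set a := triple_root x y z in last0 *.
  exists (- (x * y + a * (x * z) - (1 + a) * (y * z)) / last_coef a x y z).
  by split=> //; rewrite -/a cross_form_coef divfK // addNr.
move=> x y z w w' q [_ form0']; have last0 := last_coef_neq0 q; case: q => _.
by rewrite -form0' !cross_form_coef => /addIr; apply: mulIf.
Qed.

Lemma equianharmonic_rosqs : rosqs om nonresidue_radius equianharmonic.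
Proof.
split=> //.
- by rewrite /nonresidue_radius eqxx.
- exact: nonresidue_radiusN.
- exact: nonresidue_radius_om.
- exact: equianharmonic_design.
move=> t x y z w [d form0].
have eV : vandermonde3 (x + t) (y + t) (z + t) = vandermonde3 x y z by rewrite /vandermonde3; ring.
split; first by rewrite (distinct3_inj _ _ _ (addIr t)).
by rewrite /triple_root eV -/(triple_root x y z) -form0 /cross_form; ring.
Qed.

End Equianharmonic.

Local Close Scope ring_scope.

(** * H-designs with two layers *)

Section TwoLayers.
Variable F : zmodType.
Variables Q apexed matched : F -> F -> F -> F -> Prop.
Implicit Types (a b c d : F * bool) (x y z w v t : F).
Local Open Scope ring_scope.

Hypotheses (Q_swap12 : forall x y z w, Q x y z w -> Q y x z w)
  (Q_swap23 : forall x y z w, Q x y z w -> Q x z y w)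
  (Q_swap34 : forall x y z w, Q x y z w -> Q x y w z)
  (apexed_swap12 : forall x y z w, apexed x y z w -> apexed y x z w)
  (apexed_swap23 : forall x y z w, apexed x y z w -> apexed x z y w)
  (matched_swap12 : forall x y w v, matched x y w v -> matched y x w v)
  (matched_swap34 : forall x y w v, matched x y w v -> matched x y v w)
  (matched_dual : forall x y w v, matched x y w v -> matched (- w) (- v) (- x) (- y)).
Hypotheses (Q_uniq : forall x y z w, Q x y z w -> uniq [:: x; y; z; w])
  (apexed_uniq : forall x y z w, apexed x y z w -> uniq [:: x; y; z; w])
  (matched_uniq : forall x y w v, matched x y w v -> uniq [:: x; y; w; v]).
Hypotheses
  (complete_layer : forall x y z, distinct3 x y z ->
    exists! d : F * bool, if d.2 then apexed x y z d.1 else Q x y z d.1)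
  (complete_pair : forall x y w, distinct3 x y w ->
    exists! d : F * bool, if d.2 then matched x y w d.1 else apexed x y d.1 w).
Hypotheses (Q_shift : forall t x y z w, Q x y z w -> Q (x + t) (y + t) (z + t) (w + t))
  (apexed_shift : forall t x y z w, apexed x y z w -> apexed (x + t) (y + t) (z + t) (w + t))
  (matched_shift : forall t x y w v, matched x y w v -> matched (x + t) (y + t) (w + t) (v + t)).

Definition layer (l : bool) (s : seq (F * bool)) : seq F := [seq a.1 | a <- s & a.2 == l].

(* The upper layer is a copy of the lower one under x |-> - x. *)
Definition two_layer_block a b c d : Prop :=
  match layer false [:: a; b; c; d], layer true [:: a; b; c; d] with
  | [:: x; y; z; w], [::] => Q x y z w
  | [:: x; y; z], [:: w] => apexed x y z w
  | [:: x; y], [:: w; v] => matched x y w v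
  | [:: w], [:: x; y; z] => apexed (- x) (- y) (- z) (- w)
  | [::], [:: x; y; z; w] => Q (- x) (- y) (- z) (- w)
  | _, _ => False
  end.

Lemma two_layer_swap12 a b c d : two_layer_block a b c d -> two_layer_block b a c d.
Proof.
by case: a b c d => [x []] [y []] [z []] [w []] h;
  first [exact: h|exact: (Q_swap12 h)|exact: (apexed_swap12 h)|exact: (matched_swap12 h)|
    exact: (matched_swap34 h)].
Qed.

Lemma two_layer_swap23 a b c d : two_layer_block a b c d -> two_layer_block a c b d.
Proof.
by case: a b c d => [x []] [y []] [z []] [w []] h;
  first [exact: h|exact: (Q_swap23 h)|exact: (apexed_swap12 h)|exact: (apexed_swap23 h)|
    exact: (matched_swap12 h)|exact: (matched_swap34 h)].
Qed.

Lemma two_layer_swap34 a b c d : two_layer_block a b c d -> two_layer_block a b d c.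
Proof.
by case: a b c d => [x []] [y []] [z []] [w []] h;
  first [exact: h|exact: (Q_swap34 h)|exact: (apexed_swap12 h)|exact: (apexed_swap23 h)|
    exact: (matched_swap12 h)|exact: (matched_swap34 h)].
Qed.

Definition dual a : F * bool := (- a.1, ~~ a.2).

Lemma dualK : involutive dual.
Proof. by case=> x l; rewrite /dual /= opprK negbK. Qed.

Lemma two_layer_dual a b c d : two_layer_block a b c d ->
  two_layer_block (dual a) (dual b) (dual c) (dual d).
Proof.
by case: a b c d => [x []] [y []] [z []] [w []]; rewrite /two_layer_block /= ?opprK //; apply: matched_dual.
Qed.

Lemma two_layer_uniq a b c d : two_layer_block a b c d -> uniq [:: a.1; b.1; c.1; d.1].
Proof.
have uniq_perm_to (s s' : seq F) : uniq s' -> perm_eq s s' -> uniq s by move=> u /perm_uniq ->.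
have uniq_perm_opp (s s' : seq F) : uniq s' -> perm_eq (map -%R s) s' -> uniq s.
  by move=> u /perm_uniq; rewrite (map_inj_uniq oppr_inj) => ->.
by case: a b c d => [x []] [y []] [z []] [w []] h;
  first [apply: uniq_perm_to (Q_uniq h) _; apply/permP => f /=; lia
  |apply: uniq_perm_to (apexed_uniq h) _; apply/permP => f /=; lia
  |apply: uniq_perm_to (matched_uniq h) _; apply/permP => f /=; lia
  |apply: uniq_perm_opp (Q_uniq h) _; apply/permP => f /=; lia
  |apply: uniq_perm_opp (apexed_uniq h) _; apply/permP => f /=; lia].
Qed.

Lemma two_layer_complete_dual a b c : (exists! d, two_layer_block (dual a) (dual b) (dual c) d) ->
  exists! d, two_layer_block a b c d.
Proof.
case=> d [h u]; exists (dual d); split; first by have := two_layer_dual h; rewrite !dualK.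
by move=> d' /two_layer_dual /u ->; rewrite dualK.
Qed.

Lemma two_layer_complete_layer l x y z : distinct3 x y z ->
  exists! d, two_layer_block (x, l) (y, l) (z, l) d.
Proof.
have lower x' y' z' : distinct3 x' y' z' -> exists! d, two_layer_block (x', false) (y', false) (z', false) d.
  move=> /complete_layer [[d l'] [h u]]; exists (d, l').
  by split=> [|[d' b] h']; [case: l' h {u}|apply: u; case: b h'].
case: l => d; last exact: lower.
by apply: two_layer_complete_dual; apply: lower; rewrite (distinct3_inj _ _ _ oppr_inj).
Qed.

Lemma two_layer_complete_pair l x y w : distinct3 x y w ->
  exists! d, two_layer_block (x, l) (y, l) (w, ~~ l) d.
Proof.
have lower x' y' w' : distinct3 x' y' w' -> exists! d, two_layer_block (x', false) (y', false) (w', true) d.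
  move=> /complete_pair [[d l'] [h u]]; exists (d, l').
  by split=> [|[d' b] h']; [case: l' h {u}|apply: u; case: b h'].
case: l => d; last exact: lower.
by apply: two_layer_complete_dual; apply: lower; rewrite (distinct3_inj _ _ _ oppr_inj).
Qed.

Lemma two_layer_complete a b c : distinct3 a.1 b.1 c.1 -> exists! d, two_layer_block a b c d.
Proof.
have swap12 a' b' c' := @unique_completion_swap12 _ _ a' b' c' two_layer_swap12.
have swap23 a' b' c' := @unique_completion_swap23 _ _ a' b' c' two_layer_swap23.
have negb_neq l l' : l != l' -> l' = ~~ l by case: l l' => [] [].
case: a b c => [x l] [y l'] [z l''] /= d.
have [<-|/negb_neq ->] := eqVneq l l'; have [<-|/negb_neq ->] := eqVneq l l''.
- exact: two_layer_complete_layer.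
- exact: two_layer_complete_pair.
- by apply/swap23/two_layer_complete_pair; rewrite distinct3C23.
apply/swap12/swap23; rewrite -{3}[l]negbK; apply: two_layer_complete_pair.
by rewrite distinct3C23 distinct3C12.
Qed.

Lemma two_layer_design : design (fun a b c => distinct3 a.1 b.1 c.1) two_layer_block.
Proof.
apply: design_of_unique_completion two_layer_swap12 two_layer_swap23 two_layer_swap34 _ two_layer_complete.
by move=> a b c d /two_layer_uniq /uniq4_distinct3.
Qed.

Lemma two_layer_shift t a b c d : two_layer_block a b c d ->
  two_layer_block (a.1 + t, a.2) (b.1 + t, b.2) (c.1 + t, c.2) (d.1 + t, d.2).
Proof.
by case: a b c d => [x []] [y []] [z []] [w []]; rewrite /two_layer_block /= ?opprD;
  first [exact: Q_shift|exact: apexed_shift|exact: matched_shift].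
Qed.

End TwoLayers.

Local Open Scope ring_scope.

Lemma Fp_nat_inj p (n n' : nat) : prime p -> (n < p)%N -> (n' < p)%N -> n%:R = n'%:R :> 'F_p -> n = n'.
Proof. by move=> pp n_lt n'_lt /(congr1 val); rewrite /= !val_Fp_nat // !modn_small. Qed.

Lemma Fp_val_lt p (a : 'F_p) : prime p -> (val a < p)%N.
Proof. by move=> pp; rewrite -[X in (_ < X)%N](Fp_cast pp); apply: ltn_ord. Qed.

Lemma Fp_natr_opp p (a b : nat) : prime p -> (a + b)%N = p.-1 -> a%:R = - 1 - b%:R :> 'F_p.
Proof.
move=> pp ab; have : (a + b + 1)%:R = 0 :> 'F_p by rewrite ab addn1 prednK ?prime_gt0 ?pchar_Fp_0.
by rewrite !natrD => e; apply/eqP; rewrite -subr_eq0 -e; apply/eqP; ring.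
Qed.

(* The apex of the triangle {t + c, t + om c, t + om^2 c} is t + apex_offset c;
   on the progression x + n (x - y) of two vertices x, y it has an odd index. *)
Record apex_choice (p : nat) (om : 'F_p) (C : pred 'F_p) (apex_index : 'F_p -> nat)
    (apex_offset : 'F_p -> 'F_p) : Prop := ApexChoice {
  apex_indexN : forall d, d != 0 -> (apex_index (- d) + apex_index d = p.-1)%N;
  odd_apex_index : forall d, d != 0 -> odd (apex_index d);
  apex_offset_om : forall c, apex_offset (om * c) = apex_offset c;
  apex_offsetE : forall c, c != 0 -> C c ->
    apex_offset c - c = (apex_index ((1 - om) * c))%:R * ((1 - om) * c) }.

(* A pair x, y of the lower layer is matched with consecutive terms of its
   progression: the terms 1, ..., p - 2 without the apex k split into k - 1 and
   p - 2 - k terms, both even in number. *)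
Definition matched_index (p k n : nat) : bool :=
  [&& 0 < n, n < p.-2, n != k, n.+1 != k & odd n == (n < k)]%N.

Lemma matched_index_or p k n : odd p -> odd k -> (k < p.-1)%N -> (0 < n < p.-1)%N -> n != k ->
  matched_index p k n || matched_index p k n.-1.
Proof. by rewrite /matched_index; case: p => [|[|p]] //=; lia. Qed.

Lemma matched_index_and p k n : odd k -> matched_index p k n -> ~~ matched_index p k n.-1.
Proof. by rewrite /matched_index; lia. Qed.

Lemma matched_index_bounds p n : (0 < n)%N -> (n < p.-2)%N ->
  uniq [:: 0; p.-1; n; n.+1]%N && all (ltn^~ p) [:: 0; p.-1; n; n.+1]%N.
Proof. by rewrite /= !inE; lia. Qed.

Section LayersOfRotationalSystem.
Variables (p : nat) (om : 'F_p) (C : pred 'F_p) (Q : 'F_p -> 'F_p -> 'F_p -> 'F_p -> Prop).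
Hypotheses (prime_p : prime p) (odd_p : odd p) (rQ : rosqs om C Q).
Local Notation F := 'F_p.
Variables (apex_index : F -> nat) (apex_offset : F -> F).
Hypothesis ac : apex_choice om C apex_index apex_offset.
Implicit Types (c d t x y z w v : F) (n : nat).

Let om_prim := rosqs_om rQ.
Let om1 := cube_root_neq1 om_prim.
Let om2 := cube_root_sqr om_prim.
Local Notation radius := (radius om).

Definition progression x y n : F := x + n%:R * (x - y).
Definition third_vertex x y : F := (if C (radius x y) then x + om * y else y + om * x) / (1 + om).
Definition oriented_apexed x y z w : Prop :=
  oriented_triangle om C x y z /\ w = x - radius x y + apex_offset (radius x y).
Definition apexed x y z w : Prop := oriented_apexed x y z w \/ oriented_apexed y x z w.
Definition matched x y w v : Prop := x != y /\ exists2 n, matched_index p (apex_index (x - y)) n &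
  (w = progression x y n /\ v = progression x y n.+1) \/ (v = progression x y n /\ w = progression x y n.+1).

Lemma oriented_apexed_rot x y z w : oriented_apexed x y z w -> oriented_apexed y z x w.
Proof.
case=> tri ->; split; first exact: oriented_triangle_rot om_prim (rosqs_Com rQ) _ _ _ tri.
rewrite (oriented_triangle_radius om_prim tri) (apex_offset_om ac); have := radiusK x y om1.
by set c := radius x y => xy; rewrite -[x](subrK y) -xy; ring.
Qed.

Lemma apexed_swap12 x y z w : apexed x y z w -> apexed y x z w.
Proof. by case; [right|left]. Qed.

Lemma apexed_swap23 x y z w : apexed x y z w -> apexed x z y w.
Proof. by case=> h; [right; do 2 apply: oriented_apexed_rot|left; apply: oriented_apexed_rot]. Qed.

Lemma third_vertexE x y z : (x + om * y - (1 + om) * z == 0) = (z == (x + om * y) / (1 + om)).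
Proof.
have om1' := cube_root_addr_neq0 om_prim.
by rewrite subr_eq0; apply/eqP/eqP => [->|->]; rewrite ?[(1 + om) * _]mulrC ?mulfK ?divfK.
Qed.

Lemma oriented_apex x y : x != y -> C (radius x y) ->
  x - radius x y + apex_offset (radius x y) = progression x y (apex_index (x - y)).
Proof.
move=> xy Cxy; have := apex_offsetE ac (radius_neq0 om1 xy) Cxy.
by rewrite (radiusK _ _ om1) /progression => <-; ring.
Qed.

Lemma progression_sym x y n n' : (n + n')%N = p.-1 -> progression x y n = progression y x n'.
Proof. by move=> nn'; rewrite /progression (@Fp_natr_opp _ n' n) 1?addnC //; ring. Qed.

Lemma progression_apex_sym x y : x != y ->
  progression x y (apex_index (x - y)) = progression y x (apex_index (y - x)).
Proof.
by move=> xy; apply: progression_sym; rewrite addnC -[in apex_index (y - x)]opprB (apex_indexN ac) ?subr_eq0.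
Qed.

Lemma apexedE x y z w : x != y ->
  apexed x y z w <-> z = third_vertex x y /\ w = progression x y (apex_index (x - y)).
Proof.
move=> xy; have yx : y != x by rewrite eq_sym.
have C_yx : C (radius y x) = ~~ C (radius x y) by rewrite radius_sym (rosqs_CN rQ) ?radius_neq0.
rewrite /apexed /oriented_apexed /oriented_triangle !third_vertexE C_yx /third_vertex.
case: ifP => Cxy; rewrite /= ?andbF ?andbT; rewrite Cxy in C_yx.
  by split=> [[[/eqP -> ->]|[//]]|[-> ->]]; [rewrite oriented_apex|left; rewrite eqxx oriented_apex].
rewrite progression_apex_sym //.
by split=> [[[//]|[/eqP -> ->]]|[-> ->]]; [rewrite oriented_apex|right; rewrite eqxx oriented_apex].
Qed.

Lemma apex_index_bounds d : d != 0 -> (0 < apex_index d < p.-1)%N.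
Proof.
move=> d0; have := apex_indexN ac d0; have := odd_apex_index ac d0.
by have : - d != 0 by [rewrite oppr_eq0]; move/(odd_apex_index ac); lia.
Qed.

Lemma matched_swap34 x y w v : matched x y w v -> matched x y v w.
Proof. by case=> xy [n n_ok h]; split=> //; exists n => //; case: h; [right|left]. Qed.

Lemma matched_swap12 x y w v : matched x y w v -> matched y x w v.
Proof.
case=> xy [n n_ok h]; have xy0 : x - y != 0 by rewrite subr_eq0.
have sumE := apex_indexN ac xy0; have odd_xy := odd_apex_index ac xy0; rewrite opprB in sumE.
have bounds := apex_index_bounds xy0; split; first by rewrite eq_sym.
have [n_gt0 n_lt] : (0 < n)%N /\ (n < p.-2)%N by case/and5P: n_ok.
exists (p.-2 - n)%N.
  move: n_ok bounds sumE odd_xy; rewrite /matched_index; move: (apex_index _) (apex_index _) => k k'.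
  by clear -odd_p n_gt0 n_lt; lia.
have -> : progression y x (p.-2 - n) = progression x y n.+1 by apply: progression_sym; lia.
have -> : progression y x (p.-2 - n).+1 = progression x y n by apply: progression_sym; lia.
by case: h => [[-> ->]|[-> ->]]; [right|left].
Qed.

Lemma matched_dual x y w v : matched x y w v -> matched (- w) (- v) (- x) (- y).
Proof.
have dual_progression x' y' n : x' != y' -> matched_index p (apex_index (x' - y')) n ->
    matched (- progression x' y' n) (- progression x' y' n.+1) (- x') (- y').
  move=> xy n_ok; have diffE : - progression x' y' n - - progression x' y' n.+1 = x' - y'.
    by rewrite /progression -natr1; ring.
  split; first by rewrite -subr_eq0 diffE subr_eq0.
  by exists n; [rewrite diffE|left; rewrite /progression -natr1; split; ring].
case=> xy [n n_ok [[-> ->]|[-> ->]]]; first exact: dual_progression.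
by apply: matched_swap12; apply: dual_progression.
Qed.

Lemma progression_inj x y n n' : x != y -> (n < p)%N -> (n' < p)%N ->
  progression x y n = progression x y n' -> n = n'.
Proof.
move=> xy n_lt n'_lt /addrI /mulIf e; apply: (Fp_nat_inj prime_p n_lt n'_lt); apply: e.
by rewrite subr_eq0.
Qed.

Lemma progression0 x y : progression x y 0 = x.
Proof. by rewrite /progression mul0r addr0. Qed.

Lemma progression_last x y : progression x y p.-1 = y.
Proof. by rewrite (@progression_sym x y p.-1 0) ?progression0 // addn0. Qed.

Lemma progression_ex x y w : distinct3 x y w -> exists2 n, (0 < n < p.-1)%N & w = progression x y n.
Proof.
case/and3P => xy xw yw; have xy0 : x - y != 0 by rewrite subr_eq0.
pose n : F := (w - x) / (x - y).
have wE : w = progression x y (val n) by rewrite /progression natr_Zp /n divfK // addrC subrK.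
exists (val n); last exact: wE.
have n_neq0 : val n != 0%N by apply: contra_neq xw => n_eq; rewrite wE n_eq progression0.
have n_neq_last : val n != p.-1 by apply: contra_neq yw => n_eq; rewrite wE n_eq progression_last.
by have := Fp_val_lt n prime_p; move: n_neq0 n_neq_last; lia.
Qed.

Lemma matched_uniq x y w v : matched x y w v -> uniq [:: x; y; w; v].
Proof.
case=> xy [n /and5P [n_gt0 n_lt _ _ _] h]; have /andP [uniq_idx /allP idx_lt] := matched_index_bounds n_gt0 n_lt.
have : uniq (map (progression x y) [:: 0; p.-1; n; n.+1]%N).
  by rewrite map_inj_in_uniq // => i j /idx_lt i_lt /idx_lt j_lt; apply: progression_inj.
rewrite [map _ _]/= progression0 progression_last; case: h => [[-> ->]|[-> ->]] // h.
by rewrite (perm_uniq (perm_eq_swap34 _ _ _ _)).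
Qed.

Lemma apexed_neq x y z w : apexed x y z w -> [/\ x != y, x != w & y != w].
Proof.
move=> xyzw; have xy : x != y.
  have C0 := rosqs_C0 rQ.
  by case: xyzw => [] [/andP [_ Cxy] _]; apply: contraTneq Cxy => xy; rewrite /radius xy subrr mul0r C0.
have [_ ->] := (apexedE _ _ xy).1 xyzw; have : x - y != 0 by rewrite subr_eq0.
move=> /apex_index_bounds bounds; split=> //.
  by apply/eqP; rewrite -{1}(progression0 x y) => /(progression_inj xy) e; lia.
by apply/eqP; rewrite -{1}(progression_last x y) => /(progression_inj xy) e; lia.
Qed.

Lemma apexed_uniq x y z w : apexed x y z w -> uniq [:: x; y; z; w].
Proof.
move=> h; have [xy xw yw] := apexed_neq h; have [xz _ zw] := apexed_neq (apexed_swap23 h).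
have [yz _ _] := apexed_neq (apexed_swap23 (apexed_swap12 h)).
by rewrite /= !inE !negb_or xy xw yw xz zw yz.
Qed.

Lemma rosqs_uniq x y z w : Q x y z w -> uniq [:: x; y; z; w].
Proof. by apply: (design_block_uniq (rosqs_design rQ)) => a b c /andP []. Qed.

Lemma matched_progression x y n v : x != y -> (0 < n < p.-1)%N -> matched x y (progression x y n) v ->
  (matched_index p (apex_index (x - y)) n /\ v = progression x y n.+1) \/
  (matched_index p (apex_index (x - y)) n.-1 /\ v = progression x y n.-1).
Proof.
move=> xy n_lt [_ [n' n'_ok h]]; have /and5P [n'_gt0 n'_lt _ _ _] := n'_ok.
case: h => [[/(progression_inj xy) e ->]|[-> /(progression_inj xy) e]].
  by rewrite e; [left|lia|lia].
by rewrite e /=; [right|lia|lia].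
Qed.

Lemma complete_progression x y n : x != y -> (0 < n < p.-1)%N ->
  exists! d : F * bool, if d.2 then matched x y (progression x y n) d.1 else apexed x y d.1 (progression x y n).
Proof.
move=> xy n_lt; have xy0 : x - y != 0 by rewrite subr_eq0.
have bounds := apex_index_bounds xy0; have odd_k := odd_apex_index ac xy0.
have [n_apex|n_neq] := eqVneq n (apex_index (x - y)).
  exists (third_vertex x y, false); split=> [|[d []] /=]; first by apply/(apexedE _ _ xy); rewrite n_apex.
    case/(matched_progression xy n_lt) => [] [/and5P [_ _]]; first by rewrite n_apex eqxx.
    by move=> _; rewrite prednK ?n_apex ?eqxx //; case/andP: bounds.
  by case/(apexedE _ _ xy) => ->.
have not_apexed z : ~ apexed x y z (progression x y n).
  by case/(apexedE _ _ xy) => _ /(progression_inj xy) e; case/eqP: n_neq; apply: e; lia.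
have /orP [] := matched_index_or odd_p odd_k (proj2 (andP bounds)) n_lt n_neq => n_ok.
  exists (progression x y n.+1, true); split=> [|[d []] /=]; first by split=> //; exists n => //; left.
    by case/(matched_progression xy n_lt) => [[_ ->] //|[]]; rewrite (negPf (matched_index_and odd_k n_ok)).
  by move/not_apexed.
exists (progression x y n.-1, true); split=> [|[d []] /=].
- by split=> //; exists n.-1 => //; right; rewrite prednK //; case/andP: n_lt.
- case/(matched_progression xy n_lt) => [[n_ok' _]|[_ ->] //].
  by rewrite (negPf (matched_index_and odd_k n_ok')) in n_ok.
by move/not_apexed.
Qed.

Lemma complete_pair x y w : distinct3 x y w ->
  exists! d : F * bool, if d.2 then matched x y w d.1 else apexed x y d.1 w.
Proof.
by move=> xyw; have [n n_lt ->] := progression_ex xyw; case/and3P: xyw => xy _ _; apply: complete_progression.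
Qed.

Lemma complete_layer x y z : distinct3 x y z ->
  exists! d : F * bool, if d.2 then apexed x y z d.1 else Q x y z d.1.
Proof.
move=> xyz; have dQ := rosqs_design rQ; have /and3P [xy _ _] := xyz.
case: (boolP (cubic_triangle om C x y z)) => tri.
  have [w w_apex] : exists w, apexed x y z w.
    by case/orP: tri => tri;
      [exists (x - radius x y + apex_offset (radius x y)); left
      |exists (y - radius y x + apex_offset (radius y x)); right].
  exists (w, true); split=> [//|[w' []] /= h]; last first.
    by have /andP [_ /negP []] := design_dom dQ h.
  by have [_ ->] := (apexedE _ _ xy).1 h; have [_ ->] := (apexedE _ _ xy).1 w_apex.
have [w Qw] := design_ex dQ (introT andP (conj xyz tri)).
exists (w, false); split=> [//|[w' []] /= h]; last by rewrite (design_uniq dQ Qw h).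
by case/negP: tri; rewrite /cubic_triangle; case: h => [] [-> _]; rewrite ?orbT.
Qed.

Lemma apexed_shift t x y z w : apexed x y z w -> apexed (x + t) (y + t) (z + t) (w + t).
Proof.
have radius_shift x' y' : radius (x' + t) (y' + t) = radius x' y' by rewrite /radius; congr (_ / _); ring.
suff shift x' y' : oriented_apexed x' y' z w -> oriented_apexed (x' + t) (y' + t) (z + t) (w + t).
  by case=> /shift; [left|right].
case=> /andP [/eqP tri Cxy] ->; split; last by rewrite radius_shift; ring.
by rewrite /oriented_triangle radius_shift Cxy andbT -tri; apply/eqP; ring.
Qed.

Lemma matched_shift t x y w v : matched x y w v -> matched (x + t) (y + t) (w + t) (v + t).
Proof.
case=> xy [n n_ok h]; have diffE : x + t - (y + t) = x - y by ring.
split; first by rewrite -subr_eq0 diffE subr_eq0.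
exists n; first by rewrite diffE.
by case: h => [[-> ->]|[-> ->]]; [left|right]; split; rewrite /progression; ring.
Qed.

Lemma shift_invariant_two_layers : exists R : F * bool -> F * bool -> F * bool -> F * bool -> Prop,
  design (fun a b c : F * bool => distinct3 a.1 b.1 c.1) R /\
  forall t (a b c d : F * bool), R a b c d -> R (a.1 + t, a.2) (b.1 + t, b.2) (c.1 + t, c.2) (d.1 + t, d.2).
Proof.
have dQ := rosqs_design rQ; exists (two_layer_block Q apexed matched); split.
  exact: (two_layer_design (design_swap12 dQ) (design_swap23 dQ) (design_swap34 dQ) apexed_swap12
    apexed_swap23 matched_swap12 matched_swap34 matched_dual rosqs_uniq apexed_uniq matched_uniq
    complete_layer complete_pair).
exact: (two_layer_shift (rosqs_shift rQ) apexed_shift matched_shift).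
Qed.

End LayersOfRotationalSystem.

Local Close Scope ring_scope.

(** * Choice of the apices *)

Definition odd_apex_parameter p (om k : 'F_p) : bool :=
  [&& odd (val k), odd (val (om ^+ 2 * (k + 1))%R) & odd (val (om * k - 1)%R)].

Definition has_rosqs (p : nat) :=
  exists (om k : 'F_p) C Q, rosqs om C Q /\ odd_apex_parameter om k.

Section ApexChoice.
Local Open Scope ring_scope.
Variables (p : nat) (om k : 'F_p) (C : pred 'F_p).
Hypotheses (prime_p : prime p) (odd_p : odd p) (om_prim : 3.-primitive_root om).
Hypotheses (k_odd : odd_apex_parameter om k) (CN : forall c, c != 0 -> C (- c) = ~~ C c).
Implicit Types c d b : 'F_p.

Let om2 := cube_root_sqr om_prim.
Let om_subr_neq0 := cube_root_subr_neq0 om_prim.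

(* One element of {c, om c, om^2 c}, the same for all three. *)
Definition cubic_representative c : 'F_p := odflt 0 [pick b | b ^+ 3 == c ^+ 3].

Lemma cubic_representative_om c : cubic_representative (om * c) = cubic_representative c.
Proof. by rewrite /cubic_representative exprMn (cube_root_exp3 om_prim) mul1r. Qed.

Lemma cubic_representativeP c :
  [\/ cubic_representative c = c, cubic_representative c = om * c | cubic_representative c = om ^+ 2 * c].
Proof.
rewrite /cubic_representative; case: pickP => [b /eqP bc /=|/(_ c)]; last by rewrite eqxx.
have : (b - c) * ((b - om * c) * (b - om ^+ 2 * c)) == 0.
  by apply/eqP; transitivity (b ^+ 3 - c ^+ 3); [ring: om2|rewrite bc subrr].
by rewrite !mulf_eq0 !subr_eq0 => /or3P [] /eqP; [constructor 1|constructor 2|constructor 3].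
Qed.

Definition parametrized_apex_offset c : 'F_p := (1 + k * (1 - om)) * cubic_representative c.
Definition apex_ratio c : 'F_p := (parametrized_apex_offset c - c) / ((1 - om) * c).
Definition parametrized_apex_index d : nat :=
  let c := d / (1 - om) in if C c then val (apex_ratio c) else (p.-1 - val (apex_ratio (- c)))%N.

Lemma odd_apex_ratio c : c != 0 -> odd (val (apex_ratio c)).
Proof.
move=> c0; have edge0 : (1 - om) * c != 0 by rewrite mulf_neq0.
have ratioE b : parametrized_apex_offset c - c = b * ((1 - om) * c) -> apex_ratio c = b.
  by rewrite /apex_ratio => ->; rewrite mulfK.
have /and3P [odd1 odd2 odd3] := k_odd.
case: (cubic_representativeP c) => rep; [rewrite (ratioE k) //|rewrite (ratioE (om * k - 1)) //
  |rewrite (ratioE (om ^+ 2 * (k + 1))) //]; rewrite /parametrized_apex_offset rep; ring: om2.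
Qed.

Lemma parametrized_apex_choice :
  apex_choice om C parametrized_apex_index parametrized_apex_offset.
Proof.
have ratio_le c : (val (apex_ratio c) <= p.-1)%N by rewrite -ltnS prednK ?prime_gt0 // Fp_val_lt.
have edgeK d : d != 0 -> d / (1 - om) != 0 by move=> d0; rewrite mulf_neq0 // invr_eq0.
split=> [d d0|d d0|c|c c0 Cc]; rewrite /parametrized_apex_index ?mulNr.
- by rewrite CN ?edgeK // opprK; case: (C _); [apply: subnK|apply: subnKC].
- case: ifP => _; first exact/odd_apex_ratio/edgeK.
  have pred_p : odd p.-1 = false by move: odd_p; case: (p) => //= n /negbTE.
  by rewrite oddB // pred_p odd_apex_ratio // oppr_eq0 edgeK.
- by rewrite /parametrized_apex_offset cubic_representative_om.
by rewrite [(1 - om) * c]mulrC mulfK // Cc natr_Zp mulrC /apex_ratio [(1 - om) * c]mulrC divfK // mulf_neq0.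
Qed.

End ApexChoice.

(* The residues of k N and of (k + 1) (N + 1) modulo p are k N + p - 2 m p,
   which is even for k, N, p odd, and (k + 1) (N + 1) - 2 m p. *)
Definition odd_apex_witness (p N k m : nat) : bool :=
  [&& odd k, k < p, m.*2 * p < k * N + p, k * N < m.*2 * p,
      m.*2 * p < k.+1 * N.+1 & k.+1 * N.+1 < m.*2.+1 * p].

Lemma odd_ceil (a d : nat) : 0 < d -> exists2 k, odd k & k.-2 * d <= a < k * d.
Proof.
move=> d_gt0; have lower := leq_divM a d; have upper := ltn_ceil a d_gt0.
case odd_k : (odd (a %/ d)).
  by exists (a %/ d).+2; [rewrite /= odd_k|rewrite lower (leq_trans upper) // leq_mul2r leqnSn orbT].
exists (a %/ d).+1; first by rewrite /= odd_k.
by rewrite upper andbT (leq_trans _ lower) // leq_mul2r leq_pred orbT.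
Qed.

(* Here k N - 2 m p = N - 2 m (p - 2 N), and m is least with this negative. *)
Lemma odd_apex_witness_ge p N : odd p -> p %| N ^ 2 + N + 1 -> 3 < p <= 3 * N -> 2 * N < p ->
  exists k m, odd_apex_witness p N k m.
Proof.
move=> odd_p /dvdnP [h]; rewrite -mulnn => hp p_le p_gt.
pose e := p - 2 * N; have pE : p = 2 * N + e by rewrite /e; lia.
have e_ge3 : 2 < e.
  suff : e != 1 by lia.
  apply/eqP => e_eq1; have square_p : p * (4 * h) = p * p + 3 by rewrite pE e_eq1 in hp *; lia.
  have : p %| p * p + 3 by rewrite -square_p dvdn_mulr.
  by rewrite dvdn_addr ?dvdn_mulr // => /dvdn_leq; lia.
pose i := N %/ (2 * e).
have ie_le : 2 * (i * e) <= N by have := leq_divM N (2 * e); rewrite -/i; lia.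
have ie_gt : N < 2 * (i * e) + 2 * e by have := ltn_ceil N (d := 2 * e); rewrite -/i; lia.
have i_le : i * 3 <= i * e by rewrite leq_mul2l; lia.
have i0_or : (i == 0) || (e <= i * e) by case: (i) => //= i'; rewrite leq_pmull.
have i0_imp : (i == 0) ==> (i * e == 0) by case: (i).
move: (pE) p_le => pE' p_le; clearbody e i.
exists (4 * i.+1 + 1), i.+1; apply/and3P; split; [lia|lia|].
by rewrite pE; apply/and4P; split; lia.
Qed.

(* With h p = N^2 + N + 1 take 2 m = h + 1, and k least odd with the fifth bound. *)
Lemma odd_apex_witness_lt p N : odd p -> p %| N ^ 2 + N + 1 -> odd N -> 1 < N -> 3 * N < p ->
  exists k m, odd_apex_witness p N k m.
Proof.
move=> odd_p /dvdnP [h]; rewrite -mulnn => hp odd_N N_gt1 N_lt.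
have odd_h : odd h by have : odd (h * p) by [rewrite -hp oddD oddD oddM odd_N]; rewrite oddM => /andP [].
have [k odd_k /andP [k_min k_big]] := @odd_ceil (N * N + p) N.+1 (ltn0Sn N).
have k_gt : N.+2 <= k.
  rewrite leqNgt; apply/negP => k_lt; have : k * N.+1 <= N.+1 * N.+1 by rewrite leq_mul2r; lia.
  by lia.
have [k' kE] : exists k', k = k'.+2 by exists (k - 2); lia.
subst k; rewrite /= in k_min.
have kN_lt : k'.+2 * N < N * N + N + 1 + p.
  have N_min : N * (k' * N.+1) <= N * (N * N + p) by rewrite leq_mul2l k_min orbT.
  have : (k'.+2 * N) * N.+1 < (N * N + N + 1 + p) * N.+1 by lia.
  by rewrite ltn_mul2r => /andP [].
have k_lt : k'.+2 + N + 1 <= p.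
  have : (k'.+2 + N + 1) * N <= p * N.
    have [N3|N_neq3] := eqVneq N 3.
      have h_eq1 : h = 1 by move: hp; rewrite N3; case: (h) => [|[|h']]; lia.
      by rewrite N3 h_eq1 in hp kN_lt *; lia.
    have [N' NE] : exists N', N = N'.+1 by exists N.-1; lia.
    have p_N' : (3 * N + 1) * N' <= p * N' by rewrite leq_mul2r; lia.
    have N5 : N * 5 <= N * N by rewrite leq_mul2l; lia.
    by rewrite NE in p_N' N5 kN_lt *; lia.
  by rewrite leq_mul2r => /orP [/eqP|//]; lia.
have half_h : (h.+1./2).*2 = h.+1 by lia.
have N_k : N.+2 * N <= k'.+2 * N by rewrite leq_mul2r k_gt orbT.
exists k'.+2, h.+1./2; apply/and3P; split; [done|lia|].
by rewrite half_h !mulSn -hp; apply/and4P; split; lia.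
Qed.

Section OddApexParameter.
Local Open Scope ring_scope.
Variable p : nat.
Hypothesis prime_p : prime p.
Implicit Types om k : 'F_p.

Lemma val_Fp_eq (n : nat) (a : 'F_p) : (n < p)%N -> a = n%:R -> val a = n.
Proof. by move=> n_lt ->; rewrite /= val_Fp_nat // modn_small. Qed.

Lemma small_cube_root : (3 %| p.-1)%N -> exists2 om : 'F_p, 3.-primitive_root om & (2 * val om < p)%N.
Proof.
move=> p3; have [om om_prim] : exists om : 'F_p, 3.-primitive_root om by apply: finField_cube_root; rewrite card_Fp.
have [om_lt|om_ge] := ltnP (2 * val om) p; first by exists om.
exists (- 1 - om); first exact: cube_root_conj.
have om_lt := Fp_val_lt om prime_p; rewrite (@val_Fp_eq (p.-1 - val om)) //; [lia|lia|].
by rewrite (@Fp_natr_opp _ _ (val om)) ?natr_Zp // subnK //; lia.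
Qed.

Lemma dvdn_cube_root om : 3.-primitive_root om -> (p %| val om ^ 2 + val om + 1)%N.
Proof.
move=> om_prim; have := val_Fp_nat prime_p (val om ^ 2 + val om + 1).
rewrite /dvdn !natrD natrX natr_Zp (cube_root_sqr om_prim) => <-.
by rewrite (_ : _ + 1 = 0) //; ring.
Qed.

Hypotheses (odd_p : odd p) (p_gt3 : (3 < p)%N).

Lemma odd_apex_parameter1 om : 3.-primitive_root om -> (2 * val om < p)%N -> ~~ odd (val om) ->
  odd_apex_parameter om 1.
Proof.
move=> om_prim; have := dvdn_cube_root om_prim; have := cube_root_sqr om_prim.
have : (val om)%:R = om by apply: natr_Zp.
move: (val om) => N om_N omE dvd_N N_lt even_N; rewrite /odd_apex_parameter.
have N_gt0 : (0 < N)%N by case: (N) dvd_N => //; rewrite dvdn1; lia.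
have N_neq : (2 * N).+1 != p.
  apply/eqP => pE; move: dvd_N => /(dvdn_mull 4).
  have -> : (4 * (N ^ 2 + N + 1) = p * p + 3)%N by rewrite -pE; nia.
  by rewrite dvdn_addr ?dvdn_mulr // => /dvdn_leq; lia.
rewrite (@val_Fp_eq 1) ?(@val_Fp_eq (p - 2 - 2 * N) (om ^+ 2 * _)) ?(@val_Fp_eq N.-1) //; try lia.
  by rewrite mulr1 -om_N -{1}(prednK N_gt0) -natr1 addrK.
have : (p - 2 - 2 * N + (1 + 1 + (N + N)))%:R = 0 :> 'F_p by rewrite (_ : _ + _ = p)%N ?pchar_Fp_0 //; lia.
by rewrite !natrD om_N omE => e; apply/eqP; rewrite -subr_eq0 -oppr_eq0 -e; apply/eqP; ring.
Qed.

Lemma odd_apex_parameter_witness om (n m : nat) : 3.-primitive_root om -> odd (val om) ->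
  odd_apex_witness p (val om) n m -> odd_apex_parameter om n%:R.
Proof.
move=> om_prim; have := cube_root_sqr om_prim; have : (val om)%:R = om by apply: natr_Zp.
move: (val om) => N om_N omE odd_N /and5P [odd_n n_lt mp_lt mp_gt /andP [mp_lt' mp_gt']].
apply/and3P; split; first by rewrite (val_Fp_eq n_lt).
  rewrite (@val_Fp_eq (m.*2.+1 * p - n.+1 * N.+1)).
  - by rewrite oddB ?oddM //= ?oddM ?odd_double ?odd_p ?odd_n /= ?odd_N // ltnW.
  - by rewrite mulSn; lia.
  have : (m.*2.+1 * p - n.+1 * N.+1 + n.+1 * N.+1)%:R = 0 :> 'F_p.
    by rewrite subnK ?(ltnW mp_gt') // natrM pchar_Fp_0 // mulr0.
  rewrite natrD natrM -!natr1 om_N => e.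
  by rewrite -[RHS](addrK ((n%:R + 1) * (om + 1))) e; ring: omE.
rewrite (@val_Fp_eq (n * N + p - m.*2 * p).-1).
- have : odd (n * N) by rewrite oddM odd_n odd_N.
  by have : ~~ odd (m.*2 * p) by [rewrite oddM odd_double]; lia.
- by lia.
have : ((n * N + p - m.*2 * p).-1 + 1 + m.*2 * p)%:R = (n * N + p)%:R :> 'F_p by congr _%:R; lia.
rewrite !natrD !natrM pchar_Fp_0 // mulr0 !addr0 om_N => e.
by rewrite -[RHS](addrK 1) e mulrC.
Qed.

End OddApexParameter.

Lemma odd_apex_parameter_exists p : prime p -> odd p -> 3 < p -> 3 %| p.-1 ->
  exists om k : 'F_p, (3.-primitive_root om)%R /\ odd_apex_parameter om k.
Proof.
move=> prime_p odd_p p_gt3 p3; have [om om_prim om_lt] := small_cube_root prime_p p3.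
have [odd_om|even_om] := boolP (odd (val om)); last first.
  by exists om, 1%R; split=> //; apply: odd_apex_parameter1 => //; lia.
have dvd_om := dvdn_cube_root prime_p om_prim.
suff [k [m km]] : exists k m, odd_apex_witness p (val om) k m.
  by exists om, k%:R%R; split=> //; apply: odd_apex_parameter_witness km.
have [p_le|p_gt] := leqP p (3 * val om); first by apply: odd_apex_witness_ge => //; lia.
apply: odd_apex_witness_lt => //.
by move: dvd_om odd_om om_lt p_gt; case: (val om) => [|[|N]] // /dvdn_leq; lia.
Qed.

Lemma has_rosqs_7_mod_12 p : prime p -> p %% 12 = 7 -> has_rosqs p.
Proof.
move=> prime_p p7; have [|||om [k [om_prim k_odd]]] := @odd_apex_parameter_exists p prime_p; try lia.
exists om, k, (nonresidue_radius om), (equianharmonic om); split=> //.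
by apply: equianharmonic_rosqs => //; rewrite card_Fp.
Qed.

(** * Rotational systems for the listed primes *)

(* A cyclotomic description of a rotational system: the m-th roots of unity and
   the translations act, so that every block is the image of a block through 0
   and some g^i with i < 2 h; scale d carries d to g^(scale_index d), and
   partner i a is the fourth point on 0, g^i, a. *)
Section Orbits.
Local Open Scope ring_scope.
Variables (F : fieldType) (om g : F) (h m : nat).
Variables (scale_index : F -> nat) (scale : F -> F) (partner : nat -> F -> F).
Implicit Types (x y z w a b c d t u : F) (i j : nat).
Hypotheses (om_prim : 3.-primitive_root om) (zeta_prim : (h.*2).-primitive_root (g ^+ m)).
Hypothesis odd_m : odd m.
Hypotheses (scale_index_lt : forall d, d != 0 -> (scale_index d < h.*2)%N)
  (scale_exp : forall d, d != 0 -> scale d ^+ m = 1)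
  (scaleE : forall d, d != 0 -> d * scale d = g ^+ scale_index d).

Definition lower_class c : bool := (c != 0) && (scale_index c < h)%N.
Definition free_point i a : bool :=
  [&& a != 0, a != g ^+ i & ~~ cubic_triangle om lower_class 0 (g ^+ i) a].
Definition orbit_block x y z w : Prop :=
  let f := scale (y - x) in let i := scale_index (y - x) in
  [/\ x != y, free_point i ((z - x) * f) & partner i ((z - x) * f) = (w - x) * f].

Let m_gt0 : (0 < m)%N. Proof. by case: (m) odd_m. Qed.

Lemma expm1_neq0 u : u ^+ m = 1 -> u != 0.
Proof. by apply: contra_eq_neq => ->; rewrite expr0n gtn_eqF // eq_sym oner_neq0. Qed.

Lemma generator_exp_neq0 i : g ^+ i != 0.
Proof.
apply: expf_neq0; apply/eqP => g0; have := prim_expr_order zeta_prim; rewrite g0 expr0n gtn_eqF //.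
by rewrite expr0n gtn_eqF ?(prim_order_gt0 zeta_prim) // => /eqP; rewrite eq_sym oner_eq0.
Qed.

Lemma scale_neq0 d : d != 0 -> scale d != 0.
Proof. by move=> d0; apply/expm1_neq0/scale_exp. Qed.

Lemma expm_scale_index d : d != 0 -> d ^+ m = (g ^+ m) ^+ scale_index d.
Proof.
by move=> d0; rewrite -exprM mulnC exprM -scaleE // exprMn (scale_exp d0) mulr1.
Qed.

Lemma zeta_exp_inj i j : (i < h.*2)%N -> (j < h.*2)%N -> (g ^+ m) ^+ i = (g ^+ m) ^+ j -> i = j.
Proof. by move=> i_lt j_lt /eqP; rewrite (eq_prim_root_expr zeta_prim) !modn_small // => /eqP. Qed.

Lemma scale_index_mul d u : d != 0 -> u ^+ m = 1 -> scale_index (d * u) = scale_index d.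
Proof.
move=> d0 u1; have du0 : d * u != 0 by rewrite mulf_neq0 // (expm1_neq0 u1).
apply: zeta_exp_inj; rewrite ?scale_index_lt //.
by rewrite -!expm_scale_index // exprMn u1 mulr1.
Qed.

Lemma scale_mul d u : d != 0 -> u ^+ m = 1 -> scale d = u * scale (d * u).
Proof.
move=> d0 u1; apply: (mulfI d0); have du0 : d * u != 0 by rewrite mulf_neq0 // (expm1_neq0 u1).
by rewrite mulrA !scaleE // scale_index_mul.
Qed.

Lemma zeta_exp_h : (g ^+ m) ^+ h = -1.
Proof.
have : ((g ^+ m) ^+ h) ^+ 2 = 1 by rewrite -exprM muln2 (prim_expr_order zeta_prim).
move/eqP; rewrite sqrf_eq1 => /orP [/eqP zeta_h|/eqP //].
have h_gt0 : (0 < h)%N by rewrite -double_gt0 (prim_order_gt0 zeta_prim).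
have h0 : h = 0 by apply: zeta_exp_inj; rewrite ?zeta_h ?expr0 //; lia.
by rewrite h0 in h_gt0.
Qed.

Lemma lower_classN c : c != 0 -> lower_class (- c) = ~~ lower_class c.
Proof.
move=> c0; have nc0 : - c != 0 by rewrite oppr_eq0.
have c_lt := scale_index_lt c0; have nc_lt := scale_index_lt nc0; rewrite /lower_class c0 nc0 /=.
have e : (g ^+ m) ^+ scale_index (- c) = (g ^+ m) ^+ (h + scale_index c).
  by rewrite exprD zeta_exp_h -!expm_scale_index // exprNn -signr_odd odd_m expr1.
move/eqP: e; rewrite (eq_prim_root_expr zeta_prim) [X in X == _]modn_small //.
have [c_lower|c_upper] := ltnP (scale_index c) h; first by rewrite modn_small; lia.
have -> : (h + scale_index c = scale_index c - h + h.*2)%N by lia.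
by rewrite modnDr modn_small; lia.
Qed.

Lemma lower_class_mul u c : u ^+ m = 1 -> lower_class (u * c) = lower_class c.
Proof.
move=> u1; rewrite mulrC /lower_class mulf_eq0 (negPf (expm1_neq0 u1)) orbF.
by have [//|c0] := eqVneq c 0; rewrite scale_index_mul.
Qed.

Lemma cubic_triangle_affine u t x y z : u ^+ m = 1 ->
  cubic_triangle om lower_class ((x - t) * u) ((y - t) * u) ((z - t) * u) = cubic_triangle om lower_class x y z.
Proof.
move=> u1; have u0 := expm1_neq0 u1.
suff orient x' y' : oriented_triangle om lower_class ((x' - t) * u) ((y' - t) * u) ((z - t) * u) =
    oriented_triangle om lower_class x' y' z by rewrite /cubic_triangle !orient.
rewrite /oriented_triangle; congr (_ && _).
  have -> : (x' - t) * u + om * ((y' - t) * u) - (1 + om) * ((z - t) * u) =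
    u * (x' + om * y' - (1 + om) * z) by ring.
  by rewrite mulf_eq0 (negPf u0).
have -> : radius om ((x' - t) * u) ((y' - t) * u) = u * radius om x' y' by rewrite /radius; ring.
exact: lower_class_mul.
Qed.

Lemma cubic_triangle_base y a : y != 0 -> cubic_triangle om lower_class 0 y a =
  (a == if lower_class (y / (1 - om)) then - om * y else (1 + om) * y).
Proof.
move=> y0; have om2 := cube_root_sqr om_prim; have om1 := cube_root_neq1 om_prim.
have y_om : radius om y 0 = y / (1 - om) by rewrite /radius subr0.
have third_vertex u b : (u - (1 + om) * b == 0) = (b == - om * u).
  apply/eqP/eqP => [e|->]; last by ring: om2.
  transitivity (- om * ((1 + om) * b)); first by ring: om2.
  by congr (_ * _); apply/eqP; rewrite -subr_eq0 -oppr_eq0 opprB e.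
rewrite /cubic_triangle /oriented_triangle radius_sym lower_classN ?radius_neq0 // y_om.
rewrite add0r mulr0 addr0 !third_vertex; case: ifP => _; rewrite /= ?andbF ?andbT ?orbF //.
by congr (_ == _); ring: om2.
Qed.

Lemma free_pointE x y z : x != y ->
  free_point (scale_index (y - x)) ((z - x) * scale (y - x)) =
  distinct3 x y z && ~~ cubic_triangle om lower_class x y z.
Proof.
move=> xy; have yx0 : y - x != 0 by rewrite subr_eq0 eq_sym.
have f1 := scale_exp yx0; have f0 := scale_neq0 yx0.
rewrite /free_point -(cubic_triangle_affine x x y z f1) -scaleE // subrr mul0r /distinct3 xy /= -andbA.
congr [&& _, _ & _]; first by rewrite mulf_eq0 (negPf f0) orbF subr_eq0 eq_sym.
by rewrite (inj_eq (mulIf f0)) (inj_eq (addIr _)) eq_sym.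
Qed.

Hypothesis m3 : (3 %| m)%N.

Lemma lower_class_om c : lower_class (om * c) = lower_class c.
Proof.
by apply: lower_class_mul; case/dvdnP: m3 => k ->; rewrite mulnC exprM (cube_root_exp3 om_prim) expr1n.
Qed.

Hypothesis partner_free : forall i a, (i < h.*2)%N -> free_point i a ->
  free_point i (partner i a) /\ partner i (partner i a) = a.
Hypothesis partner_pivot : forall i a, (i < h.*2)%N -> free_point i a ->
  partner (scale_index a) (g ^+ i * scale a) = partner i a * scale a.
Hypothesis partner_reverse : forall i a, (i < h.*2)%N -> free_point i a ->
  partner (scale_index (- g ^+ i)) ((a - g ^+ i) * scale (- g ^+ i)) =
  (partner i a - g ^+ i) * scale (- g ^+ i).

Lemma orbit_block_dom x y z w : orbit_block x y z w ->
  distinct3 x y z && ~~ cubic_triangle om lower_class x y z.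
Proof. by case=> xy free _; rewrite -free_pointE. Qed.

Lemma orbit_blockI x y z w : distinct3 x y z -> ~~ cubic_triangle om lower_class x y z ->
  partner (scale_index (y - x)) ((z - x) * scale (y - x)) = (w - x) * scale (y - x) -> orbit_block x y z w.
Proof.
by move=> xyz tri e; have /and3P [xy _ _] := xyz; split; rewrite ?free_pointE ?xyz.
Qed.

Lemma orbit_block_swap34 x y z w : orbit_block x y z w -> orbit_block x y w z.
Proof.
case=> xy free pz; have yx0 : y - x != 0 by rewrite subr_eq0 eq_sym.
by have [free_w pw] := partner_free (scale_index_lt yx0) free; rewrite pz in free_w pw; split.
Qed.

Lemma orbit_block_swap23 x y z w : orbit_block x y z w -> orbit_block x z y w.
Proof.
move=> xyzw; have /andP [xyz tri] := orbit_block_dom xyzw; have /and3P [xy xz _] := xyz.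
have yx0 : y - x != 0 by rewrite subr_eq0 eq_sym.
have zx0 : z - x != 0 by rewrite subr_eq0 eq_sym.
case: xyzw => _ free pz; have f1 := scale_exp yx0.
apply: orbit_blockI; first by rewrite distinct3C23.
  by rewrite -(cubic_triangle_swap23 om_prim lower_class_om).
have := partner_pivot (scale_index_lt yx0) free.
by rewrite pz scale_index_mul // -scaleE // -!mulrA -scale_mul.
Qed.

Lemma orbit_block_swap12 x y z w : orbit_block x y z w -> orbit_block y x z w.
Proof.
move=> xyzw; have /andP [xyz tri] := orbit_block_dom xyzw; have /and3P [xy xz _] := xyz.
have yx0 : y - x != 0 by rewrite subr_eq0 eq_sym.
have xy0 : x - y != 0 by rewrite subr_eq0.
case: xyzw => _ free pz; have f1 := scale_exp yx0.
apply: orbit_blockI; [by rewrite distinct3C12|by rewrite cubic_triangle_swap12|].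
have oppE : - g ^+ scale_index (y - x) = (x - y) * scale (y - x) by rewrite -scaleE // -mulNr opprB.
have diffE v : (v - x) * scale (y - x) - g ^+ scale_index (y - x) = (v - y) * scale (y - x).
  by rewrite -scaleE //; ring.
have := partner_reverse (scale_index_lt yx0) free.
by rewrite pz !diffE oppE scale_index_mul // -!mulrA -scale_mul.
Qed.

Lemma orbit_rosqs : rosqs om lower_class orbit_block.
Proof.
split=> //; [by rewrite /lower_class eqxx|exact: lower_classN|exact: lower_class_om| |]; last first.
  have diff t a b : b + t - (a + t) = b - a by ring.
  by move=> t x y z w [xy free pz]; split; rewrite ?diff // -subr_eq0 diff subr_eq0.
split=> //; [exact: orbit_block_swap12|exact: orbit_block_swap23|exact: orbit_block_swap34| | |].
- exact: orbit_block_dom.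
- move=> x y z /andP [xyz tri]; have /and3P [xy _ _] := xyz.
  have f0 : scale (y - x) != 0 by rewrite scale_neq0 // subr_eq0 eq_sym.
  exists (x + partner (scale_index (y - x)) ((z - x) * scale (y - x)) / scale (y - x)).
  by apply: orbit_blockI => //; rewrite addrAC subrr add0r divfK.
move=> x y z w w' [xy _ pz] [_ _]; have f0 : scale (y - x) != 0 by rewrite scale_neq0 // subr_eq0 eq_sym.
by rewrite pz => /(mulIf f0) /addIr.
Qed.

End Orbits.

Local Open Scope N_scope.

Section ModularArithmetic.
Variable P : N.
Definition mulm (a b : N) : N := N.modulo (a * b) P.
Definition subm (a b : N) : N := N.modulo (a + P - b) P.
Fixpoint expm (a : N) (e : positive) : N := match e with
  | xH => a | xO e' => let b := expm a e' in mulm b b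
  | xI e' => let b := expm a e' in mulm a (mulm b b) end.
Fixpoint geometric (a c : N) (n : nat) : seq N := if n is n'.+1 then c :: geometric a (mulm a c) n' else [::].
End ModularArithmetic.

Section ResidueCodes.
Variables (p : nat) (P : N).
Hypotheses (prime_p : prime p) (PE : N.to_nat P = p).
Implicit Types (m n : N) (a : 'F_p).

Definition decode n : 'F_p := (N.to_nat n)%:R%R.
Definition code a : N := N.of_nat (val a).

Lemma codeK a : decode (code a) = a.
Proof. by rewrite /decode /code Nat2N.id natr_Zp. Qed.

Lemma code_lt a : code a < P.
Proof. by have := Fp_val_lt a prime_p; rewrite /code; lia. Qed.

Lemma val_decode n : n < P -> val (decode n) = N.to_nat n.
Proof. by move=> n_lt; rewrite (val_Fp_eq prime_p _ (erefl (decode n))) //; lia. Qed.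

Lemma decodeK n : n < P -> code (decode n) = n.
Proof. by move=> n_lt; rewrite /code val_decode // N2Nat.id. Qed.

Lemma eqb_decode m n : m < P -> n < P -> N.eqb m n = (decode m == decode n).
Proof.
move=> m_lt n_lt; case: N.eqb_spec => [->|neq]; first by rewrite eqxx.
by apply/esym/eqP => /(congr1 code); rewrite !decodeK.
Qed.

Let P_neq0 : P <> N0. Proof. by have := prime_gt0 prime_p; lia. Qed.

Lemma modulo_lt n : N.modulo n P < P.
Proof. exact: N.mod_lt. Qed.

Lemma decodeD m n : decode (m + n) = (decode m + decode n)%R.
Proof. by rewrite /decode N2Nat.inj_add natrD. Qed.

Lemma decodeM m n : decode (m * n) = (decode m * decode n)%R.
Proof. by rewrite /decode N2Nat.inj_mul natrM. Qed.

Lemma decode_modulus : decode P = 0%R.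
Proof. by rewrite /decode PE pchar_Fp_0. Qed.

Lemma decode_modulo n : decode (N.modulo n P) = decode n.
Proof. by rewrite [in RHS](N.div_mod n P P_neq0) decodeD decodeM decode_modulus mul0r add0r. Qed.

Lemma decode_mulm m n : decode (mulm P m n) = (decode m * decode n)%R.
Proof. by rewrite decode_modulo decodeM. Qed.

Lemma decode_subm m n : n < P -> decode (subm P m n) = (decode m - decode n)%R.
Proof.
move=> n_lt; apply/eqP; rewrite decode_modulo eq_sym subr_eq -decodeD.
by rewrite (_ : _ + n = m + P) ?decodeD ?decode_modulus ?addr0 //; lia.
Qed.

Lemma decode_expm m e : decode (expm P m e) = (decode m ^+ Pos.to_nat e)%R.
Proof.
elim: e => [e IH|e IH|] /=; last by rewrite expr1.
  have -> : Pos.to_nat (xI e) = (Pos.to_nat e * 2).+1 by lia.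
  by rewrite !decode_mulm IH exprS exprM expr2.
have -> : Pos.to_nat (xO e) = (Pos.to_nat e * 2)%N by lia.
by rewrite !decode_mulm IH exprM expr2.
Qed.

Lemma expm_lt m e : m < P -> expm P m e < P.
Proof. by case: e => [e|e|] //= _; apply: modulo_lt. Qed.

Lemma nth_geometric (b c : N) (k i : nat) : (i < k)%N -> c < P ->
  nth N0 (geometric P b c k) i < P /\
  decode (nth N0 (geometric P b c k) i) = (decode c * decode b ^+ i)%R.
Proof.
elim: k c i => [|k IH] c [|i] //= i_lt c_lt; first by rewrite expr0 mulr1.
by have [? ->] := IH (mulm P b c) i i_lt (modulo_lt _); rewrite decode_mulm exprS mulrCA mulrA.
Qed.

End ResidueCodes.

(* T lists a scale index and a scale for every d, W the partner of every a on every
   line 0, g^i; iv is the inverse of 1 - om. *)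
Section TableCheck.
Variables (P g om iv k : N) (h : nat) (M : positive) (T : seq (nat * N)) (W : seq (seq N)).

Definition table_scale (z : N) : nat * N := nth (0%N, 0) T (N.to_nat z).
Definition table_partner (i : nat) (z : N) : N := nth 0 (nth [::] W i) (N.to_nat z).
Definition table_power (i : nat) : N := nth 0 (geometric P g 1 h.*2.+1) i.

Definition free_code (i : nat) (z : N) : bool :=
  let y := table_power i in
  [&& ~~ N.eqb z 0, ~~ N.eqb z y & ~~ N.eqb z
    (if ((table_scale (mulm P y iv)).1 < h)%N then mulm P (subm P 0 om) y else mulm P (1 + om) y)].

Definition check_parameters : bool :=
  [&& N.ltb om P && N.ltb 1 om, N.eqb (N.modulo (om * om + om + 1) P) 0 & N.eqb (mulm P iv (subm P 1 om)) 1].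

Definition check_apex_parameter : bool :=
  [&& N.odd k, N.ltb k P, N.odd (mulm P (mulm P om om) (k + 1)) & N.odd (subm P (mulm P om k) 1)].

Definition check_generator : bool := (0 < h)%N &&
  all (fun i => N.eqb (expm P (table_power i) M) 1 == (i == h.*2)) (iota 1 h.*2).

Definition check_scales : bool :=
  all (fun n => let z := N.of_nat n in let: (i, f) := table_scale z in
    [&& (i < h.*2)%N, N.ltb f P, N.eqb (mulm P z f) (table_power i) & N.eqb (expm P f M) 1])
  (iota 1 (N.to_nat P).-1).

Definition check_partners : bool :=
  all (fun i => let y := table_power i in let: (i2, f2) := table_scale (subm P 0 y) in
    all (fun n => let z := N.of_nat n in let w := table_partner i z in let: (i1, f1) := table_scale z in
      free_code i z ==>
      [&& N.ltb w P, free_code i w, N.eqb (table_partner i w) z,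
          N.eqb (table_partner i1 (mulm P y f1)) (mulm P w f1) &
          N.eqb (table_partner i2 (mulm P (subm P z y) f2)) (mulm P (subm P w y) f2)])
    (iota 1 (N.to_nat P).-1)) (iota 0 h.*2).

Definition check_tables : bool :=
  [&& check_parameters, check_apex_parameter, check_generator, check_scales & check_partners].

Variable p : nat.
Hypotheses (prime_p : prime p) (PE : N.to_nat P = p).
Hypotheses (odd_m : odd (Pos.to_nat M)) (m3 : 3 %| Pos.to_nat M).
Hypothesis tables_ok : check_tables.
Local Open Scope ring_scope.
Implicit Types (a d : 'F_p) (i : nat).
Local Notation decode := (decode p).
Local Notation m := (Pos.to_nat M).

Definition scale_index a : nat := (table_scale (code a)).1.
Definition scale a : 'F_p := decode (table_scale (code a)).2.
Definition partner i a : 'F_p := decode (table_partner i (code a)).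

Let parameters_ok : check_parameters. Proof. by case/and5P: tables_ok. Qed.
Let apex_ok : check_apex_parameter. Proof. by case/and5P: tables_ok. Qed.
Let generator_ok : check_generator. Proof. by case/and5P: tables_ok. Qed.
Let scales_ok : check_scales. Proof. by case/and5P: tables_ok. Qed.
Let partners_ok : check_partners. Proof. by case/and5P: tables_ok. Qed.
Let one_lt : (1 < P)%num. Proof. by have := prime_gt1 prime_p; lia. Qed.
Let zero_lt : (0 < P)%num. Proof. by lia. Qed.
Let om_lt : (om < P)%num. Proof. by case/and3P: parameters_ok => /andP [/N.ltb_lt]. Qed.

Lemma decode1 : decode 1 = 1.
Proof. by []. Qed.

Lemma table_cube_root : 3.-primitive_root (decode om).
Proof.
case/and3P: parameters_ok => /andP [_ /N.ltb_lt om_gt1] /N.eqb_eq /(congr1 decode) om2 _.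
apply: primitive_cube_rootI.
  rewrite (decode_modulo prime_p PE) !decodeD decodeM in om2.
  by rewrite expr2 -[LHS]subr0 -[0]/(decode 0) -om2 decode1; ring.
by rewrite -decode1 -(eqb_decode prime_p PE) //; apply/negP => /N.eqb_eq e; rewrite e in om_gt1.
Qed.

Lemma table_inverse : decode iv = (1 - decode om)^-1.
Proof.
case/and3P: parameters_ok => _ _ /N.eqb_eq /(congr1 decode).
rewrite (decode_mulm prime_p PE) (decode_subm prime_p PE) // decode1 => e.
have om1 := cube_root_subr_neq0 table_cube_root.
by apply: (mulIf om1); rewrite e mulVf.
Qed.

Lemma N_oddE (n : N) : odd (N.to_nat n) = N.odd n.
Proof.
have nE := N.div2_odd n.
have -> : N.to_nat n = (N.odd n + (N.to_nat (N.div2 n)).*2)%N.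
  by move: nE; case: (N.odd n); rewrite /N.b2n; lia.
by rewrite oddD odd_double addbF oddb.
Qed.

Lemma table_apex_parameter : odd_apex_parameter (decode om) (decode k).
Proof.
case/and4P: apex_ok => odd_k /N.ltb_lt k_lt odd_k1 odd_k2; apply/and3P.
have -> : decode om ^+ 2 * (decode k + 1) = decode (mulm P (mulm P om om) (k + 1)).
  by rewrite !(decode_mulm prime_p PE) decodeD decode1 expr2.
have -> : decode om * decode k - 1 = decode (subm P (mulm P om k) 1).
  by rewrite (decode_subm prime_p PE) // (decode_mulm prime_p PE) decode1.
by split; rewrite (val_decode prime_p PE) ?N_oddE //; apply: modulo_lt prime_p PE _.
Qed.

Lemma table_power_lt i : (i <= h.*2)%N -> (table_power i < P)%num.
Proof. by move=> i_le; case: (nth_geometric prime_p PE g (i_le : (i < h.*2.+1)%N) one_lt). Qed.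

Lemma decode_table_power i : (i <= h.*2)%N -> decode (table_power i) = decode g ^+ i.
Proof.
move=> i_le; case: (nth_geometric prime_p PE g (i_le : (i < h.*2.+1)%N) one_lt) => _ ->.
by rewrite decode1 mul1r.
Qed.

Lemma table_generator : (h.*2).-primitive_root (decode g ^+ m).
Proof.
case/andP: generator_ok => h_gt0 /allP gen_ok; rewrite /primitive_root_of_unity double_gt0 h_gt0.
apply/forallP => i; have i_lt := ltn_ord i; have /gen_ok /eqP <- : i.+1 \in iota 1 h.*2 by rewrite mem_iota.
have power_lt := table_power_lt i_lt; have powerM_lt := expm_lt prime_p PE M power_lt.
by rewrite unity_rootE (eqb_decode prime_p PE) // (decode_expm prime_p PE) decode_table_power // decode1 -!exprM mulnC.
Qed.

Lemma code_gt0 a : a != 0 -> (0 < val a)%N.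
Proof. by rewrite lt0n; apply: contra => /eqP e; apply/eqP/val_inj. Qed.

Lemma code_iota a : a != 0 -> val a \in iota 1 (N.to_nat P).-1.
Proof.
move=> /code_gt0 a0; rewrite mem_iota a0 PE add1n prednK ?prime_gt0 //.
exact: Fp_val_lt.
Qed.

Lemma table_scaleP d : d != 0 ->
  [/\ (scale_index d < h.*2)%N, scale d ^+ m = 1 & d * scale d = decode g ^+ scale_index d] /\
  ((table_scale (code d)).2 < P)%num.
Proof.
move/code_iota => d_in; have := allP scales_ok _ d_in; rewrite /scale_index /scale -/(code d).
case: (table_scale _) => i f /= /and4P [i_lt /N.ltb_lt f_lt /N.eqb_eq dfE /N.eqb_eq f1]; split=> //; split=> //.
  by rewrite -(decode_expm prime_p PE) f1.
by rewrite -decode_table_power ?(ltnW i_lt) // -dfE (decode_mulm prime_p PE) codeK.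
Qed.

Lemma scale_index_bound d : d != 0 -> (scale_index d < h.*2)%N.
Proof. by case/table_scaleP => [[]]. Qed.
Lemma expm_scale d : d != 0 -> scale d ^+ m = 1.
Proof. by case/table_scaleP => [[]]. Qed.
Lemma mul_scale d : d != 0 -> d * scale d = decode g ^+ scale_index d.
Proof. by case/table_scaleP => [[]]. Qed.

Local Notation free_point := (free_point (decode om) (decode g) h scale_index).

Lemma free_codeE i (z : N) : (i < h.*2)%N -> (z < P)%num -> free_code i z = free_point i (decode z).
Proof.
move=> i_lt z_lt; have gi0 := generator_exp_neq0 table_generator odd_m.
have om_prim := table_cube_root; have om1 := cube_root_subr_neq0 om_prim.
have y_lt := table_power_lt (ltnW i_lt); have yE := decode_table_power (ltnW i_lt).
rewrite /free_point (cubic_triangle_base om_prim table_generator odd_m scale_index_bound expm_scale mul_scale) //.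
have -> : lower_class h scale_index (decode g ^+ i / (1 - decode om)) =
    ((table_scale (mulm P (table_power i) iv)).1 < h)%N.
  rewrite /lower_class mulf_neq0 ?invr_eq0 //= /scale_index -table_inverse -yE -(decode_mulm prime_p PE).
  by rewrite (decodeK prime_p PE) //; apply: modulo_lt prime_p PE _.
rewrite /free_code !(eqb_decode prime_p PE) ?yE //; last by case: ifP => _; apply: modulo_lt prime_p PE _.
case: ifP => _; rewrite !(decode_mulm prime_p PE) ?(decode_subm prime_p PE) ?decodeD ?decode1 // yE.
  by rewrite -[decode 0]/(0 : 'F_p) sub0r.
by [].
Qed.

Lemma code_mulm (u v : N) : code (decode u * decode v) = mulm P u v.
Proof. by rewrite -(decode_mulm prime_p PE) (decodeK prime_p PE) //; apply: modulo_lt prime_p PE _. Qed.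

Lemma table_partnerP i a : (i < h.*2)%N -> free_point i a ->
  [/\ free_point i (partner i a) /\ partner i (partner i a) = a,
    partner (scale_index a) (decode g ^+ i * scale a) = partner i a * scale a &
    partner (scale_index (- decode g ^+ i)) ((a - decode g ^+ i) * scale (- decode g ^+ i)) =
      (partner i a - decode g ^+ i) * scale (- decode g ^+ i)].
Proof.
move=> i_lt free; have y_lt := table_power_lt (ltnW i_lt); have yE := decode_table_power (ltnW i_lt).
have a_in : val a \in iota 1 (N.to_nat P).-1 by apply: code_iota; case/and3P: free.
have negE : code (- decode g ^+ i) = subm P 0 (table_power i).
  rewrite -yE -[- _]sub0r -[0]/(decode 0) -(decode_subm prime_p PE) // (decodeK prime_p PE) //.
  exact: modulo_lt prime_p PE _.
have /(allP partners_ok) : i \in iota 0 h.*2 by rewrite mem_iota.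
rewrite /scale_index /scale negE; case: (table_scale (subm P 0 _)) => i2 f2 /allP /(_ _ a_in).
rewrite -/(code a); case: (table_scale (code a)) => i1 f1.
rewrite free_codeE // ?codeK ?free /=; last exact: code_lt prime_p PE _.
case/and5P => /N.ltb_lt w_lt; rewrite free_codeE // => free_w /N.eqb_eq pw /N.eqb_eq pivot /N.eqb_eq reverse.
rewrite /partner; split.
- by rewrite (decodeK prime_p PE) // pw codeK.
- by rewrite -yE code_mulm pivot (decode_mulm prime_p PE).
rewrite -yE -{1}(codeK a) -!(decode_subm prime_p PE) // code_mulm reverse.
exact: decode_mulm prime_p PE _ _.
Qed.

Lemma has_rosqs_of_tables : has_rosqs p.
Proof.
exists (decode om), (decode k), (lower_class h scale_index); eexists; split; last exact: table_apex_parameter.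
apply: (orbit_rosqs (partner := partner) table_cube_root table_generator odd_m scale_index_bound expm_scale mul_scale m3).
- by move=> i a i_lt free; case: (table_partnerP i_lt free).
- by move=> i a i_lt free; case: (table_partnerP i_lt free).
by move=> i a i_lt free; case: (table_partnerP i_lt free).
Qed.

End TableCheck.

Definition scale_table (P g : N) (h m : nat) : seq (nat * N) :=
  let zeta := nth 0 (geometric P g 1 h.*2.+1) h.*2 in let inv_zeta := last 0 (geometric P zeta 1 m) in
  foldr (fun (ie : nat * N) T => foldr (fun (uf : N * N) T =>
    set_nth (0%N, 0) T (N.to_nat (mulm P ie.2 uf.1)) (ie.1, uf.2))
      T (zip (geometric P zeta 1 m) (geometric P inv_zeta 1 m)))
  [::] (zip (iota 0 h.*2) (geometric P g 1 h.*2)).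

Definition partner_table (P : N) (T : seq (nat * N)) (base : seq N) : seq (seq N) :=
  let orders := permutations (iota 0 4) in
  foldl (fun W b => foldl (fun W q =>
    if [seq nth 0 b j | j <- q] is [:: x; y; z; w] then
      let: (i, f) := table_scale T (subm P y x) in
      set_nth [::] W i (set_nth 0 (nth [::] W i) (N.to_nat (mulm P (subm P z x) f)) (mulm P (subm P w x) f))
    else W) W orders) [::] (quadruples base).

Definition check_base_blocks (p : nat) (P g om iv k : N) (h : nat) (M : positive) (base : seq N) : bool :=
  let T := scale_table P g h (Pos.to_nat M) in
  [&& prime p, N.to_nat P == p, odd (Pos.to_nat M), 3 %| Pos.to_nat M &
    check_tables P g om iv k h M T (partner_table P T base)].

Lemma has_rosqs_of_base_blocks p P g om iv k h M base :
  check_base_blocks p P g om iv k h M base -> has_rosqs p.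
Proof.
case/and5P => prime_p /eqP PE odd_m m3 tables_ok.
exact: (has_rosqs_of_tables prime_p PE odd_m m3 tables_ok).
Qed.

Definition base_blocks_37 : seq N :=
  [:: 0; 1; 5; 25; 0; 1; 7; 8; 0; 1; 2; 4; 0; 1; 6; 15; 0; 1; 9; 14; 0; 1; 12; 28; 0; 2; 17; 31]%num.

Definition base_blocks_61 : seq N :=
  [:: 0; 1; 3; 26; 0; 1; 7; 22; 0; 1; 20; 30; 0; 1; 17; 40; 0; 1; 5; 34; 0; 1; 6; 56; 0; 1; 18;
  36; 0; 1; 4; 10; 0; 1; 2; 55; 0; 1; 15; 49; 0; 2; 30; 37]%num.

Definition base_blocks_73 : seq N :=
  [:: 0; 5; 28; 35; 0; 5; 11; 56; 0; 5; 26; 31; 0; 5; 10; 29; 0; 1; 12; 24; 0; 1; 22; 51; 0; 1;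
  6; 23; 0; 1; 11; 68; 0; 1; 21; 27; 0; 1; 7; 15; 0; 1; 20; 60; 0; 1; 29; 47; 0; 1; 28; 49; 0; 1;
  25; 30; 0; 1; 3; 50; 0; 1; 16; 53; 0; 1; 19; 62; 0; 1; 13; 71; 0; 1; 8; 45; 0; 1; 42; 69; 0; 1;
  34; 40; 0; 1; 2; 5; 0; 5; 38; 50; 0; 1; 10; 66; 0; 25; 31; 44; 0; 1; 9; 52]%num.

Definition base_blocks_109 : seq N :=
  [:: 0; 1; 17; 93; 0; 1; 67; 86; 0; 1; 38; 79; 0; 1; 13; 60; 0; 1; 56; 98; 0; 1; 6; 23; 0; 1; 7;
  62; 0; 1; 55; 57; 0; 1; 11; 43; 0; 1; 2; 31; 0; 1; 24; 37; 0; 1; 9; 50; 0; 1; 19; 72; 0; 1; 18;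
  26; 0; 1; 10; 103; 0; 1; 4; 16; 0; 1; 3; 105; 0; 1; 46; 52; 0; 1; 47; 65]%num.

Definition base_blocks_157 : seq N :=
  [:: 0; 1; 15; 121; 0; 1; 10; 71; 0; 1; 3; 4; 0; 1; 47; 142; 0; 1; 36; 64; 0; 1; 25; 83; 0; 1;
  26; 132; 0; 1; 11; 62; 0; 1; 17; 67; 0; 1; 12; 30; 0; 1; 9; 43; 0; 1; 60; 136; 0; 1; 6; 22; 0;
  1; 24; 125; 0; 1; 16; 27; 0; 1; 23; 104; 0; 1; 18; 80; 0; 1; 38; 152; 0; 1; 5; 29; 0; 1; 2; 79;
  0; 1; 20; 116; 0; 1; 8; 139; 0; 1; 44; 129; 0; 1; 21; 66; 0; 1; 7; 61; 0; 1; 14; 146; 0; 5; 34;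
  97]%num.

Definition base_blocks_181 : seq N :=
  [:: 0; 1; 7; 24; 0; 2; 8; 112; 0; 1; 90; 104; 0; 1; 54; 57; 0; 1; 23; 99; 0; 1; 28; 59; 0; 1;
  2; 152; 0; 1; 8; 78; 0; 1; 25; 174; 0; 1; 17; 91; 0; 1; 9; 47; 0; 1; 58; 83; 0; 1; 11; 89; 0;
  1; 21; 109; 0; 1; 52; 84; 0; 1; 6; 53; 0; 1; 94; 112; 0; 1; 12; 19; 0; 1; 30; 35; 0; 1; 5; 32;
  0; 1; 41; 172; 0; 1; 3; 62; 0; 1; 22; 101; 0; 1; 10; 127; 0; 1; 15; 177; 0; 1; 61; 178; 0; 1;
  31; 100; 0; 1; 4; 82; 0; 1; 33; 108; 0; 1; 49; 77; 0; 1; 50; 134]%num.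

Definition base_blocks_229 : seq N :=
  [:: 0; 1; 12; 203; 0; 1; 4; 148; 0; 1; 3; 17; 0; 1; 19; 122; 0; 1; 2; 46; 0; 1; 48; 187; 0; 1;
  5; 128; 0; 1; 16; 172; 0; 1; 56; 144; 0; 1; 24; 50; 0; 1; 109; 120; 0; 1; 28; 192; 0; 1; 23;
  210; 0; 1; 75; 87; 0; 1; 18; 88; 0; 1; 110; 129; 0; 1; 8; 34; 0; 1; 77; 111; 0; 1; 7; 53; 0; 1;
  6; 130; 0; 1; 10; 93; 0; 1; 11; 168; 0; 1; 89; 106; 0; 1; 73; 161; 0; 1; 124; 152; 0; 1; 30;
  182; 0; 1; 117; 190; 0; 1; 29; 189; 0; 1; 9; 39; 0; 1; 42; 114; 0; 1; 195; 223; 0; 1; 54; 72;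
  0; 1; 40; 92; 0; 1; 74; 97; 0; 1; 13; 150; 0; 1; 200; 208; 0; 1; 14; 156; 0; 1; 96; 136; 0; 1;
  32; 95]%num.

Definition base_blocks_277 : seq N :=
  [:: 0; 1; 84; 148; 0; 1; 59; 122; 0; 1; 9; 256; 0; 1; 4; 201; 0; 1; 11; 238; 0; 1; 14; 261; 0;
  1; 10; 33; 0; 1; 16; 231; 0; 1; 49; 131; 0; 1; 3; 58; 0; 1; 21; 270; 0; 1; 40; 264; 0; 1; 22;
  78; 0; 1; 28; 128; 0; 1; 18; 247; 0; 1; 2; 114; 0; 1; 6; 42; 0; 1; 25; 193; 0; 1; 51; 220; 0;
  1; 13; 142; 0; 1; 43; 82; 0; 1; 23; 96; 0; 1; 8; 76; 0; 1; 7; 269; 0; 1; 74; 245; 0; 1; 29;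
  153; 0; 1; 30; 125; 0; 1; 27; 183; 0; 1; 38; 81; 0; 1; 39; 260; 0; 1; 15; 166; 0; 1; 105; 234;
  0; 1; 167; 198; 0; 1; 26; 129; 0; 1; 62; 99; 0; 1; 12; 163; 0; 1; 172; 240; 0; 1; 135; 150; 0;
  1; 35; 61; 0; 1; 37; 152; 0; 1; 44; 98; 0; 1; 17; 195; 0; 1; 32; 126; 0; 1; 111; 184; 0; 1;
  104; 254; 0; 1; 117; 224; 0; 1; 118; 162]%num.

Lemma has_rosqs_37 : has_rosqs 37.
Proof.
by apply: (@has_rosqs_of_base_blocks 37 37 2 26 34 3 2 9%positive base_blocks_37); vm_compute.
Qed.

Lemma has_rosqs_61 : has_rosqs 61.
Proof.
by apply: (@has_rosqs_of_base_blocks 61 61 2 47 57 5 2 15%positive base_blocks_61); vm_compute.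
Qed.

Lemma has_rosqs_73 : has_rosqs 73.
Proof.
by apply: (@has_rosqs_of_base_blocks 73 73 5 8 52 1 4 9%positive base_blocks_73); vm_compute.
Qed.

Lemma has_rosqs_109 : has_rosqs 109.
Proof.
by apply: (@has_rosqs_of_base_blocks 109 109 6 63 58 3 2 27%positive base_blocks_109); vm_compute.
Qed.

Lemma has_rosqs_157 : has_rosqs 157.
Proof.
by apply: (@has_rosqs_of_base_blocks 157 157 5 12 57 1 2 39%positive base_blocks_157); vm_compute.
Qed.

Lemma has_rosqs_181 : has_rosqs 181.
Proof.
by apply: (@has_rosqs_of_base_blocks 181 181 2 48 77 1 2 45%positive base_blocks_181); vm_compute.
Qed.

Lemma has_rosqs_229 : has_rosqs 229.
Proof.
by apply: (@has_rosqs_of_base_blocks 229 229 6 134 198 7 2 57%positive base_blocks_229); vm_compute.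
Qed.

Lemma has_rosqs_277 : has_rosqs 277.
Proof.
by apply: (@has_rosqs_of_base_blocks 277 277 5 116 224 1 2 69%positive base_blocks_277); vm_compute.
Qed.

Local Close Scope N_scope.

(** * Optical orthogonal codes *)

Section InvariantFibredDesign.
Variables (p u : nat).
Hypotheses (prime_p : prime p) (odd_p : odd p) (p_rosqs : has_rosqs p).
Hypotheses (even_u : ~~ odd u) (u_gt0 : 0 < u).
Implicit Types (t : 'F_p) (x y z w : 'F_p * 'I_u).

Lemma two_layers_of_rosqs :
  exists R : 'F_p * bool -> 'F_p * bool -> 'F_p * bool -> 'F_p * bool -> Prop,
  design (fun a b c : 'F_p * bool => distinct3 a.1 b.1 c.1) R /\
  forall t (a b c d : 'F_p * bool), R a b c d ->
    R (a.1 + t, a.2)%R (b.1 + t, b.2)%R (c.1 + t, c.2)%R (d.1 + t, d.2)%R.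
Proof.
case: p_rosqs => om [k [C [Q [rQ k_odd]]]].
exact: (shift_invariant_two_layers prime_p odd_p rQ
  (parametrized_apex_choice prime_p odd_p (rosqs_om rQ) k_odd (rosqs_CN rQ))).
Qed.

Lemma transversal_design : exists R, design (fun x y z => distinct3 x.1 y.1 z.1) R /\
  forall t x y z w, R x y z w -> R (shift t x) (shift t y) (shift t z) (shift t w).
Proof.
have [R [dR R_shift]] := two_layers_of_rosqs.
have [n uE] : exists n, u = n.+1.*2 by exists u.-2./2; lia.
have [b [b' bK b'K]] : exists b : 'I_u -> bool * 'I_n.+1, bijective b.
  by apply: card_bij; rewrite card_prod card_bool !card_ord; lia.
pose f x : ('F_p * bool) * 'I_n.+1 := ((x.1, (b x.2).1), (b x.2).2).
have f_bij : bijective f.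
  exists (fun q => (q.1.1, b' (q.1.2, q.2))) => [[a v]|[[a l] v]]; rewrite /f /=.
    by rewrite -surjective_pairing bK.
  by rewrite b'K.
exists (fun x y z w => R (f x).1 (f y).1 (f z).1 (f w).1 /\ ((f x).2 + (f y).2 + (f z).2 + (f w).2 = 0)%R).
split; first exact: (design_preim f_bij (weight_design 'I_n.+1 dR)).
by move=> t x y z w [h sum0]; split; first exact: R_shift h.
Qed.

Variables (DU : 'I_u -> 'I_u -> 'I_u -> Prop) (RU : 'I_u -> 'I_u -> 'I_u -> 'I_u -> Prop).
Hypothesis dU : design DU RU.

Lemma edge_pair_shift (K : Type) (c : 'I_u -> 'I_u -> K) t x y z w :
  edge_pair (@neq_rel _) c x y z w -> edge_pair (@neq_rel _) c (shift t x) (shift t y) (shift t z) (shift t w).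
Proof. by case=> [[xy zw xz] exy ezw cE]; split=> //; split; rewrite /= ?xy ?zw // (inj_eq (addIr t)) -xy -zw. Qed.

Lemma invariant_fibred_design : exists R, design (@fibred_dom 'F_p 'I_u DU) R /\
  forall t x y z w, R x y z w -> R (shift t x) (shift t y) (shift t z) (shift t w).
Proof.
have [RH [dH RH_shift]] := transversal_design.
have [|K [c fc]] := @one_factorization_even 'I_u; first by rewrite card_ord.
exists (fibred_block c RU RH); split; first exact: (fibred_design fc dU dH).
move=> t x y z w [[xy xz xw h]|[h|h]].
- by left; split; rewrite /= -?xy -?xz -?xw.
- by right; left; case: h => /(edge_pair_shift t); [apply: Or31|apply: Or32|apply: Or33].
by right; right; apply: RH_shift.
Qed.

End InvariantFibredDesign.

Lemma card_distinct3 (T : finType) (x : T) :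
  #|[set q : T * T | distinct3 x q.1 q.2]| = (#|T| - 1) * (#|T| - 2).
Proof.
rewrite cardsE -(sum_pred (fun q : T * T => distinct3 x q.1 q.2)).
rewrite -(pair_bigA _ (fun y z => distinct3 x y z : nat)) /= (bigID (pred1 x)) /=.
rewrite big1 ?add0n => [|y /eqP ->]; last first.
  by rewrite big1 // => z _; rewrite /distinct3 eqxx.
rewrite (eq_bigr (fun=> #|T| - 2)) => [|y yx].
  by rewrite sum_nat_const subn1 -(cardC1 x).
rewrite (sum_pred (fun z => distinct3 x y z)) -(cardsC [set x; y]) cards2 eq_sym yx addKn -cardsE.
by apply: eq_card => z; rewrite !inE /distinct3 eq_sym yx negb_or !(eq_sym z).
Qed.

Definition fibred_triple (G U : eqType) (D : U -> U -> U -> bool) (x y z : G * U) : bool :=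
  if (x.1 == y.1) && (x.1 == z.1) then D x.2 y.2 z.2 else distinct3 x y z.

Lemma card_fibred_triple (G U : finType) (D : U -> U -> U -> bool) (x : G * U) :
  (forall a b c, D a b c -> distinct3 a b c) ->
  #|[set q : (G * U) * (G * U) | fibred_triple D x q.1 q.2]| =
    (#|{: G * U}| - 1) * (#|{: G * U}| - 2) - #|[set r : U * U | distinct3 x.2 r.1 r.2 && ~~ D x.2 r.1 r.2]|.
Proof.
move=> D_distinct; set missing := [set r : U * U | _].
pose f (r : U * U) := ((x.1, r.1), (x.1, r.2)).
have f_inj : injective f by move=> [a b] [a' b'] [-> ->].
have mem_f q : q \in f @: missing =
    [&& x.1 == q.1.1, x.1 == q.2.1, distinct3 x.2 q.1.2 q.2.2 & ~~ D x.2 q.1.2 q.2.2].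
  apply/imsetP/and3P => [[r]|]; first by rewrite inE => r_missing ->; rewrite !eqxx.
  by case: q => [[i a] [j b]] /= [/eqP <- /eqP <- ab]; exists (a, b); rewrite ?inE.
rewrite -(card_distinct3 x) -(card_imset _ f_inj).
have missing_sub : f @: missing \subset [set q | distinct3 x q.1 q.2].
  apply/subsetP => q; rewrite mem_f inE => /and4P [/eqP xy /eqP xz xyz _].
  by rewrite distinct3_fst.
rewrite -(setIidPr missing_sub) -cardsD; apply: eq_card => q; rewrite !inE mem_f /fibred_triple.
case: ifP => [/andP [/eqP xy /eqP xz]|not_same].
  rewrite (distinct3_fst xy xz) -xy -xz !eqxx /=.
  by case: (boolP (D _ _ _)) => [/D_distinct -> //|_]; rewrite andbT andNb.
by move: not_same; case: (x.1 == q.1.1) => //= ->.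
Qed.

Lemma ooc_of_fibre_design p u (U : finType) (D : U -> U -> U -> bool) (n : nat) :
  prime p -> odd p -> has_rosqs p -> ~~ odd u -> 0 < u -> #|U| = u ->
  has_design (fun x y z => D x y z) -> (forall x y z, D x y z -> distinct3 x y z) ->
  (forall x : U, #|[set r : U * U | distinct3 x r.1 r.2 && ~~ D x r.1 r.2]| = n) ->
  exists C : {set 'M[bool]_(u, p)}, is_OOC_4_2 C /\ 24 * #|C| = u * ((p * u - 1) * (p * u - 2) - n).
Proof.
move=> prime_p odd_p p_rosqs even_u u_gt0 U_card [RU dRU] D_distinct D_card.
have [b b_bij] : exists b : 'I_u -> U, bijective b by apply: card_bij; rewrite card_ord.
have b3 := distinct3_inj _ _ _ (bij_inj b_bij).
pose Du i j k : bool := D (b i) (b j) (b k).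
have Du_distinct i j k : Du i j k -> distinct3 i j k by move/D_distinct; rewrite b3.
have [R [dR R_shift]] := invariant_fibred_design prime_p odd_p p_rosqs even_u u_gt0 (design_preim b_bij dRU).
have dR' : design (fun x y z : 'F_p * 'I_u => fibred_triple Du x y z) R.
  by apply: eq_design dR => x y z; rewrite /fibred_dom /fibred_triple; case: ifP.
apply: (ooc_of_invariant_design prime_p odd_p dR' R_shift) => [x y z|i].
  rewrite /fibred_triple; case: ifP => // /andP [/eqP xy /eqP xz] /Du_distinct.
  by rewrite distinct3_fst.
rewrite card_fibred_triple // card_prod card_Fp // card_ord; congr (_ - _).
pose bb (r : 'I_u * 'I_u) := (b r.1, b r.2).
have bb_bij : bijective bb.
  by case: b_bij => b' bK b'K; exists (fun r => (b' r.1, b' r.2)) => -[i' j']; rewrite /bb /= ?bK ?b'K.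
rewrite -(D_card (b i)) -(on_card_preimset (onW_bij _ bb_bij)).
by apply: eq_card => r; rewrite !inE b3.
Qed.

Lemma perfect_ooc_exists p u : prime p -> odd p -> has_rosqs p -> u %% 6 \in [:: 2; 4] ->
  exists C : {set 'M[bool]_(u, p)}, is_perfect_OOC_4_2 C.
Proof.
move=> prime_p odd_p p_rosqs u6; have u_sqs := sqs_exists u6; rewrite !inE in u6.
have [||||i|C [C_ooc C_card]] := @ooc_of_fibre_design p u 'I_u (@distinct3 _) 0 prime_p odd_p p_rosqs _ _ _ u_sqs.
- by lia.
- by lia.
- exact: card_ord.
- by [].
- by apply: eq_card0 => r; rewrite inE andbN.
by exists C; split=> //; rewrite C_card subn0 mulnA [p * u]mulnC.
Qed.

Section GroupTransversal.
Variables G V W : eqType.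

Definition group_transversal (x y z : G * (V * W)) : bool :=
  [&& x.1 == y.1, x.1 == z.1 & distinct3 x.2.1 y.2.1 z.2.1].

Lemma group_transversal_distinct3 x y z : group_transversal x y z -> distinct3 x y z.
Proof.
have neq (a b : G * (V * W)) : a.2.1 != b.2.1 -> a != b by apply: contra_neq => ->.
by case/and3P => _ _ /and3P [xy xz yz]; rewrite /distinct3 !neq.
Qed.

End GroupTransversal.

Lemma card_group_transversal (G V W : finType) (x : G * (V * W)) :
  #|[set r : (G * (V * W)) * (G * (V * W)) | group_transversal x r.1 r.2]| =
    (#|V| - 1) * (#|V| - 2) * (#|W| * #|W|).
Proof.
pose f (r : (V * V) * (W * W)) := ((x.1, (r.1.1, r.2.1)), (x.1, (r.1.2, r.2.2))).
have f_inj : injective f by move=> [[a b] [i j]] [[a' b'] [i' j']] [-> -> -> ->].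
rewrite -(card_distinct3 x.2.1) -card_prod -[#|{: W * W}|]cardsT -cardsX -(card_imset _ f_inj).
apply: eq_card => r; rewrite inE; apply/idP/imsetP => [|[q]].
  case: r => [[a [v w]] [b [v' w']]] /= /and3P /= [/eqP <- /eqP <- vv'].
  by exists ((v, v'), (w, w')); rewrite // !inE /= vv'.
by rewrite !inE andbT => q_distinct ->; rewrite /group_transversal /= !eqxx.
Qed.

Lemma edge_and_point_bool (V : eqType) (a b c : V * bool) :
  edge_and_point_dom (@neq_rel bool) a b c <-> distinct3 a b c && ~~ distinct3 a.1 b.1 c.1.
Proof.
split=> [abc|/andP [abc not_transversal]].
  have /andP [-> _] : gdom a b c by apply/gdomE; left.
  exact: edge_and_point_not_transversal abc.
suff /gdomE [//|transversal] : gdom a b c by rewrite transversal in not_transversal.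
rewrite /gdom abc /=; apply/negP => /andP [/eqP ab /eqP ac].
by move: abc; rewrite (distinct3_fst ab ac); case: a.2 b.2 c.2 => [] [] [].
Qed.

Lemma packing_design (G V : eqType) : gdes G (V * bool)%type ->
  has_design (fun x y z : G * (V * bool) => distinct3 x y z && ~~ group_transversal x y z).
Proof.
move=> G_design; have [|K [c fc]] := @one_factorization_even bool; first by rewrite card_bool.
have group_design := fibre_design G (edge_pair_design V fc).
apply: eq_has_design (has_design_union _ G_design (ex_intro _ _ group_design)) => x y z; last first.
  by move=> /andP [_ not_same] [xy xz _]; case/negP: not_same; rewrite -xy -xz !eqxx.
rewrite /gdom /group_transversal; split=> [[/andP [-> not_same]|[xy xz /edge_and_point_bool]]|/andP [xyz]].
- by move: not_same; rewrite !negb_and => /orP [->|->]; rewrite ?orbT.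
- by case/andP => xyz not_transversal; rewrite -xy -xz !eqxx /= not_transversal andbT distinct3_fst.
case: (boolP ((x.1 == y.1) && (x.1 == z.1))) => [/andP [/eqP xy /eqP xz]|not_same _]; last by left; rewrite xyz.
rewrite -xy -xz !eqxx /= => not_transversal; right; split=> //; apply/edge_and_point_bool.
by rewrite not_transversal andbT -distinct3_fst.
Qed.

Lemma Jstar_of_count u p s c : u * p = 6 * s -> 0 < s ->
  24 * c = u * ((u * p - 1) * (u * p - 2) - 8) -> c = Jstar u p.
Proof.
case: s => // s upE _; rewrite /Jstar upE.
have -> : 6 * s.+1 - 1 = 6 * s + 5 by lia.
have -> : 6 * s.+1 - 2 = 6 * s + 4 by lia.
have -> : (6 * s + 4) %/ 2 = 3 * s + 2 by lia.
pose x := 6 * (s * s) + 9 * s + 2.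
have -> : (6 * s + 5) * (6 * s + 4) - 8 = 6 * x by rewrite /x; lia.
have -> : (6 * s + 5) * (3 * s + 2) = x.+1 * 3 + 1 by rewrite /x; lia.
rewrite divnMDl // addn0 subn1 /= => cE.
have -> : u * x = c * 4 by lia.
by rewrite mulnK.
Qed.

Lemma Jstar_ooc_exists p u : prime p -> odd p -> has_rosqs p -> u %% 6 = 0 ->
  exists C : {set 'M[bool]_(u, p)}, is_OOC_4_2 C /\ #|C| = Jstar u p.
Proof.
move=> prime_p odd_p p_rosqs u6; have [->|u_gt0] := posnP u.
  by exists set0; split; rewrite ?cards0 //; split=> [A|A B r]; rewrite inE.
have [m uE] : exists m, u = 6 * m.+1 by exists (u %/ 6).-1; lia.
have U_card : #|{: 'I_m.+1 * ('I_3 * bool)}| = u by rewrite !card_prod card_bool !card_ord; lia.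
have U_design : has_design (fun x y z : 'I_m.+1 * ('I_3 * bool) => distinct3 x y z && ~~ group_transversal x y z).
  by apply/packing_design/gdes_card/gdes_exists; rewrite // card_prod card_bool !card_ord.
have [||x|C [C_ooc C_card]] := @ooc_of_fibre_design p u _ _ 8 prime_p odd_p p_rosqs _ u_gt0 U_card U_design.
- by lia.
- by move=> x y z /andP [].
- transitivity ((#|'I_3| - 1) * (#|'I_3| - 2) * (#|{: bool}| * #|{: bool}|)); last by rewrite card_bool card_ord.
  rewrite -(card_group_transversal x); apply: eq_card => r; rewrite !inE negb_and negbK andb_orr andbN /=.
  by apply: andb_idl => /group_transversal_distinct3.
have up : u * p = 6 * (m.+1 * p) by rewrite uE mulnA.
exists C; split=> //; apply: (Jstar_of_count up); first by rewrite muln_gt0 (prime_gt0 prime_p).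
by rewrite C_card [p * u]mulnC.
Qed.

Lemma has_rosqs_listed p : p \in [:: 37; 61; 73; 109; 157; 181; 229; 277] -> has_rosqs p /\ odd p.
Proof.
rewrite !inE; do ?[case/orP => [/eqP ->|]]; last move/eqP ->; split=> //.
- exact: has_rosqs_37.
- exact: has_rosqs_61.
- exact: has_rosqs_73.
- exact: has_rosqs_109.
- exact: has_rosqs_157.
- exact: has_rosqs_181.
- exact: has_rosqs_229.
exact: has_rosqs_277.
Qed.

Theorem theorem9p14 (p : nat) :
  prime p ->
  (p %% 12 = 7 \/ p \in [:: 37; 61; 73; 109; 157; 181; 229; 277]) ->
  (forall u : nat, (u %% 6 = 2 \/ u %% 6 = 4) ->
     exists C : {set 'M[bool]_(u, p)}, is_perfect_OOC_4_2 C) /\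
  (forall u : nat, u %% 6 = 0 ->
     exists C : {set 'M[bool]_(u, p)}, is_OOC_4_2 C /\ #|C| = Jstar u p).
Proof.
move=> prime_p p_ok; have [p_rosqs odd_p] : has_rosqs p /\ odd p.
  case: p_ok => [p7|/has_rosqs_listed //]; split; first exact: has_rosqs_7_mod_12.
  by lia.
split=> u u6; last exact: Jstar_ooc_exists.
by apply: perfect_ooc_exists => //; rewrite !inE; case: u6 => ->.
Qed.
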